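(* Let $A_0:\mathcal D(A_0)\subset H\to H$ be the operator defined in the context (linearization around $f_0(\rho)=2\arctan\rho$). Then $\sigma(A_0)=\sigma_c(A_0)=[0,\infty)$; in particular $\sigma_p(A_0)=\sigma_r(A_0)=\emptyset$.
   Context: $H:=L^2_w(0,1)$ with $w(\rho)=\frac{\rho^2}{(1-\rho^2)^2}$ and inner product $(u|v)_H=\int_0^1u\bar v\,w\,d\rho$. $AC_{\mathrm{loc}}(0,1)$ denotes functions absolutely continuous on every compact subinterval of $(0,1)$. Define $\mathcal D(A):=\{u\in H:\ u,\ \rho^2u'\in AC_{\mathrm{loc}}(0,1),\ \frac1w(-(\rho^2u')'+2u)\in H\}$ and $Au:=\frac1w(-(\rho^2u')'+2u)$. For $f_0(\rho)=2\arctan\rho$ put $g_0(\rho)=\frac{2(1-\rho^2)\cos(2f_0(\rho))-\rho^2-2(1-\rho^2)^2}{\rho^2}$ (which extends continuously to $[0,1]$), and define $\mathcal D(A_0):=\mathcal D(A)$, $A_0u:=Au+g_0u$. For a closed operator $T$ on a complex Banach space: $\sigma_p(T)$ is the set of eigenvalues; $\lambda\in\sigma_c(T)$ if $\lambda-T$ is injective, not surjective, with dense range; $\lambda\in\sigma_r(T)$ if $\lambda-T$ is injective with non-dense range; $\rho(T)$ is the set of $\lambda$ with $\lambda-T$ bijective; $\sigma(T)=\mathbb C\setminus\rho(T)$. *)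

(* Defs.v *)
From HB Require Import structures.
From mathcomp Require Import all_boot all_order all_algebra.
From mathcomp Require Import all_classical all_reals all_analysis.
From mathcomp Require Import complex.
Set Implicit Arguments. Unset Strict Implicit. Unset Printing Implicit Defensive.
Import Order.TTheory GRing.Theory Num.Theory.
Import numFieldNormedType.Exports.
Local Open Scope classical_set_scope.
Local Open Scope ring_scope.
Local Open Scope complex_scope.

Section Defs.
Variable R : realType.

Definition lt_ebar (a b : \bar R) : Prop := (a < b)%E.
Definition mu := (@lebesgue_measure R).

Definition I01 : set R := `]0, 1[.

Definition wt (x : R) : R := x ^+ 2 / (1 - x ^+ 2) ^+ 2.

Definition f0 (x : R) : R := 2 * atan x.
Definition g0 (x : R) : R :=
  (2 * (1 - x ^+ 2) * cos (2 * f0 x) - x ^+ 2 - 2 * (1 - x ^+ 2) ^+ 2) / x ^+ 2.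

Definition aeq (f g : R -> R[i]) : Prop := ae_eq mu I01 f g.

Definition Hnorm2 (f : R -> R[i]) : \bar R :=
  (\int[mu]_(x in I01) ((Normc.normc (f x)) ^+ 2 * wt x)%:E)%E.

Definition Hrep (f : R -> R[i]) : Prop :=
  measurable_fun I01 (fun x => complex.Re (f x)) /\
  measurable_fun I01 (fun x => complex.Im (f x)) /\
  (Hnorm2 f < +oo)%E.

(* f (defined a.e. on (0,1)) is an element of H = L^2_w(0,1) *)
Definition inH (f : R -> R[i]) : Prop := exists g, Hrep g /\ aeq f g.

Definition ACon (a b : R) (f : R -> R[i]) : Prop :=
  forall eps : R, 0 < eps -> exists2 delta : R, 0 < delta &
    forall (n : nat) (s t : nat -> R),
      (forall k, (k < n)%N -> a <= s k /\ s k <= t k /\ t k <= b) ->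
      (forall k, (k.+1 < n)%N -> t k <= s k.+1) ->
      \sum_(k < n) (t k - s k) < delta ->
      \sum_(k < n) Normc.normc (f (t k) - f (s k)) < eps.

Definition AC_loc (f : R -> R[i]) : Prop :=
  forall a b : R, 0 < a -> a <= b -> b < 1 -> ACon a b f.

Definition cder (f : R -> R[i]) (x : R) : R[i] :=
  Complex (derive1 (fun y => complex.Re (f y)) x) (derive1 (fun y => complex.Im (f y)) x).

Definition rho2du (u : R -> R[i]) : R -> R[i] := fun x => (x ^+ 2)%:C * cder u x.

Definition Aop (u : R -> R[i]) : R -> R[i] :=
  fun x => ((wt x)^-1)%:C * (- cder (rho2du u) x + 2 * u x).

Definition inDA (u : R -> R[i]) : Prop :=
  inH u /\ AC_loc u /\ AC_loc (rho2du u) /\ inH (Aop u).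

(* A_0 u = A u + g0 u,  D(A_0) = D(A) *)
Definition A0op (u : R -> R[i]) : R -> R[i] := fun x => Aop u x + (g0 x)%:C * u x.

Definition res_op (lam : R[i]) (u : R -> R[i]) : R -> R[i] :=
  fun x => lam * u x - A0op u x.

Definition A0_inj (lam : R[i]) : Prop :=
  forall u, inDA u -> aeq (res_op lam u) (fun=> 0) -> aeq u (fun=> 0).

Definition A0_surj (lam : R[i]) : Prop :=
  forall f, inH f -> exists u, inDA u /\ aeq (res_op lam u) f.

Definition A0_dense_range (lam : R[i]) : Prop :=
  forall f, Hrep f -> forall eps : R, 0 < eps ->
    exists u, inDA u /\ exists h, Hrep h /\ aeq (res_op lam u) h /\
      lt_ebar (Hnorm2 (fun x => (h x - f x)%R)) eps%:E.

Definition sigma_p (lam : R[i]) : Prop := ~ A0_inj lam.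
Definition sigma_c (lam : R[i]) : Prop :=
  A0_inj lam /\ ~ A0_surj lam /\ A0_dense_range lam.
Definition sigma_r (lam : R[i]) : Prop := A0_inj lam /\ ~ A0_dense_range lam.
Definition resolvent_set (lam : R[i]) : Prop := A0_inj lam /\ A0_surj lam.
Definition spectrum (lam : R[i]) : Prop := ~ resolvent_set lam.

End Defs.

(* Main.v *)
Require Import Defs.
From HB Require Import structures.
From mathcomp Require Import all_boot all_order all_algebra.
From mathcomp Require Import all_classical all_reals all_analysis.
From mathcomp Require Import measurable_realfun complex.
From mathcomp Require Import ring lra.
Set Implicit Arguments. Unset Strict Implicit. Unset Printing Implicit Defensive.
Import Order.TTheory GRing.Theory Num.Theory.
Import numFieldNormedType.Exports.
Local Open Scope classical_set_scope.
Local Open Scope ring_scope.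

(** Everything is reduced to real functions. An absolutely continuous function is a primitive of an
    integrable density (total variation is an absolutely continuous Stieltjes function, hence
    Radon-Nikodym applies), so the domain of [A] consists of solutions of a first order system.
    A weighted Hardy argument inverts [A] on [L^2_w]; as the homogeneous equation has no solution
    in [L^2_w], every element of the domain has the resulting decay at both ends, and all
    boundary terms vanish. Hence [A] is symmetric, and [A_0 >= 0] because [A_0] factorizes through
    the positive zero-energy function [x sqrt (1 - x^2) / (1 + x^2)].

    Off [[0, oo)], the operators [A + t (g0 - lam)], [0 <= t <= 1], have, after rotation by a fixed
    complex number, a uniformly positive real part, and invertibility propagates from [t = 0] to
    [t = 1] by Neumann series. For [lam >= 0], an energy estimate at [x = 1] shows that a solution
    of the homogeneous equation on [(c, 1)] that lies in [L^2_w] vanishes there. With [c = 0] this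
    gives injectivity, and then density of the range by symmetry. If [lam - A_0] were
    onto, solving with a right-hand side cut off at [c] would yield functions vanishing on [(c, 1)],
    and symmetry would force an explicit element of the domain to vanish at [c]. *)

(** * Absolutely continuous functions *)

(** In the variables [z = x u / sqrt (1 - x^2)] and [t = artanh x] the space [L^2_w] becomes
    [L^2 (0, oo)] and [A_0] becomes the Schrodinger operator [- z'' + V z] with
    [V = 2 (1 - x^2)^2 / x^2 + g0 + 1]. At infinity, that is near [x = 1], [V] is of the order of
    [1 - x^2], hence integrable in [t]; therefore solutions for [lam > 0] oscillate there like free
    waves and do not decay. The zero-energy function becomes [x^2 / (1 + x^2)], which tends to a
    nonzero constant at infinity: 0 is a borderline case and needs an argument of its own. The
    development keeps the variable [x], but its weights and energies are those of this half-line
    problem.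

    The obstacle is that the domain prescribes no boundary condition at either end, so that every
    limit at 0 or 1 has to be extracted from square integrability alone. *)

Section AbsolutelyContinuousSeq.
Context {R : realType}.
Implicit Types (F G : R -> R) (a b : R) (L : seq (R * R)).

(** Ordered lists rather than indexed families: an entry can be replaced in place by the consecutive
    pieces of a partition, which is how sums of increments are turned into sums of total
    variations. *)
Definition nonoverlapping a b L :=
  all (fun p => [&& a <= p.1, p.1 <= p.2 & p.2 <= b]) L && sorted (fun p q => p.2 <= q.1) L.

Definition total_length L : R := \sum_(p <- L) (p.2 - p.1).
Definition total_increment F L : R := \sum_(p <- L) `|F p.2 - F p.1|.

Definition abs_continuous a b F := forall eps : R, 0 < eps ->
  exists2 delta : R, 0 < delta & forall L, nonoverlapping a b L ->
    total_length L < delta -> total_increment F L < eps.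

Lemma total_length_cat L1 L2 :
  total_length (L1 ++ L2) = total_length L1 + total_length L2.
Proof. by rewrite /total_length big_cat. Qed.

Lemma total_increment_cat F L1 L2 :
  total_increment F (L1 ++ L2) = total_increment F L1 + total_increment F L2.
Proof. by rewrite /total_increment big_cat. Qed.

Fixpoint consecutive (x : R) (s : seq R) : seq (R * R) :=
  if s is y :: s' then (x, y) :: consecutive y s' else [::].

Lemma total_length_consecutive x s :
  total_length (consecutive x s) = last x s - x.
Proof.
rewrite /total_length; elim: s x => [|y s IH] x /=; first by rewrite big_nil subrr.
by rewrite big_cons IH /=; ring.
Qed.

Lemma variation_consecutive F a b s : itv_partition a b s ->
  variation a b F s = total_increment F (consecutive a s).
Proof.
move=> abs; rewrite variation_zip// /total_increment.
elim: s a {abs} => [|y s IH] a /=; first by rewrite !big_nil.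
by rewrite !big_cons/= IH.
Qed.

Lemma all_consecutive a b s : itv_partition a b s ->
  all (fun p => [&& a <= p.1, p.1 <= p.2 & p.2 <= b]) (consecutive a s).
Proof.
elim: s a => [//|y s IH] a [/= /andP[ay ys] lb].
have lys : y <= last y s.
  elim: s y ys {IH lb ay} => [//|z s IH] y /= /andP[yz zs].
  exact: le_trans (ltW yz) (IH _ zs).
rewrite lexx (ltW ay)/= -(eqP lb) lys /=.
have /IH := conj ys lb => /allP H; apply/allP => p /H /and3P[h1 h2 h3].
by rewrite (le_trans (ltW ay) h1) h2 (eqP lb) h3.
Qed.

Lemma path_consecutive a s (q : R * R) : (q.2 <= a) ->
  path (fun p r : R * R => p.2 <= r.1) q (consecutive a s).
Proof. by elim: s a q => [//|y s IH] a q qa /=; rewrite qa/= IH. Qed.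

Lemma last_consecutive a s (q : R * R) : q.2 <= a ->
   (last q (consecutive a s)).2 <= last a s.
Proof. by elim: s a q => [//|y s IH] a q qa //=; apply: IH. Qed.

Lemma sorted_cat_last (T : eqType) (r : rel T) (p : T) (L1 L2 : seq T) :
  sorted r (L1 ++ p :: L2) = sorted r (rcons L1 p) && path r p L2.
Proof.
by case: L1 => [//|q L1] /=; rewrite cat_path/= rcons_path andbA.
Qed.

Lemma nonoverlapping_refine a b L1 p L2 s :
  nonoverlapping a b (L1 ++ p :: L2) -> itv_partition p.1 p.2 s ->
  nonoverlapping a b ((L1 ++ consecutive p.1 s) ++ L2).
Proof.
case: p => x y /= /andP[]; rewrite all_cat /= => /andP[aL1 /andP[axyb aL2]].
rewrite sorted_cat_last => /andP[s1 s2] ps.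
have /= ac := all_consecutive ps.
move/and3P: axyb => [ax xy yb].
rewrite /nonoverlapping !all_cat aL1 aL2 andbT; apply/andP; split => /=.
  apply/allP => p /(allP ac)/and3P[h1 h2 h3].
  by rewrite (le_trans ax h1) h2 (le_trans h3 yb).
case: ps => ps /eqP ls.
have pL2 (q : R * R) : q.2 <= y -> path (fun p r => p.2 <= r.1) q L2.
  by case: L2 s2 {aL2} => //= r L2 /andP[yr ->] qy; rewrite (le_trans qy yr).
case: L1 s1 {aL1} => [|q L1] /=.
  move=> _; case: s ps ls {ac} => [|z s] /=.
    by move=> _ xy'; move: pL2; case: L2 {s2 aL2} => //= r L2 /(_ (y, y) (lexx _)) /andP[].
  move=> _ ls; rewrite cat_path path_consecutive//=.
  by apply: pL2; rewrite -ls; apply: last_consecutive.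
rewrite rcons_path => /andP[p1 p2].
by rewrite !cat_path p1 /= path_consecutive//= last_cat pL2// -ls; exact: last_consecutive.
Qed.

Lemma length_refine L1 p L2 s : itv_partition p.1 p.2 s ->
  total_length ((L1 ++ consecutive p.1 s) ++ L2) = total_length (L1 ++ p :: L2).
Proof.
case: p => x y /= [_ /eqP ls].
rewrite -[(x, y) :: L2]cat1s !total_length_cat total_length_consecutive ls.
by rewrite [total_length [:: _]]big_seq1 /=; ring.
Qed.

(** The modulus of continuity passes to the total variation with the same [delta]. [L1] collects the
    intervals already cut by a fixed partition, [L2] those still measured by their total variation.
    The supremum over partitions is taken for one interval at a time, which is why the bounds are
    not strict. *)
Lemma total_variation_sum_le F a b (eps delta : R) :
  (forall L, nonoverlapping a b L -> total_length L < delta ->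
     total_increment F L <= eps) ->
  forall L2 L1, nonoverlapping a b (L1 ++ L2) -> total_length (L1 ++ L2) < delta ->
   ((total_increment F L1)%:E + \sum_(p <- L2) total_variation p.1 p.2 F <= eps%:E)%E.
Proof.
move=> H; elim=> [|p L2 IH] L1 nL lL.
  by rewrite big_nil adde0 lee_fin; apply: H; rewrite cats0 in nL lL.
have /andP[+ _] := nL; rewrite all_cat/= => /andP[_ /andP[/and3P[ap pp pb] aL2]].
have S0 : (0 <= \sum_(p <- L2) total_variation p.1 p.2 F)%E.
  rewrite big_seq; apply: sume_ge0 => q qL; apply: total_variation_ge0.
  by move/allP: aL2 => /(_ _ qL) /and3P[].
have IHs s : itv_partition p.1 p.2 s ->
  ((total_increment F L1 + variation p.1 p.2 F s)%:E +
    \sum_(p <- L2) total_variation p.1 p.2 F <= eps%:E)%E.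
  move=> ps; rewrite variation_consecutive// -total_increment_cat.
  by apply: IH; [exact: nonoverlapping_refine|rewrite length_refine].
(* Any partition will do: it only serves to show that the remaining sum is finite, so that it may be
   moved across the inequality before the supremum over [s] is taken. *)
have [s0 ps0] : exists s, itv_partition p.1 p.2 s.
  move: pp; rewrite le_eqVlt => /orP[/eqP ->|pp].
    by exists [::]; split => //=.
  by exists [:: p.2]; exact: itv_partition1.
have Sfin : (\sum_(p <- L2) total_variation p.1 p.2 F)%E \is a fin_num.
  rewrite ge0_fin_numE//; have := IHs _ ps0.
  by case: (\sum_(_ <- _) _)%E => //= r; rewrite ?ltry.
rewrite big_cons addeCA -leeBrDr ?fin_numD ?Sfin//.
apply: ge_ereal_sup => _ [_ [s ps <-] <-].
rewrite leeBrDr ?fin_numD ?Sfin// addeA -EFinD [X in X%:E]addrC.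
exact: IHs.
Qed.

End AbsolutelyContinuousSeq.

(** * Densities of monotone absolutely continuous functions *)

Section MonotoneDensity.
Context {R : realType}.
Implicit Types (a b : R).
Notation mu := (@lebesgue_measure R).

Lemma stieltjes_itvoc (G : cumulative R R) (x y : R) : x <= y ->
  lebesgue_stieltjes_measure G `]x, y] = (G y - G x)%:E.
Proof.
move=> xy; rewrite /lebesgue_stieltjes_measure /measure_extension/=.
rewrite measurable_mu_extE/=; last exact: is_ocitv.
rewrite wlength_itv/= lte_fin -EFinB.
by move: xy; rewrite le_eqVlt => /orP[/eqP ->|->//]; rewrite ltxx subrr.
Qed.

(** Components of an open cover may stick out of []a, b]] and have to be trimmed. The infimum of the
    trimmed set is not attained, since [I] is open and []a, b]] is open on the left; the supremum
    may be attained at [b]. Hence an interval closed on the right, the kind on which a Stieltjes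
    measure is known. *)
Lemma open_interval_hull (I : set R) a b : open I -> is_interval I -> a <= b ->
  exists st : R * R, [/\ a <= st.1, st.1 <= st.2, st.2 <= b,
    `]st.1, st.2[ `<=` I & I `&` `]a, b] `<=` `]st.1, st.2]].
Proof.
move=> oI iI ab; set J := I `&` `]a, b].
have [J0|/set0P [z0 Jz0]] := eqVneq J set0.
  exists (a, a); split => //=; last by rewrite J0.
  by rewrite set_itv_ge ?bnd_simp ?ltxx//.
have lJ : has_lbound J.
  by exists a => z [_ /=]; rewrite in_itv/= => /andP[/ltW].
have uJ : has_ubound J.
  by exists b => z [_ /=]; rewrite in_itv/= => /andP[].
have infJ z : J z -> inf J <= z by move=> Jz; apply: ge_inf.
have supJ z : J z -> z <= sup J by move=> Jz; apply: ub_le_sup.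
exists (inf J, sup J) => /=; split.
- apply: lb_le_inf; first by exists z0.
  by move=> z [_ /=]; rewrite in_itv/= => /andP[/ltW].
- exact: le_trans (infJ _ Jz0) (supJ _ Jz0).
- apply: ge_sup; first by exists z0.
  by move=> z [_ /=]; rewrite in_itv/= => /andP[].
- move=> z /=; rewrite in_itv/= => /andP[iz zs].
  have [u Ju uz] : exists2 u, J u & u < z by apply: inf_lt => //; exists z0.
  have [v Jv zv] : exists2 v, J v & z < v by apply: sup_gt => //; exists z0.
  by apply: (iI u v); [case: Ju|case: Jv|rewrite (ltW uz) (ltW zv)].
- move=> z Jz; rewrite /= in_itv/= supJ// andbT.
  case: Jz => Iz /=; rewrite in_itv/= => /andP[az zb].
  move: oI => /(_ z Iz) /nbhs_ballP[e /= e0 be].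
  pose d := Num.min (e / 2) ((z - a) / 2).
  have d0 : 0 < d by rewrite lt_min !divr_gt0// subr_gt0.
  have de : d <= e / 2 by rewrite ge_min lexx.
  have dz : d <= (z - a) / 2 by rewrite ge_min lexx orbT.
  apply: (@le_lt_trans _ _ (z - d)); last by lra.
  apply: infJ; split.
    by apply: be; rewrite /ball/= opprD addrA subrr sub0r opprK gtr0_norm//; lra.
  by rewrite /= in_itv/=; apply/andP; split; lra.
Qed.

(** Radon-Nikodym for the Stieltjes measure of [G] restricted to []a, b]]. Domination by Lebesgue
    measure: a null set has an open neighbourhood of measure below [delta], and any finitely many of
    its components, trimmed and sorted, form a list to which the hypothesis applies. *)
Lemma monotone_density (G : cumulative R R) a b : a <= b ->
  (forall eps : R, 0 < eps -> exists2 delta : R, 0 < delta & forall L,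
     nonoverlapping a b L -> total_length L < delta ->
     total_increment G L <= eps) ->
  exists g : R -> R, mu.-integrable setT (EFin \o g) /\
    forall x y, a <= x -> x <= y -> y <= b ->
      G y - G x = \int[mu]_(t in `]x, y]) g t.
Proof.
move=> ab acG.
have mab : measurable (`]a, b]%classic : set (measurableTypeR R)).
  exact: (measurable_itv `]a, b]).
pose nuG := lebesgue_stieltjes_measure G.
have nuab : (nuG `]a, b]%classic < +oo)%E by rewrite /nuG stieltjes_itvoc// ltry.
pose nu : {finite_measure set (measurableTypeR R) -> \bar R} := mfrestr mab nuab.
have numu : nu `<< mu.
  apply/null_content_dominatesP => N mN N0.
  apply/eqP; rewrite eq_le measure_ge0 andbT.
  apply/lee_addgt0Pr => e e0; rewrite add0e.
  have [d d0 Hd] := acG _ e0.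
  have [U [oU NU]] := lebesgue_regularity_outer mN
     (eq_ind_r (fun z => z < +oo)%E (ltry 0) N0) d0.
  move=> muU.
  have mU : measurable U by exact: open_measurable.
  have {}muU : (mu U < d%:E)%E.
    rewrite -(setDUK NU) measureU//; last 2 first.
      exact: measurableD.
      by rewrite setDE setICA setICr setI0.
    by rewrite N0 add0e.
  apply: (@le_trans _ _ (nu U)); first by apply: le_measure => //; rewrite inE.
  have [I [oI trI UI]] := OpenSetDisjointItvs.open_disjoint_itv oU.
  have /choice[st Hst] k := open_interval_hull (oI k).1 (oI k).2 ab.
  have mI k : measurable (I k) by apply: open_measurable; exact: (oI k).1.
  have mUI : measurable (\bigcup_q I q) by rewrite -UI.
  rewrite {1}UI (measure_semi_bigcup nu mI trI mUI).
  apply: lime_le; first by apply: is_cvg_nneseries => n _ _; exact: measure_ge0.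
  apply: nearW => n.
  have nuI k : (nu (I k) <= (G (st k).2 - G (st k).1)%:E)%E.
    have [h1 h2 h3 h4 h5] := Hst k.
    rewrite -stieltjes_itvoc// /nu/= /mfrestr /mrestr; apply: le_measure => //=.
      by rewrite inE; apply: measurableI; [exact: mI|exact: mab].
    by rewrite inE; exact: (measurable_itv `](st k).1, (st k).2]).
  apply: (le_trans (lee_sum _ (fun k _ => nuI k))).
  rewrite sumEFin lee_fin.
  (* Degenerate intervals are dropped before sorting: for nondegenerate ones, an overlap in the
     order of left endpoints would yield a common point of two disjoint components. *)
  pose idx := sort (fun i j => (st i).1 <= (st j).1)
     [seq k <- index_iota 0 n | (st k).1 < (st k).2].
  have pidx : perm_eq idx [seq k <- index_iota 0 n | (st k).1 < (st k).2].
    by rewrite perm_sort.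
  have uidx : uniq idx by rewrite (perm_uniq pidx) filter_uniq// iota_uniq.
  have aidx : all (fun k => (st k).1 < (st k).2) idx.
    by rewrite (perm_all _ pidx) filter_all.
  pose L := map st idx.
  have nov : nonoverlapping a b L.
    rewrite /nonoverlapping /L; apply/andP; split.
      apply/allP => p /mapP[k kidx ->]; have [h1 h2 h3 h4 h5] := Hst k.
      by rewrite h1 h2 h3.
    rewrite sorted_map; apply: pairwise_sorted.
    have : pairwise (fun i j => (st i).1 <= (st j).1) idx.
      rewrite -sorted_pairwise; last by move=> i j k; exact: le_trans.
      by apply: sort_sorted => i j; exact: le_total.
    move: uidx; rewrite uniq_pairwise => uidx pi.
    have := conj pi uidx => /andP; rewrite -pairwise_relI.
    apply: (@sub_in_pairwise _ (fun k => (st k).1 < (st k).2)) => //.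
    move=> i j si sj /andP[sij /= ij].
    rewrite leNgt; apply/negP => tij.
    have [_ _ _ hi _] := Hst i; have [_ _ _ hj _] := Hst j.
    pose m := Num.min (st i).2 (st j).2.
    have sm : (st j).1 < m by rewrite lt_min tij.
    have mi : m <= (st i).2 by rewrite ge_min lexx.
    have mj : m <= (st j).2 by rewrite ge_min lexx orbT.
    move/trivIsetP: trI => /(_ i j Logic.I Logic.I ij).
    rewrite -subset0 => /(_ (((st j).1 + m) / 2)); apply; split.
      by apply: hi; rewrite /= in_itv/=; apply/andP; split; lra.
    by apply: hj; rewrite /= in_itv/=; apply/andP; split; lra.
  have sumL (H : R * R -> R) : (forall k, (st k).1 = (st k).2 -> H (st k) = 0) ->
      \sum_(0 <= k < n) H (st k) = \sum_(p <- L) H p.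
    move=> H0; rewrite /L big_map (perm_big _ pidx) /= big_filter.
    rewrite [RHS]big_mkcond/=; apply: eq_bigr => k _.
    case: ifPn => //; rewrite -leNgt => h; apply: H0.
    by apply/eqP; rewrite eq_le h; have [_ ->] := Hst k.
  rewrite (sumL (fun p => G p.2 - G p.1)); last by move=> k ->; rewrite subrr.
  have -> : \sum_(p <- L) (G p.2 - G p.1) = total_increment G L.
    rewrite /total_increment big_seq [RHS]big_seq; apply: eq_bigr => p pL.
    rewrite ger0_norm// subr_ge0; apply: cumulative_is_nondecreasing.
    by move/andP: nov => [/allP/(_ p pL)/and3P[]].
  apply: Hd => //; rewrite /total_length -(sumL (fun p => p.2 - p.1)); last first.
    by move=> k ->; rewrite subrr.
  rewrite -lte_fin (le_lt_trans _ muU)// -sumEFin.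
  have -> : (\sum_(0 <= k < n) ((st k).2 - (st k).1)%:E =
             \sum_(0 <= k < n) mu `](st k).1, (st k).2[%classic)%E.
    apply: eq_bigr => k _; have [_ h _ _ _] := Hst k.
    rewrite lebesgue_measure_itv/= lte_fin -EFinB.
    by move: h; rewrite le_eqVlt => /orP[/eqP ->|->//]; rewrite ltxx subrr.
  apply: (@le_trans _ _ (\sum_(0 <= k < n) mu (I k))%E).
    apply: lee_sum => k _; have [_ _ _ h _] := Hst k.
    apply: le_measure => //; rewrite inE; last exact: mI.
    exact: (measurable_itv `](st k).1, (st k).2[).
  rewrite UI (measure_semi_bigcup mu mI trI mUI).
  by apply: nneseries_lim_ge => k _ _; exact: measure_ge0.
pose f := Radon_Nikodym_SigmaFinite.f nu mu.
have fi := Radon_Nikodym_SigmaFinite.f_integrable numu.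
have ff x : f x = (fine (f x))%:E.
  by rewrite fineK//; exact: Radon_Nikodym_SigmaFinite.f_fin_num.
exists (fine \o f); split.
  by apply: eq_integrable fi => //= x _; rewrite -ff.
move=> x y ax xy yb.
have mxy : measurable (`]x, y]%classic : set (measurableTypeR R)).
  exact: (measurable_itv `]x, y]).
have : nu `]x, y]%classic = (G y - G x)%:E.
  rewrite /nu/= /mfrestr /mrestr/= setIidl; first exact: stieltjes_itvoc.
  move=> z /=; rewrite !in_itv/= => /andP[xz zy].
  by rewrite (le_lt_trans ax xz) (le_trans zy yb).
rewrite (Radon_Nikodym_SigmaFinite.f_integral numu mxy) /Rintegral.
rewrite -/f => fE; have -> : (\int[mu]_(t in `]x, y]) ((fine \o f) t)%:E =
    \int[mu]_(t in `]x, y]) f t)%E.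
  by apply: eq_integral => t _; rewrite [RHS]ff.
by rewrite fE.
Qed.

End MonotoneDensity.

(** * Total variation and density of an absolutely continuous function *)

Section ClampedTotalVariation.
Context {R : realType}.
Variables (F : R -> R) (a b : R).
Hypothesis ab : a <= b.
Hypothesis acF : abs_continuous a b F.
Notation mu := (@lebesgue_measure R).

(** A [cumulative] function lives on the whole line, so [F] is extended by constants outside
    [[a, b]]. *)
Definition clamp (x : R) := Num.max a (Num.min b x).

Lemma clamp_ge x : a <= clamp x.
Proof. by rewrite le_max lexx. Qed.

Lemma clamp_le x : clamp x <= b.
Proof. by rewrite ge_max ab ge_min lexx. Qed.

Lemma clamp_id x : a <= x -> x <= b -> clamp x = x.
Proof. by move=> ax xb; rewrite /clamp (min_idPr xb) (max_idPr ax). Qed.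

Lemma clamp_nd x y : x <= y -> clamp x <= clamp y.
Proof.
move=> xy; rewrite ge_max le_max lexx/= le_max.
by rewrite (_ : Num.min b x <= Num.min b y) ?orbT// le_min ge_min lexx/= ge_min xy orbT.
Qed.

Lemma clamp_dist x y : x <= y -> clamp y - clamp x <= y - x.
Proof.
move=> xy; rewrite /clamp /Num.max /Num.min.
by do 4! case: ifPn => //; rewrite -?leNgt; move: xy ab; lra.
Qed.

Lemma abs_continuous_small : exists2 delta : R, 0 < delta & forall x y,
  a <= x -> x <= y -> y <= b -> y - x < delta ->
  (total_variation x y F <= 1)%E.
Proof.
have [d d0 Hd] := acF ltr01; exists d => // x y ax xy yb xyd.
have := @total_variation_sum_le R F a b 1 d (fun L nL lL => ltW (Hd L nL lL))
  [:: (x, y)] [::].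
rewrite /total_increment big_nil add0e big_seq1; apply => //=.
  by rewrite /nonoverlapping/= ax xy yb.
by rewrite /total_length big_seq1.
Qed.

(** The interval is exhausted by finitely many steps of length [d / 2], each contributing a
    variation of at most 1. *)
Lemma total_variation_fin x : a <= x -> x <= b -> total_variation a x F \is a fin_num.
Proof.
have [d d0 Hd] := abs_continuous_small.
suff H n y : a <= y -> y <= b -> y - a <= (d / 2) *+ n ->
    total_variation a y F \is a fin_num.
  move=> ax xb; have := archi_boundP (divr_ge0 (eqbRL (subr_ge0 a x) ax)
     (ltW (divr_gt0 d0 (ltr0Sn R 1)))) => /ltW.
  rewrite ler_pdivrMr ?divr_gt0// => h; apply: (H (Num.bound ((x - a) / (d / 2)))) => //.
  by rewrite -mulr_natl.
elim: n y => [|n IH] y ay yb.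
  rewrite mulr0n subr_le0 => ya; have -> : y = a by apply/eqP; rewrite eq_le ay ya.
  by rewrite total_variationxx.
rewrite mulrS => yd.
pose z := Num.max a (y - d / 2).
have az : a <= z by rewrite le_max lexx.
have zy : z <= y by rewrite ge_max ay/=; lra.
rewrite (total_variationD F az zy) fin_numD; apply/andP; split.
  apply: IH => //; first exact: le_trans zy yb.
  have : 0 <= (d / 2) *+ n by rewrite mulrn_wge0// ltW// divr_gt0.
  by rewrite /z /Num.max; case: ifPn; rewrite -?leNgt; move: yd ay; lra.
have yz : y - z < d by rewrite /z /Num.max; case: ifPn; rewrite -?leNgt; lra.
rewrite ge0_fin_numE ?total_variation_ge0//.
by apply: (le_lt_trans (Hd _ _ az zy yb yz)); rewrite ltry.
Qed.

Definition clamped_variation x := fine (total_variation a (clamp x) F).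

Lemma clamped_variationB x y : x <= y ->
  ((clamped_variation y - clamped_variation x)%:E =
    total_variation (clamp x) (clamp y) F)%E.
Proof.
move=> xy; have cxy := clamp_nd xy; have ax := clamp_ge x.
have fx := total_variation_fin (clamp_ge x) (clamp_le x).
have fy := total_variation_fin (clamp_ge y) (clamp_le y).
rewrite EFinB !fineK// (total_variationD F ax cxy).
by rewrite addeAC subee// add0e.
Qed.

Lemma clamped_increment_le x y : x <= y ->
  `|F (clamp y) - F (clamp x)| <= clamped_variation y - clamped_variation x.
Proof.
move=> xy; rewrite -lee_fin clamped_variationB//.
exact/total_variation_ge/clamp_nd.
Qed.

Lemma clamped_variation_ac (eps : R) : 0 < eps ->
  exists2 delta : R, 0 < delta & forall L, nonoverlapping a b L ->
    total_length L < delta -> total_increment clamped_variation L <= eps.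
Proof.
move=> e0; have [d d0 Hd] := acF e0; exists d => // L nL lL.
have := total_variation_sum_le (fun L nL lL => ltW (Hd L nL lL)) (L2 := L) (L1 := [::]) nL lL.
rewrite /total_increment big_nil add0e.
have -> : (\sum_(p <- L) total_variation p.1 p.2 F =
    \sum_(p <- L) `|clamped_variation p.2 - clamped_variation p.1|%:E)%E.
  rewrite big_seq [RHS]big_seq; apply: eq_bigr => p pL.
  move: nL => /andP[/allP/(_ p pL)/and3P[ap pp pb] _].
  rewrite ger0_norm; last by apply: le_trans (clamped_increment_le pp).
  by rewrite clamped_variationB// !clamp_id// ?(le_trans pp) ?(le_trans ap).
by rewrite sumEFin lee_fin.
Qed.

(** The Jordan decomposition with a parameter: [c = 0] and [c = 1] give two nondecreasing functions
    whose difference is [F], and both are handled by the same lemmas. *)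
Definition shifted_variation (c x : R) := clamped_variation x + c * F (clamp x).

Lemma shifted_increment c x y : `|c| <= 1 -> x <= y ->
  0 <= shifted_variation c y - shifted_variation c x
    <= 2 * (clamped_variation y - clamped_variation x).
Proof.
move=> c1 xy; have := clamped_increment_le xy.
have -> : shifted_variation c y - shifted_variation c x =
  (clamped_variation y - clamped_variation x) + c * (F (clamp y) - F (clamp x)).
  by rewrite /shifted_variation; ring.
move: (clamped_variation y - _) (F _ - F _) => p q qp.
have cq : `|c * q| <= p.
  by rewrite normrM (le_trans _ qp)// ler_piMl.
by move: cq; rewrite ler_norml => /andP[h1 h2]; apply/andP; split; lra.
Qed.

Lemma shifted_nd c : `|c| <= 1 -> nondecreasing (shifted_variation c).
Proof.
by move=> c1 x y xy; have /andP[] := shifted_increment c1 xy; rewrite subr_ge0.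
Qed.

Lemma shifted_rc c : `|c| <= 1 -> right_continuous (shifted_variation c).
Proof.
move=> c1 x; apply/cvgrPdist_le => e e0.
have [d d0 Hd] := clamped_variation_ac (divr_gt0 e0 (ltr0Sn R 1)).
near=> y.
have xy : x <= y by near: y; exact: nbhs_right_ge.
have yd : y < x + d by near: y; apply: nbhs_right_lt; rewrite ltrDl.
have /andP[h1 h2] := shifted_increment c1 xy.
rewrite distrC ger0_norm// (le_trans h2)//.
have := Hd [:: (clamp x, clamp y)].
rewrite /nonoverlapping/= clamp_ge clamp_le clamp_nd// => /(_ erefl).
rewrite /total_length /total_increment !big_seq1/=.
have cc z : clamped_variation (clamp z) = clamped_variation z.
  by rewrite /clamped_variation (clamp_id (clamp_ge z) (clamp_le z)).
rewrite !cc => h3.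
have : clamp y - clamp x < d by rewrite (le_lt_trans (clamp_dist xy))//; move: yd; lra.
move=> /h3; rewrite ger0_norm; first lra.
exact: le_trans (clamped_increment_le xy).
Unshelve. all: by end_near. Qed.

Lemma shifted_density c : `|c| <= 1 ->
  exists g : R -> R, mu.-integrable setT (EFin \o g) /\
    forall x y, a <= x -> x <= y -> y <= b ->
      shifted_variation c y - shifted_variation c x = \int[mu]_(t in `]x, y]) g t.
Proof.
move=> c1.
pose G : cumulative R R := HB.pack (shifted_variation c)
  (isCumulative.Build R _ R (shifted_variation c) (shifted_nd c1) (shifted_rc c1)).
apply: (@monotone_density R G a b ab) => e e0.
have [d d0 Hd] := clamped_variation_ac (divr_gt0 e0 (ltr0Sn R 1)).
exists d => // L nL lL.
have h : total_increment G L <= 2 * total_increment clamped_variation L.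
  rewrite /total_increment mulr_sumr big_seq [leRHS]big_seq.
  apply: ler_sum => p pL.
  move: nL => /andP[/allP/(_ p pL)/and3P[ap pp pb] _].
  have /andP[h1 h2] := shifted_increment c1 pp.
  rewrite ger0_norm// ger0_norm//.
  exact: le_trans (clamped_increment_le pp).
apply: (le_trans h); have := Hd _ nL lL; lra.
Qed.

Lemma abs_continuous_density :
  exists g : R -> R, mu.-integrable setT (EFin \o g) /\
    forall x y, a <= x -> x <= y -> y <= b ->
      F y - F x = \int[mu]_(t in `]x, y]) g t.
Proof.
have [g0 [ig0 Hg0]] : exists g : R -> R, mu.-integrable setT (EFin \o g) /\
    forall x y, a <= x -> x <= y -> y <= b ->
      shifted_variation 0 y - shifted_variation 0 x = \int[mu]_(t in `]x, y]) g t.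
  by apply: shifted_density; rewrite normr0.
have [g1 [ig1 Hg1]] : exists g : R -> R, mu.-integrable setT (EFin \o g) /\
    forall x y, a <= x -> x <= y -> y <= b ->
      shifted_variation 1 y - shifted_variation 1 x = \int[mu]_(t in `]x, y]) g t.
  by apply: shifted_density; rewrite normr1.
exists (fun x => g1 x - g0 x); split.
  by apply: eq_integrable (integrableB measurableT ig1 ig0) => //= x _; rewrite EFinB.
move=> x y ax xy yb.
have mxy : measurable (`]x, y]%classic : set R) by exact: measurable_itv.
rewrite RintegralB//; last 2 first.
  exact: integrableS ig1.
  exact: integrableS ig0.
rewrite -Hg0// -Hg1// /shifted_variation !clamp_id ?(le_trans ax xy) ?(le_trans xy yb)//.
ring.
Qed.

End ClampedTotalVariation.

(** * Rules for pointwise derivatives *)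

Section RealDerivatives.
Context {R : realType}.
Implicit Types (F G : R -> R) (x a b : R).

Lemma derive_const c x : is_derive x 1 (fun=> c : R) (0 : R).
Proof. exact: is_derive_cst. Qed.

Lemma derive_var x : is_derive x 1 (fun y : R => y) (1 : R).
Proof. exact: is_derive_id. Qed.

Lemma derive_add F G x a b : is_derive x 1 F a -> is_derive x 1 G b ->
  is_derive x 1 (fun y => F y + G y) (a + b).
Proof. exact: is_deriveD. Qed.

Lemma derive_sub F G x a b : is_derive x 1 F a -> is_derive x 1 G b ->
  is_derive x 1 (fun y => F y - G y) (a - b).
Proof. exact: is_deriveB. Qed.

Lemma derive_mul F G x a b : is_derive x 1 F a -> is_derive x 1 G b ->
  is_derive x 1 (fun y => F y * G y) (a * G x + F x * b).
Proof.
move=> dF dG; have := is_deriveM dF dG.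
by rewrite /GRing.scale/= addrC [G x * a]mulrC.
Qed.

Lemma derive_inv F x a : is_derive x 1 F a -> F x != 0 ->
  is_derive x 1 (fun y => (F y)^-1) (- a / F x ^+ 2).
Proof.
move=> dF F0; have := is_deriveV F0 dF.
by rewrite /GRing.scale/= mulNr mulrC -mulNr.
Qed.

Lemma derive_sqr F x a : is_derive x 1 F a ->
  is_derive x 1 (fun y => F y ^+ 2) (2 * F x * a).
Proof. by move=> dF; have := derive_mul dF dF; move/is_derive_eq; apply; ring. Qed.

Lemma derive_ln F x a : is_derive x 1 F a -> 0 < F x ->
  is_derive x 1 (fun y => ln (F y)) (a / F x).
Proof.
move=> dF F0; have := is_derive1_comp (is_derive1_ln F0) dF.
by rewrite mulrC.
Qed.

Lemma derive_eq F x a b : is_derive x 1 F a -> a = b -> is_derive x 1 F b.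
Proof. by move=> + <-. Qed.

Lemma derive_pow n x : is_derive x 1 (fun y : R => y ^+ n) (n%:R * x ^+ n.-1).
Proof.
elim: n => [|n IH].
  have -> : (fun y : R => y ^+ 0) = (fun=> 1) by apply/funext => y; rewrite expr0.
  by rewrite mul0r; exact: derive_const.
have -> : (fun y : R => y ^+ n.+1) = (fun y => y * y ^+ n).
  by apply/funext => y; rewrite exprS.
apply: (derive_eq (derive_mul (derive_var x) IH)).
case: n {IH} => [|n] /=; first by rewrite !expr0; ring.
by rewrite -[n.+2]addn1 natrD exprS; ring.
Qed.

Lemma derive_continuous F x a : is_derive x 1 F a -> {for x, continuous F}.
Proof.
by move=> [dF _]; apply: differentiable_continuous; exact/derivable1_diffP.
Qed.

End RealDerivatives.

(** * Primitives of locally integrable functions on an open interval *)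

Section Antiderivatives.
Context {R : realType}.
Notation mu := (@lebesgue_measure R).
Implicit Types (F G f g : R -> R) (l r a b x y : R).

(** Integrability is asked only away from the ends, so [F] and [f] may blow up there, as powers of
    [1 / x] do at 0. All differential equations below take this form, in which [f] matters only up
    to null sets and products can be differentiated. *)
Definition antider l r F f := forall a b, l < a -> a <= b -> b < r ->
  mu.-integrable `]a, b] (EFin \o f) /\ F b - F a = \int[mu]_(t in `]a, b]) f t.

Lemma measurable_itvR (i : interval R) : measurable ([set` i] : set R).
Proof. exact: measurable_itv. Qed.
Hint Resolve measurable_itvR : core.

Lemma aeS (P Q : R -> Prop) : (forall x, P x -> Q x) ->
  {ae mu, forall x, P x} -> {ae mu, forall x, Q x}.
Proof. exact: (@filterS _ _ (ae_filter_ringOfSetsType mu)). Qed.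

Lemma aeS2 (P Q S : R -> Prop) : (forall x, P x -> Q x -> S x) ->
  {ae mu, forall x, P x} -> {ae mu, forall x, Q x} -> {ae mu, forall x, S x}.
Proof. exact: (@filterS2 _ _ (ae_filter_ringOfSetsType mu)). Qed.

Lemma ae_integrable (D : set R) f g : measurable D -> mu.-integrable D (EFin \o f) ->
  measurable_fun D g -> ae_eq mu D f g ->
  mu.-integrable D (EFin \o g) /\ \int[mu]_(t in D) f t = \int[mu]_(t in D) g t.
Proof.
move=> mD intf mg fg.
have mf : measurable_fun D (EFin \o f) by case/integrableP: intf.
have mg' : measurable_fun D (EFin \o g) by exact/measurable_EFinP.
have fg' : ae_eq mu D (EFin \o f) (EFin \o g).
  by move: fg; apply: filterS => x h Dx /=; rewrite h.
split; last by congr fine; exact: ae_eq_integral.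
apply/integrableP; split => //.
have -> : (\int[mu]_(x in D) `|(EFin \o g) x| = \int[mu]_(x in D) `|(EFin \o f) x|)%E.
  apply: ae_eq_integral => //; try exact: measurableT_comp.
  by move: fg; apply: filterS => x h Dx /=; rewrite h.
by case/integrableP: intf.
Qed.

Lemma near_shift_derive F G (c x : R) : {near x, (fun y => G y + c) =1 F} ->
  derivable G x 1 -> derivable F x 1 /\ derive1 F x = derive1 G x.
Proof.
move=> nF dG.
have dc : derivable (cst c : R -> R) x 1 by exact: derivable_cst.
have dGc : derivable (G + cst c) x 1 by exact: derivableD.
split; first exact: near_eq_derivable dGc.
by rewrite !derive1E -(near_eq_derive _ nF) (deriveD dG dc) derive_cst addr0.
Qed.

Lemma density_ae_derive F g a b : mu.-integrable setT (EFin \o g) ->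
  (forall x y, a <= x -> x <= y -> y <= b ->
      F y - F x = \int[mu]_(t in `]x, y]) g t) ->
  {ae mu, forall x, a < x < b -> derivable F x 1 /\ derive1 F x = g x}.
Proof.
move=> ig HF.
have loc : locally_integrable [set: R] g.
  by have := integrable_locally measurableT ig; rewrite patch_setT.
have igy y : mu.-integrable [set` Interval (BRight a) (BRight y)] (EFin \o g).
  exact: integrableS ig.
have := FTC1 igy loc; set P := fun y => _.
apply: aeS => x /= H /andP[ax xb].
have [dP EP] := H ax.
have nF : {near x, (fun y => P y + F a) =1 F}.
  have : \near x, a < x < b.
    near=> z; apply/andP; split; near: z; [exact: lt_nbhsr | exact: lt_nbhsl].
  apply: filterS => y /andP[ay yb]; by rewrite /P -(HF _ _ (lexx a) (ltW ay) (ltW yb)) subrK.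
by have [? ->] := near_shift_derive nF dP.
Unshelve. all: by end_near. Qed.

(** The abstract Radon-Nikodym density agrees almost everywhere with [derive1 F] by Lebesgue
    differentiation, so it may be replaced by the given [g]. *)
Lemma abs_continuous_antider l r F g :
  (forall a b, l < a -> a <= b -> b < r -> abs_continuous a b F) ->
  measurable_fun `]l, r[ g ->
  {ae mu, forall x, l < x < r -> derive1 F x = g x} -> antider l r F g.
Proof.
move=> acF mg Fg a b la ab br.
pose b' := (b + r) / 2.
have bb' : b < b' by rewrite /b'; lra.
have b'r : b' < r by rewrite /b'; lra.
have [g0 [ig0 Hg0]] := abs_continuous_density (le_trans ab (ltW bb'))
  (acF _ _ la (le_trans ab (ltW bb')) b'r).
have F0 := density_ae_derive ig0 Hg0.
rewrite (Hg0 a b)// ?ltW//.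
apply: ae_integrable => //.
- exact: integrableS ig0.
- apply: measurable_funS mg => // x /=; rewrite !in_itv/= => /andP[ax xb].
  by rewrite (lt_trans la ax) (le_lt_trans xb br).
- apply: (aeS2 _ Fg F0) => x h1 h2; rewrite /= in_itv/= => /andP[ax xb].
  have [_ <-] := h2 (introT andP (conj ax (le_lt_trans xb bb'))).
  by rewrite h1// (lt_trans la ax) (le_lt_trans xb br).
Qed.

(** [A] is the union of the intervals of [L]. The number [c] records where it begins, which makes it
    disjoint from the interval that the induction puts in front. *)
Lemma integral_cover_increment (F g : R -> R) a b :
  mu.-integrable setT (EFin \o g) ->
  (forall x y, a <= x -> x <= y -> y <= b ->
      F y - F x = \int[mu]_(t in `]x, y]) g t) ->
  forall L c, all (fun p => [&& a <= p.1, p.1 <= p.2 & p.2 <= b]) L ->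
    path (fun p q => p.2 <= q.1) (c, c) L ->
  exists A : set R, [/\ measurable A, A `<=` `]c, +oo[,
    mu A = (total_length L)%:E &
    total_increment F L <= \int[mu]_(t in A) `|g t|].
Proof.
move=> ig HF; elim=> [|p L IH] c /=.
  move=> _ _; exists set0; split => //.
    by rewrite measure0 /total_length big_nil.
  by rewrite /total_increment big_nil Rintegral_set0.
move=> /andP[/and3P[ap pp pb] aL] /andP[cp pL].
have [|A [mA Ap muA FA]] := IH p.2 aL.
  by case: L {IH aL} pL.
have mp : measurable (`]p.1, p.2] : set R) by [].
have pA : `]p.1, p.2] `&` A = set0.
  rewrite -subset0 => z [/=]; rewrite in_itv/= => /andP[_ zp] /Ap /=.
  by rewrite in_itv/= andbT ltNge zp.
have ign : mu.-integrable setT (EFin \o (fun t => `|g t|)).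
  by apply: eq_integrable (integrable_abse ig) => //.
exists (`]p.1, p.2] `|` A); split.
- exact: measurableU.
- move=> z [/=|/Ap /=]; rewrite !in_itv/= ?andbT.
    by move=> /andP[pz _]; exact: le_lt_trans pz.
  by apply: le_lt_trans; exact: le_trans pp.
- transitivity (mu `]p.1, p.2]%classic + mu A)%E; first exact: measureU.
  rewrite muA /total_length big_cons EFinD; congr (_ + _)%E.
  rewrite lebesgue_measure_itv/= lte_fin -EFinB.
  by move: pp; rewrite le_eqVlt => /orP[/eqP ->|->//]; rewrite ltxx subrr.
- rewrite Rintegral_setU//; last 2 first.
    by apply: integrableS ign => //; exact: measurableU.
    by apply/disj_setPS; rewrite pA.
  rewrite /total_increment big_cons lerD// HF//.
  by apply: le_normr_Rintegral => //; exact: integrableS ig.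
Qed.

Lemma antider_abs_continuous l r F g a b :
  antider l r F g -> l < a -> a <= b -> b < r -> abs_continuous a b F.
Proof.
move=> H la ab br e e0.
pose h := g \_ `]a, b].
have ih : mu.-integrable setT (EFin \o h).
  have [+ _] := H a b la ab br.
  by rewrite integrable_mkcond// /h restrict_EFin.
have Hh x y : a <= x -> x <= y -> y <= b -> F y - F x = \int[mu]_(t in `]x, y]) h t.
  move=> ax xy yb.
  have [_ ->] := H x y (lt_le_trans la ax) xy (le_lt_trans yb br).
  apply: eq_Rintegral => t; rewrite inE/= in_itv/= => /andP[xt ty].
  by rewrite /h patchE mem_set//= in_itv/= (le_lt_trans ax xt) (le_trans ty yb).
have [d [d0 Hd]] := integral_normr_continuous ih e0.
exists d => // L /andP[aL sL] lL.
have [|A [mA _ muA FA]] := integral_cover_increment ih Hh (L := L) (c := a) aL.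
  case: L sL aL {lL} => //= p L pL /andP[/and3P[ap pp pb] _].
  by rewrite ap.
apply: (le_lt_trans FA); apply: Hd => //.
exact: (eq_ind_r (fun z => z < d%:E)%E _ muA).
Qed.

Lemma antider_sub l r l' r' F g : l <= l' -> r' <= r ->
  antider l r F g -> antider l' r' F g.
Proof.
move=> ll rr H a b la ab br; apply: H => //.
  exact: le_lt_trans la.
exact: lt_le_trans rr.
Qed.

(** With [n + 3] each margin is at most a third of the interval, so that the pieces of the
    exhaustion are nonempty from [n = 0] on. *)
Lemma itv_exhaustion l r x : l < x < r -> exists n : nat,
  l + (r - l) / (n + 3)%:R < x < r - (r - l) / (n + 3)%:R.
Proof.
move=> /andP[lx xr].
pose m := Num.min (x - l) (r - x).
have m0 : 0 < m by rewrite lt_min !subr_gt0 lx xr.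
exists (Num.bound ((r - l) / m)).
have h : (r - l) / (Num.bound ((r - l) / m) + 3)%:R < m.
  rewrite ltr_pdivrMr ?ltr0n ?addn3// -ltr_pdivrMl// mulrC.
  apply: (lt_le_trans (archi_boundP _)).
    by rewrite divr_ge0// ?ltW// subr_gt0 (lt_trans lx).
  by rewrite ler_nat -addn3 leq_addr.
have m1 : m <= x - l by rewrite ge_min lexx.
have m2 : m <= r - x by rewrite ge_min lexx orbT.
by apply/andP; split; lra.
Qed.

Lemma itv_exhaustion_bounds l r (n : nat) : l < r ->
  [/\ l < l + (r - l) / (n + 3)%:R,
     l + (r - l) / (n + 3)%:R <= r - (r - l) / (n + 3)%:R &
     r - (r - l) / (n + 3)%:R < r].
Proof.
move=> lr.
have e0 : 0 < (r - l) / (n + 3)%:R by rewrite divr_gt0 ?subr_gt0// ltr0n addn3.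
have e1 : (r - l) / (n + 3)%:R <= (r - l) / 3.
  by rewrite ler_pM2l ?subr_gt0// lef_pV2 ?posrE ?ltr0n ?addn3// ler_nat.
by split; lra.
Qed.

Lemma antider_ae_derive l r F g : antider l r F g ->
  {ae mu, forall x, l < x < r -> derivable F x 1 /\ derive1 F x = g x}.
Proof.
move=> H.
have [rl|lr] := leP r l.
  by apply: aeW => x /andP[lx xr]; move: (lt_trans lx xr); rewrite ltNge rl.
have : {ae mu, forall x, forall n : nat, l + (r - l) / (n + 3)%:R < x < r - (r - l) / (n + 3)%:R ->
    derivable F x 1 /\ derive1 F x = g x}.
  apply: ae_foralln => n.
  set a := l + _; set b := r - _.
  have [la ab br] := itv_exhaustion_bounds n lr; rewrite -/a -/b in la ab br.
  pose h := g \_ `]a, b].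
  have ih : mu.-integrable setT (EFin \o h).
    have [+ _] := H a b la ab br.
    by rewrite integrable_mkcond// /h restrict_EFin.
  have Hh x y : a <= x -> x <= y -> y <= b -> F y - F x = \int[mu]_(t in `]x, y]) h t.
    move=> ax xy yb.
    have [_ ->] := H x y (lt_le_trans la ax) xy (le_lt_trans yb br).
    apply: eq_Rintegral => t; rewrite inE/= in_itv/= => /andP[xt ty].
    by rewrite /h patchE mem_set//= in_itv/= (le_lt_trans ax xt) (le_trans ty yb).
  have := density_ae_derive ih Hh; apply: aeS => x H1 H2.
  have := H1 H2; rewrite {1}/h patchE mem_set//= in_itv/=.
  by case/andP: H2 => -> /ltW ->.
apply: aeS => x Hx lxr; have [n Hn] := itv_exhaustion lxr.
exact: Hx Hn.
Qed.

Lemma abs_continuous_continuous l r F x :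
  (forall a b, l < a -> a <= b -> b < r -> abs_continuous a b F) -> l < x < r ->
  {for x, continuous F}.
Proof.
move=> H /andP[lx xr].
pose a := (l + x) / 2; pose b := (x + r) / 2.
have la : l < a by rewrite /a; lra.
have ax : a < x by rewrite /a; lra.
have xb : x < b by rewrite /b; lra.
have br : b < r by rewrite /b; lra.
have ac := H a b la (ltW (lt_trans ax xb)) br.
apply/cvgrPdist_lt => e e0; have [d d0 Hd] := ac e e0.
near=> y.
have ay : a < y by near: y; apply: lt_nbhsr.
have yb : y < b by near: y; apply: lt_nbhsl.
have xy : `|x - y| < d.
  by near: y; apply/nbhs_ballP; exists d.
have [yx|/ltW yx] := leP x y.
  have := Hd [:: (x, y)].
  rewrite /nonoverlapping/= (ltW ax) yx (ltW yb) /total_length /total_increment !big_seq1/=.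
  rewrite distrC => -> //; move: xy; rewrite distrC ger0_norm ?subr_ge0//.
have := Hd [:: (y, x)].
rewrite /nonoverlapping/= (ltW ay) yx (ltW xb) /total_length /total_increment !big_seq1/=.
move=> -> //; move: xy; rewrite ger0_norm ?subr_ge0//.
Unshelve. all: by end_near. Qed.

Lemma antider_continuous l r F g x : antider l r F g -> l < x < r ->
  {for x, continuous F}.
Proof.
by move=> H; apply: abs_continuous_continuous => a b; exact: antider_abs_continuous H.
Qed.

Lemma antider_derive l r F g x : antider l r F g -> l < x < r ->
  {for x, continuous g} -> is_derive x 1 F (g x).
Proof.
move=> H /andP[lx xr] cg.
pose a := (l + x) / 2; pose b := (x + r) / 2.
have la : l < a by rewrite /a; lra.
have ax : a < x by rewrite /a; lra.
have xb : x < b by rewrite /b; lra.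
have br : b < r by rewrite /b; lra.
have [iab _] := H a b la (ltW (lt_trans ax xb)) br.
have [//|//|] := @continuous_FTC1 R g (BRight a) x b xb iab.
set P := fun y => _ => dP EP.
have nF : {near x, (fun y => P y + F a) =1 F}.
  have : \near x, a < x < b.
    near=> z; apply/andP; split; near: z; [exact: lt_nbhsr | exact: lt_nbhsl].
  apply: filterS => y /andP[ay yb]; rewrite /P.
  by have [_ <-] := H a y la (ltW ay) (lt_trans yb br); rewrite subrK.
have [dF EF] := near_shift_derive nF dP.
by split => //; rewrite -derive1E EF.
Unshelve. all: by end_near. Qed.

Lemma derive_antider l r F f : (forall x, l < x < r -> is_derive x 1 F (f x)) ->
  (forall x, l < x < r -> {for x, continuous f}) -> antider l r F f.
Proof.
move=> dF cf a b la; rewrite le_eqVlt => /orP[/eqP <-|ab] br.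
  rewrite set_itv_ge ?bnd_simp ?ltxx// Rintegral_set0 subrr; split => //.
  exact: integrable_set0.
have lr x : x \in `[a, b] -> l < x < r.
  by rewrite in_itv/= => /andP[ax xb]; rewrite (lt_le_trans la ax) (le_lt_trans xb br).
have lr' x : x \in `]a, b[ -> l < x < r.
  by rewrite in_itv/= => /andP[ax xb]; rewrite (lt_trans la ax) (lt_trans xb br).
have wf : {within `[a, b], continuous f}.
  by apply: continuous_in_subspaceT => x; rewrite inE/= => /lr/cf.
have intf : mu.-integrable `[a, b] (EFin \o f).
  by apply: continuous_compact_integrable => //; exact: segment_compact.
have cF x : l < x < r -> {for x, continuous F}.
  by move=> /dF[dd _]; apply: differentiable_continuous; exact/derivable1_diffP.
have doo : derivable_oo_LRcontinuous F a b.
  split.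
  - by move=> x /lr'/dF[].
  - apply: cvg_at_right_filter; apply: cF; rewrite la; exact: lt_trans br.
  - apply: cvg_at_left_filter; apply: cF; rewrite br andbT; exact: lt_trans ab.
have Ff : {in `]a, b[, derive1 F =1 f}.
  by move=> x /lr'/dF h; rewrite derive1E; exact: derive_val.
have E := continuous_FTC2 ab wf doo Ff.
split.
  by apply: integrableS intf => // x /=; rewrite !in_itv/= => /andP[/ltW -> ->].
rewrite Rintegral_itv_obnd_cbnd; last first.
  by apply: integrableS intf => // x /=; rewrite !in_itv/= => /andP[/ltW -> ->].
by rewrite /Rintegral E.
Qed.

Lemma antider_ext l r F F' f f' : antider l r F f ->
  (forall x, l < x < r -> F x = F' x) -> (forall x, l < x < r -> f x = f' x) ->
  antider l r F' f'.
Proof.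
move=> H FF ff a b la ab br; have [i E] := H a b la ab br.
have lr x : x \in `]a, b] -> l < x < r.
  by rewrite in_itv/= => /andP[ax xb]; rewrite (lt_trans la ax) (le_lt_trans xb br).
split.
  by apply: eq_integrable i => //= x; rewrite inE => /lr/ff ->.
rewrite -!FF ?E ?la ?br ?(le_lt_trans ab br) ?(lt_le_trans la ab)//.
by apply: eq_Rintegral => x; rewrite inE => /lr/ff.
Qed.

Lemma antiderD l r F G f g : antider l r F f -> antider l r G g ->
  antider l r (fun x => F x + G x) (fun x => f x + g x).
Proof.
move=> HF HG a b la ab br; have [i1 E1] := HF a b la ab br; have [i2 E2] := HG a b la ab br.
split; last by rewrite RintegralD// -E1 -E2; ring.
by apply: eq_integrable (integrableD _ i1 i2) => //.
Qed.

Lemma antiderZ l r F f c : antider l r F f ->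
  antider l r (fun x => c * F x) (fun x => c * f x).
Proof.
move=> HF a b la ab br; have [i1 E1] := HF a b la ab br.
split; last by rewrite RintegralZl// -E1; ring.
by apply: eq_integrable (integrableZl _ c i1) => //.
Qed.

Lemma antiderB l r F G f g : antider l r F f -> antider l r G g ->
  antider l r (fun x => F x - G x) (fun x => f x - g x).
Proof.
move=> HF HG; have := antiderD HF (antiderZ (-1) HG).
by move/antider_ext; apply => x _; ring.
Qed.

Lemma antider_le l r F G f g a b : antider l r F f -> antider l r G g ->
  l < a -> a <= b -> b < r -> (forall x, a < x <= b -> f x <= g x) ->
  F b - F a <= G b - G a.
Proof.
move=> HF HG la ab br fg; have [i1 ->] := HF a b la ab br; have [i2 ->] := HG a b la ab br.
by apply: le_Rintegral => // x; rewrite /= in_itv/= => /fg.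
Qed.

Lemma antider_measurable l r F g : antider l r F g -> measurable_fun `]l, r[ g.
Proof.
move=> H.
have [rl|lr] := leP r l.
  by rewrite set_itv_ge ?bnd_simp -?leNgt//; exact: measurable_fun_set0.
pose e (n : nat) := (r - l) / (n + 3)%:R.
have -> : `]l, r[%classic = \bigcup_(n in setT) `]l + e n, r - e n]%classic.
  apply/seteqP; split=> x /=.
    rewrite in_itv/= => /itv_exhaustion[n /andP[h1 h2]]; exists n => //.
    by rewrite /= in_itv/= h1 ltW.
  move=> [n _]; rewrite /= !in_itv/= => /andP[h1 h2].
  have [la _ br] := itv_exhaustion_bounds n lr.
  by rewrite (lt_trans la h1) (le_lt_trans h2 br).
apply/measurable_fun_bigcup => // n.
have [la ab br] := itv_exhaustion_bounds n lr.
have [i _] := H _ _ la ab br.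
by case/integrableP: i => /measurable_EFinP.
Qed.

Lemma antider_measurable_primitive l r F g : antider l r F g ->
  measurable_fun `]l, r[ F.
Proof.
move=> HF; apply: open_continuous_measurable_fun; first exact: interval_open.
by move=> x; rewrite inE/= in_itv/= => xlr; exact: antider_continuous HF xlr.
Qed.

Lemma abs_continuous_bounded a b F : a <= b -> abs_continuous a b F ->
  exists M, forall x, a <= x <= b -> `|F x| <= M.
Proof.
move=> ab acF; exists (fine (total_variation a b F) + `|F a|) => x /andP[ax xb].
have := total_variation_ge F ax.
have fx := total_variation_fin acF ax xb.
have fb := total_variation_fin acF ab (lexx b).
have : (total_variation a x F <= total_variation a b F)%E.
  by rewrite (total_variationD F ax xb) leeDl// total_variation_ge0.
rewrite -(fineK fx) -(fineK fb) !lee_fin => h1 h2.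
rewrite -[F x](subrK (F a)) (le_trans (ler_normD _ _))// lerD2r.
exact: le_trans h2 h1.
Qed.

Lemma abs_continuousM a b F G : a <= b -> abs_continuous a b F -> abs_continuous a b G ->
  abs_continuous a b (fun x => F x * G x).
Proof.
move=> ab acF acG e e0.
have [M HM] := abs_continuous_bounded ab acF.
have [N HN] := abs_continuous_bounded ab acG.
pose K := Num.max 1 (Num.max M N).
have K1 : 1 <= K by rewrite le_max lexx.
have KM : M <= K by rewrite !le_max lexx orbT.
have KN : N <= K by rewrite !le_max lexx !orbT.
have K0 : 0 < K by exact: lt_le_trans K1.
have eK : 0 < e / (2 * K) by rewrite divr_gt0// mulr_gt0.
have [d1 d10 H1] := acF _ eK; have [d2 d20 H2] := acG _ eK.
exists (Num.min d1 d2); first by rewrite lt_min d10.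
move=> L nL; rewrite lt_min => /andP[l1 l2].
apply: (@le_lt_trans _ _ (K * (total_increment F L + total_increment G L))).
  rewrite /total_increment -big_split mulr_sumr big_seq [leRHS]big_seq/=.
  apply: ler_sum => p pL; move: nL => /andP[/allP/(_ p pL)/and3P[ap pp pb] _].
  have -> : F p.2 * G p.2 - F p.1 * G p.1 =
     (F p.2 - F p.1) * G p.2 + F p.1 * (G p.2 - G p.1) by ring.
  rewrite (le_trans (ler_normD _ _))// !normrM mulrDr lerD//.
    by rewrite mulrC ler_wpM2r// (le_trans _ KN)// HN// (le_trans ap pp).
  by rewrite ler_wpM2r// (le_trans _ KM)// HM// ap (le_trans pp pb).
have h1 := H1 _ nL l1; have h2 := H2 _ nL l2.
rewrite -ltr_pdivlMl//.
have -> : K^-1 * e = e / (2 * K) + e / (2 * K) by field; rewrite gt_eqF.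
exact: ltrD.
Qed.

Lemma antiderM l r F G f g : antider l r F f -> antider l r G g ->
  antider l r (fun x => F x * G x) (fun x => f x * G x + F x * g x).
Proof.
move=> HF HG; apply: abs_continuous_antider.
- by move=> a b la ab br; apply: abs_continuousM => //;
    apply: antider_abs_continuous la ab br; eassumption.
- apply: measurable_funD; apply: measurable_funM.
  + exact: antider_measurable HF.
  + exact: antider_measurable_primitive HG.
  + exact: antider_measurable_primitive HF.
  + exact: antider_measurable HG.
- apply: (aeS2 _ (antider_ae_derive HF) (antider_ae_derive HG)) => x h1 h2 xlr.
  have [d1 e1] := h1 xlr; have [d2 e2] := h2 xlr.
  rewrite derive1E (deriveM d1 d2) -!derive1E e1 e2 /GRing.scale/=; ring.
Qed.

End Antiderivatives.

(** * The weighted space *)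

Section WeightedL2.
Context {R : realType}.
Notation mu := (@lebesgue_measure R).
Implicit Types (F G f g u : R -> R) (a b x y : R).
Notation I01 := (@I01 R).

Lemma I01P x : I01 x <-> 0 < x < 1.
Proof. by rewrite /I01 /= in_itv. Qed.

Lemma measurable_I01 : measurable (I01 : set R).
Proof. exact: measurable_itvR. Qed.
Hint Resolve measurable_I01 measurable_itvR : core.

Lemma onem_sqr_gt0 x : 0 < x < 1 -> 0 < 1 - x ^+ 2.
Proof. by move=> /andP[x0 x1]; rewrite subr_gt0 expr_lt1// ltW. Qed.

Lemma wt_gt0 x : 0 < x < 1 -> 0 < wt x.
Proof.
move=> x01; rewrite /wt divr_gt0 ?exprn_gt0 ?onem_sqr_gt0//.
by case/andP: x01.
Qed.

Lemma wt_ge0 x : 0 <= wt x :> R.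
Proof. by rewrite /wt divr_ge0 ?sqr_ge0. Qed.

Lemma measurable_wt : measurable_fun I01 (@wt R).
Proof.
apply: open_continuous_measurable_fun; first exact: interval_open.
move=> x; rewrite inE => /I01P /onem_sqr_gt0 h.
have c : {for x, continuous (fun y : R => (1 - y ^+ 2) ^+ 2)}.
  apply: (@continuous_comp _ _ _ (fun y : R => 1 - y ^+ 2) (fun z => z ^+ 2)); last exact: exprn_continuous.
  by apply: continuousB; [exact: cst_continuous|exact: exprn_continuous].
have c2 : {for x, continuous (fun y : R => y ^+ 2)} by exact: exprn_continuous.
apply: (continuousM c2).
by apply: continuousV => //; rewrite gt_eqF// exprn_gt0.
Qed.

Lemma cauchy_schwarz_discriminant (A B C : R) : 0 <= A ->
  (forall t, 2 * t * B <= t ^+ 2 * A + C) -> B ^+ 2 <= A * C.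
Proof.
rewrite le_eqVlt => /orP[/eqP <- H|A0 H].
  suff -> : B = 0 by rewrite expr0n mul0r.
  apply/eqP/negP => /negP B0.
  (* When [A = 0] the hypothesis is linear in [t]; this value turns it into [2 (C + 1) <= C],
     against [0 <= C] from [t = 0]. *)
  have := H ((C + 1) / B); rewrite mulr0 add0r.
  have -> : 2 * ((C + 1) / B) * B = 2 * (C + 1) by field.
  have := H 0; rewrite mulr0 mul0r mulr0 add0r; lra.
have := H (B / A).
have -> : 2 * (B / A) * B = 2 * (B ^+ 2 / A) by ring.
have -> : (B / A) ^+ 2 * A = B ^+ 2 / A by field; rewrite gt_eqF.
move=> h; have : B ^+ 2 / A <= C by lra.
by rewrite ler_pdivrMr// mulrC.
Qed.

Section RealIntegrable.
Variable D : set R.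
Hypothesis mD : measurable D.
Notation integr f := (mu.-integrable D (EFin \o f)).

Lemma integrable_ext f g : (forall x, D x -> f x = g x) -> integr f -> integr g.
Proof. by move=> fg; apply: eq_integrable => // x; rewrite inE => /fg /= ->. Qed.

Lemma integrable_add f g : integr f -> integr g -> integr (fun x => f x + g x).
Proof. by move=> i1 i2; apply: eq_integrable (integrableD _ i1 i2). Qed.

Lemma integrable_scale c f : integr f -> integr (fun x => c * f x).
Proof. by move=> i1; apply: eq_integrable (integrableZl _ c i1). Qed.

Lemma integrable_sub f g : integr f -> integr g -> integr (fun x => f x - g x).
Proof. by move=> i1 i2; apply: eq_integrable (integrableB _ i1 i2). Qed.

Lemma integrable_dominated f g : measurable_fun D f ->
  (forall x, D x -> `|f x| <= g x) -> integr g -> integr f.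
Proof.
move=> mf fg ig; apply: (le_integrable _ _ _ ig) => //; first exact/measurable_EFinP.
move=> x Dx /=; rewrite lee_fin (le_trans (fg x Dx))// ger0_norm//.
by rewrite (le_trans _ (fg x Dx)).
Qed.

Lemma integral_fin f : integr f -> (\int[mu]_(x in D) (f x)%:E)%E \is a fin_num.
Proof. by move=> i; apply: integrable_fin_num i. Qed.

Lemma Rintegral_add f g : integr f -> integr g ->
  \int[mu]_(x in D) (f x + g x) = \int[mu]_(x in D) f x + \int[mu]_(x in D) g x.
Proof. by move=> i1 i2; rewrite RintegralD. Qed.

Lemma Rintegral_sub f g : integr f -> integr g ->
  \int[mu]_(x in D) (f x - g x) = \int[mu]_(x in D) f x - \int[mu]_(x in D) g x.
Proof. by move=> i1 i2; rewrite RintegralB. Qed.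

Lemma Rintegral_scale c f : integr f ->
  \int[mu]_(x in D) (c * f x) = c * \int[mu]_(x in D) f x.
Proof. by move=> i1; rewrite RintegralZl. Qed.

End RealIntegrable.

Lemma integrable_subset (D E : set R) f : measurable D -> measurable E -> E `<=` D ->
  mu.-integrable D (EFin \o f) -> mu.-integrable E (EFin \o f).
Proof. by move=> mD mE ED; apply: integrableS. Qed.

Lemma ge0_integral_subset (D E : set R) f : measurable D -> measurable E -> E `<=` D ->
  (forall x, D x -> 0 <= f x) -> mu.-integrable D (EFin \o f) ->
  \int[mu]_(x in E) f x <= \int[mu]_(x in D) f x.
Proof.
move=> mD mE ED f0 i.
have iE := integrable_subset mD mE ED i.
rewrite /Rintegral fine_le//; try exact: integral_fin.
by apply: ge0_subset_integral => //; exact: measurable_int i.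
Qed.

Lemma integrable_mul (D : set R) f g : measurable D -> measurable_fun D f ->
  measurable_fun D g -> mu.-integrable D (EFin \o (fun x => f x ^+ 2)) ->
  mu.-integrable D (EFin \o (fun x => g x ^+ 2)) ->
  mu.-integrable D (EFin \o (fun x => f x * g x)).
Proof.
move=> mD mf mg i1 i2.
apply: (integrable_dominated mD) (integrable_add mD i1 i2).
  exact: measurable_funM.
move=> x Dx; rewrite ler_norml; apply/andP; split; nra.
Qed.

Lemma Rintegral_cauchy_schwarz (D : set R) f g : measurable D -> measurable_fun D f ->
  measurable_fun D g -> mu.-integrable D (EFin \o (fun x => f x ^+ 2)) ->
  mu.-integrable D (EFin \o (fun x => g x ^+ 2)) ->
  (\int[mu]_(x in D) (f x * g x)) ^+ 2 <=
  (\int[mu]_(x in D) f x ^+ 2) * (\int[mu]_(x in D) g x ^+ 2).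
Proof.
move=> mD mf mg i1 i2; have i3 := integrable_mul mD mf mg i1 i2.
apply: cauchy_schwarz_discriminant.
  by apply: Rintegral_ge0 => x _; exact: sqr_ge0.
move=> t.
have ii1 := integrable_scale mD (t ^+ 2) i1.
have ii3 := integrable_scale mD (2 * t) i3.
rewrite -(Rintegral_scale mD _ i3) -(Rintegral_scale mD _ i1) -(Rintegral_add mD ii1 i2).
apply: le_Rintegral => //; first exact: integrable_add.
move=> x _; have := sqr_ge0 (t * f x - g x); nra.
Qed.

Definition weightedL2 f := measurable_fun I01 f /\
  mu.-integrable I01 (EFin \o (fun x => f x ^+ 2 * wt x)).

Definition wip f g : R := \int[mu]_(x in I01) (f x * g x * wt x).

Lemma wip_integrable f g : weightedL2 f -> weightedL2 g ->
  mu.-integrable I01 (EFin \o (fun x => f x * g x * wt x)).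
Proof.
move=> [mf i1] [mg i2].
apply: (integrable_dominated measurable_I01) (integrable_add measurable_I01 i1 i2).
  by apply: measurable_funM; [exact: measurable_funM|exact: measurable_wt].
move=> x Dx; rewrite -mulrDl normrM (ger0_norm (wt_ge0 x)).
rewrite ler_wpM2r ?wt_ge0//.
rewrite ler_norml; apply/andP; split; nra.
Qed.

Lemma wipC f g : wip f g = wip g f.
Proof. by apply: eq_Rintegral => x _; rewrite [f x * _]mulrC. Qed.

Lemma wip_ge0 f : 0 <= wip f f.
Proof. by apply: Rintegral_ge0 => x _; rewrite mulr_ge0 ?wt_ge0// -expr2 sqr_ge0. Qed.

Lemma weightedL2_bounded (M : R) (m : R -> R) f : measurable_fun I01 m ->
  (forall x, 0 < x < 1 -> `|m x| <= M) -> weightedL2 f ->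
  weightedL2 (fun x => m x * f x).
Proof.
move=> mm bm [mf i1]; split; first exact: measurable_funM.
apply: (integrable_dominated measurable_I01) (integrable_scale measurable_I01 (M ^+ 2) i1).
  apply: measurable_funM; last exact: measurable_wt.
  by apply: measurable_funX; exact: measurable_funM.
move=> x /I01P Dx /=.
rewrite ger0_norm; last by rewrite mulr_ge0 ?sqr_ge0 ?wt_ge0.
rewrite [leRHS]mulrA ler_wpM2r ?wt_ge0//.
rewrite exprMn ler_wpM2r ?sqr_ge0// -[m x ^+ 2]real_normK ?num_real//.
by rewrite lerXn2r ?nnegrE// ?bm// (le_trans _ (bm x Dx)).
Qed.

Lemma weightedL2Z c f : weightedL2 f -> weightedL2 (fun x => c * f x).
Proof. by apply: (weightedL2_bounded (M := `|c|) (m := fun=> c)). Qed.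

Lemma weightedL2D f g : weightedL2 f -> weightedL2 g -> weightedL2 (fun x => f x + g x).
Proof.
move=> hf hg; have ifg := wip_integrable hf hg.
case: hf => mf i1; case: hg => mg i2; split; first exact: measurable_funD.
have := integrable_add measurable_I01 (integrable_add measurable_I01 i1 i2)
   (integrable_scale measurable_I01 2 ifg).
by apply: eq_integrable => // x _ /=; congr EFin; ring.
Qed.

Lemma weightedL2B f g : weightedL2 f -> weightedL2 g -> weightedL2 (fun x => f x - g x).
Proof.
move=> hf hg; have := weightedL2D hf (weightedL2Z (-1) hg).
by congr weightedL2; apply/funext => x; rewrite mulN1r.
Qed.

Lemma weightedL20 : weightedL2 (fun=> 0).
Proof.
split; first exact: measurable_cst.
have -> : EFin \o (fun x : R => 0 ^+ 2 * wt x) = cst (0%:E : \bar R).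
  by apply/funext => x /=; rewrite expr0n mul0r.
exact: integrable0.
Qed.

Lemma weightedL2_ae f g : weightedL2 f -> measurable_fun I01 g -> ae_eq mu I01 f g ->
  weightedL2 g.
Proof.
move=> [mf i1] mg fg; split => //.
have mm : measurable_fun I01 (fun x => g x ^+ 2 * wt x).
  by apply: measurable_funM; [exact: measurable_funX|exact: measurable_wt].
have [] // := ae_integrable measurable_I01 i1 mm.
by move: fg; apply: aeS => x h Dx; rewrite h.
Qed.

Lemma wipDl f g h : weightedL2 f -> weightedL2 g -> weightedL2 h ->
  wip (fun x => f x + g x) h = wip f h + wip g h.
Proof.
move=> hf hg hh; rewrite /wip -(Rintegral_add measurable_I01 (wip_integrable hf hh) (wip_integrable hg hh)).
by apply: eq_Rintegral => x _; ring.
Qed.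

Lemma wipZl c f h : weightedL2 f -> weightedL2 h ->
  wip (fun x => c * f x) h = c * wip f h.
Proof.
move=> hf hh; rewrite /wip -(Rintegral_scale measurable_I01 _ (wip_integrable hf hh)).
by apply: eq_Rintegral => x _; ring.
Qed.

Lemma wip_eq0 f : weightedL2 f -> wip f f = 0 -> ae_eq mu I01 f (fun=> 0).
Proof.
move=> hf f0.
have m2 : measurable_fun I01 (EFin \o (fun x => f x * f x * wt x)).
  by case/integrableP: (wip_integrable hf hf).
have : (\int[mu]_(x in I01) `|(f x * f x * wt x)%:E| = 0)%E.
  have -> : (\int[mu]_(x in I01) `|(f x * f x * wt x)%:E| =
             \int[mu]_(x in I01) (f x * f x * wt x)%:E)%E.
    apply: eq_integral => x _; rewrite gee0_abs// lee_fin.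
    by rewrite mulr_ge0 ?wt_ge0// -expr2 sqr_ge0.
  rewrite -[LHS]fineK; last exact: integral_fin (wip_integrable hf hf).
  by rewrite -/(Rintegral mu I01 (fun x => f x * f x * wt x)) -/(wip f f) f0.
move/(ae_eq_integral_abs mu measurable_I01 m2).
apply: aeS => x h Dx; have := h Dx => /= -[] /eqP.
move/I01P: Dx => Dx; rewrite mulf_eq0 (gt_eqF (wt_gt0 Dx)) orbF mulf_eq0 orbb.
by move/eqP.
Qed.

Lemma wt_integrable_sub f a b : weightedL2 f -> 0 <= a -> b <= 1 ->
  mu.-integrable `]a, b[ (EFin \o (fun x => f x ^+ 2 * wt x)) /\
  \int[mu]_(x in `]a, b[) (f x ^+ 2 * wt x) <= wip f f.
Proof.
move=> [mf i1] a0 b1.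
have sub : `]a, b[ `<=` I01.
  move=> x /=; rewrite in_itv/= => /andP[ax xb]; apply/I01P.
  by rewrite (le_lt_trans a0 ax) (lt_le_trans xb b1).
have i2 := integrable_subset measurable_I01 (measurable_itvR _) sub i1.
split => //; rewrite /wip; under [leRHS]eq_Rintegral do rewrite -expr2.
apply: ge0_integral_subset => // x _.
by rewrite mulr_ge0 ?sqr_ge0 ?wt_ge0.
Qed.

Lemma integrable_exhaustion f M : measurable_fun I01 f ->
  (forall x, 0 < x < 1 -> 0 <= f x) ->
  (forall a b, 0 < a -> a <= b -> b < 1 ->
     mu.-integrable `]a, b] (EFin \o f) /\ \int[mu]_(x in `]a, b]) f x <= M) ->
  mu.-integrable I01 (EFin \o f) /\ \int[mu]_(x in I01) f x <= M.
Proof.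
move=> mf f0 H.
pose e (n : nat) : R := (1 - 0) / (n + 3)%:R.
pose D n : set R := `]0 + e n, 1 - e n]%classic.
have IE : I01 = \bigcup_n D n.
  apply/seteqP; split=> x /=.
    move=> /I01P /itv_exhaustion[n /andP[h1 h2]]; exists n => //.
    by rewrite /D /= in_itv/= h1 ltW.
  move=> [n _]; rewrite /D/= in_itv/= => /andP[h1 h2]; apply/I01P.
  have [la _ br] := itv_exhaustion_bounds n (@ltr01 R).
  by rewrite (lt_trans la h1) (le_lt_trans h2 br).
have ndD : {homo D : n m / (n <= m)%N >-> (n <= m)%O}.
  move=> n m nm; apply/subsetPset => x; rewrite /D /= !in_itv/= => /andP[h1 h2].
  have h : e m <= e n.
    by rewrite ler_pM2l ?subr_gt0// lef_pV2 ?posrE ?ltr0n ?addn3// ler_nat.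
  by apply/andP; split; lra.
have DI n : D n `<=` I01 by rewrite IE => x Dx; exists n.
have mfD n : measurable_fun (D n) (EFin \o f).
  by apply/measurable_EFinP; apply: measurable_funS mf => //.
have fD n x : D n x -> (0 <= (EFin \o f) x)%E.
  by move=> /DI/I01P/f0; rewrite lee_fin.
have iM : (\int[mu]_(x in I01) (f x)%:E <= M%:E)%E.
  rewrite IE.
  have cv := ge0_nondecreasing_set_cvg_integral (mu := mu) ndD (fun n => measurable_itvR _) mfD fD.
  rewrite -(cvg_lim _ cv)//; apply: lime_le; first by apply/cvg_ex; eexists; exact: cv.
  apply: nearW => n; have [la ab br] := itv_exhaustion_bounds n (@ltr01 R).
  have [i1 i2] := H _ _ la ab br.
  by rewrite -(fineK (integral_fin _ i1))// lee_fin.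
have i : mu.-integrable I01 (EFin \o f).
  apply/integrableP; split; first exact/measurable_EFinP.
  have -> : (\int[mu]_(x in I01) `|(EFin \o f) x| = \int[mu]_(x in I01) (f x)%:E)%E.
    by apply: eq_integral => x; rewrite inE => /I01P/f0 h; rewrite gee0_abs// lee_fin.
  by rewrite (le_lt_trans iM)// ltry.
split => //; by rewrite -lee_fin /Rintegral fineK//; exact: integral_fin i.
Qed.

Definition vanishes_at_ends (K : R -> R) := forall eps : R, 0 < eps ->
  exists2 delta : R, 0 < delta & forall x, 0 < x < 1 ->
    (x < delta) || (1 - x < delta) -> `|K x| <= eps.

(** Every integration by parts over the whole of [(0, 1)] goes through this lemma: [K] is the
    boundary term on compact subintervals. An identity of integrals is obtained by applying it in
    both directions. *)
Lemma integral_ge0_of_boundary g K : mu.-integrable I01 (EFin \o g) ->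
  vanishes_at_ends K ->
  (forall a b, 0 < a -> a <= b -> b < 1 -> K a - K b <= \int[mu]_(x in `]a, b]) g x) ->
  0 <= \int[mu]_(x in I01) g x.
Proof.
move=> ig Kv Kg; rewrite leNgt; apply/negP => n0.
set I := \int[mu]_(x in I01) g x in n0.
(* Three errors of this size, two boundary values and the integral over the two margins, cannot make
   up for [I]. *)
have e0 : 0 < - I / 4 by lra.
have [d1 d10 Hd1] := Kv _ e0.
pose h := g \_ I01.
have ih : mu.-integrable setT (EFin \o h).
  by move: ig; rewrite integrable_mkcond// /h restrict_EFin.
have [d2 [d20 Hd2]] := integral_normr_continuous ih e0.
pose a := Num.min (1 / 4) (Num.min (d1 / 2) (d2 / 4)).
have a0 : 0 < a by rewrite !lt_min !divr_gt0.
have a4 : a <= 1 / 4 by rewrite ge_min lexx.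
have ad1 : a <= d1 / 2 by rewrite !ge_min lexx orbT.
have ad2 : a <= d2 / 4 by rewrite !ge_min lexx !orbT.
pose b := 1 - a.
have ab : a <= b by rewrite /b; lra.
have b1 : b < 1 by rewrite /b; lra.
have h1 := Kg a b a0 ab b1.
have h2 : `|K a| <= - I / 4 by apply: Hd1; [|apply/orP; left]; rewrite ?a0/=; lra.
have h3 : `|K b| <= - I / 4.
  by apply: Hd1; [|apply/orP; right]; rewrite ?b1 ?andbT/= /b; lra.
have sub : `]a, b] `<=` I01.
  move=> x /=; rewrite in_itv/= => /andP[ax xb]; apply/I01P.
  by rewrite (lt_trans a0 ax) (le_lt_trans xb b1).
pose C := I01 `\` `]a, b].
have mC : measurable C by exact: measurableD.
have IE : I01 = `]a, b] `|` C by rewrite /C setDUK.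
have IS : I = \int[mu]_(x in `]a, b]) g x + \int[mu]_(x in C) g x.
  rewrite /I {1}IE Rintegral_setU//; first by rewrite -IE.
  by apply/disj_setPS => x [? []].
have muC : (mu C < d2%:E)%E.
  have Csub : C `<=` `]0, a] `|` `]b, 1[.
    move=> x [/I01P /andP[x0 x1]] /=; rewrite !in_itv/= => /negP.
    rewrite negb_and -leNgt -ltNge => /orP[xa|bx]; [left|right].
      by rewrite x0.
    by rewrite bx.
  apply: (@le_lt_trans _ _ (mu (`]0%R, a] `|` `]b, 1%R[)%classic)).
    by apply: le_measure => //; rewrite inE//; exact: measurableU.
  apply: (@le_lt_trans _ _ (mu `]0%R, a]%classic + mu `]b, 1%R[%classic)%E).
    exact: measureU2.
  rewrite !lebesgue_measure_itv/= !lte_fin a0 b1 -!EFinD lte_fin /b; lra.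
have h4 : `|\int[mu]_(x in C) g x| < - I / 4.
  apply: le_lt_trans (Hd2 C mC muC).
  have CI : C `<=` I01 by move=> x [].
  apply: (@le_trans _ _ (\int[mu]_(x in C) `|g x|)).
    by apply: le_normr_Rintegral => //; exact: integrable_subset CI ig.
  rewrite le_eqVlt; apply/orP; left; apply/eqP; apply: eq_Rintegral => x; rewrite inE => /CI Ix.
  by rewrite /h patchE mem_set.
move: h2 h3 h4; rewrite ltr_norml !ler_norml => /andP[] h2 h2' /andP[] h3 h3' /andP[] h4 h4'.
move: IS h1 h2 h2' h3 h3' h4 h4' n0; clearbody I.
move: (\int[mu]_(x in `]a, b]) g x) (\int[mu]_(x in C) g x) (K a) (K b).
by move=> p q ka kb IS h1 h2 h2' h3 h3' h4 h4' n0; clear -IS h1 h2 h2' h3 h3' h4 h4' n0; lra.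
Qed.

(** A logarithmic divergence at 1 is the only obstruction to square integrability ever used at that
    end; the primitive [- ln (1 - x)] is unbounded. *)
Lemma not_weightedL2_near1 u (b0 d : R) : weightedL2 u -> 0 <= b0 < 1 -> 0 < d ->
  (forall x, b0 < x < 1 -> d / (1 - x) <= u x ^+ 2 * wt x) -> False.
Proof.
move=> hu /andP[b00 b01] d0 H.
pose G x := 0 - ln (1 - x) : R.
have aG : antider b0 1 G (fun x => (1 - x)^-1).
  apply: derive_antider => x /andP[bx x1].
    have x10 : 0 < 1 - x by lra.
    have h2 := derive_sub (derive_const 1 x) (derive_var x).
    by apply: (derive_eq (derive_sub (derive_const 0 x) (derive_ln h2 x10))); ring.
  apply: continuousV; first by rewrite gt_eqF//; lra.
  by apply: continuousB; [exact: cst_continuous|exact: cvg_id].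
pose a := (b0 + 1) / 2.
have ba : b0 < a by rewrite /a; lra.
have a1 : a < 1 by rewrite /a; lra.
(* Close enough to 1 for [ln ((1 - a) / (1 - c))] to reach [(wip u u + 1) / d], which overshoots the
   norm of [u] by 1. *)
pose c := Num.max a (1 - (1 - a) * expR (- ((wip u u + 1) / d))).
have eg := expR_gt0 (- ((wip u u + 1) / d)).
have c1 : c < 1.
  rewrite gt_max a1/=; have : 0 < (1 - a) * expR (- ((wip u u + 1) / d)).
    by rewrite mulr_gt0// subr_gt0.
  lra.
have ac : a <= c by rewrite le_max lexx.
have [i1 E1] := aG a c ba ac c1.
have [i2 L2] := wt_integrable_sub hu (le_trans b00 (ltW ba)) (lexx 1).
have sub : `]a, c] `<=` `]a, 1[.
  by move=> x /=; rewrite !in_itv/= => /andP[-> xc]; exact: le_lt_trans c1.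
have i3 := integrable_subset (measurable_itvR _) (measurable_itvR _) sub i2.
have L3 : \int[mu]_(x in `]a, c]) (u x ^+ 2 * wt x) <= wip u u.
  apply: le_trans L2; apply: ge0_integral_subset => // x _.
  by rewrite mulr_ge0 ?sqr_ge0 ?wt_ge0.
have L4 : d * (G c - G a) <= wip u u.
  apply: le_trans L3; rewrite E1 -(Rintegral_scale _ _ i1)//; apply: le_Rintegral => //.
    exact: integrable_scale.
  move=> x /=; rewrite in_itv/= => /andP[ax xc]; apply: H.
  by rewrite (lt_trans ba ax) (le_lt_trans xc c1).
have L5 : (wip u u + 1) / d <= G c - G a.
  have -> : G c - G a = ln ((1 - a) / (1 - c)).
    by rewrite /G ln_div ?posrE ?subr_gt0//; ring.
  rewrite -[leLHS]expRK ler_ln ?posrE ?expR_gt0 ?divr_gt0 ?subr_gt0//.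
  rewrite ler_pdivlMr ?subr_gt0//.
  have : (1 - a) * expR (- ((wip u u + 1) / d)) >= 1 - c.
    have : 1 - (1 - a) * expR (- ((wip u u + 1) / d)) <= c by rewrite le_max lexx orbT.
    lra.
  move=> h; rewrite mulrC -ler_pdivlMr ?expR_gt0// -expRN; lra.
have : wip u u + 1 <= wip u u.
  apply: le_trans L4; rewrite -ler_pdivrMl// mulrC; exact: L5.
lra.
Qed.

Lemma not_weightedL2_near0 u (a0 d : R) : weightedL2 u -> 0 < a0 < 1 -> 0 < d ->
  (forall x, 0 < x < a0 -> d / x <= u x ^+ 2 * wt x) -> False.
Proof.
move=> hu /andP[a00 a01] d0 H.
pose G x := ln x : R.
have aG : antider 0 a0 G (fun x => x^-1).
  apply: derive_antider => x /andP[x0 x1]; first exact: is_derive1_ln.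
  by apply: continuousV; [rewrite gt_eqF|exact: cvg_id].
pose b := a0 / 2.
have b0 : 0 < b by rewrite /b; lra.
have ba : b < a0 by rewrite /b; lra.
pose c := Num.min b (b * expR (- ((wip u u + 1) / d))).
have eg := expR_gt0 (- ((wip u u + 1) / d)).
have c0 : 0 < c by rewrite lt_min b0/= mulr_gt0.
have cb : c <= b by rewrite ge_min lexx.
have [i1 E1] := aG c b c0 cb ba.
have [i2 L2] := wt_integrable_sub hu (lexx 0) (ltW a01).
have sub : `]c, b] `<=` `]0, a0[.
  move=> x /=; rewrite !in_itv/= => /andP[cx xb].
  by rewrite (lt_trans c0 cx) (le_lt_trans xb ba).
have i3 := integrable_subset (measurable_itvR _) (measurable_itvR _) sub i2.
have L3 : \int[mu]_(x in `]c, b]) (u x ^+ 2 * wt x) <= wip u u.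
  apply: le_trans L2; apply: ge0_integral_subset => // x _.
  by rewrite mulr_ge0 ?sqr_ge0 ?wt_ge0.
have L4 : d * (G b - G c) <= wip u u.
  apply: le_trans L3; rewrite E1 -(Rintegral_scale _ _ i1)//; apply: le_Rintegral => //.
    exact: integrable_scale.
  move=> x /=; rewrite in_itv/= => /andP[cx xb]; apply: H.
  by rewrite (lt_trans c0 cx) (le_lt_trans xb ba).
have L5 : (wip u u + 1) / d <= G b - G c.
  rewrite /G -ln_div ?posrE//.
  rewrite -[leLHS]expRK ler_ln ?posrE ?expR_gt0 ?divr_gt0//.
  rewrite ler_pdivlMr// mulrC -ler_pdivlMr ?expR_gt0// -expRN.
  by rewrite ge_min lexx orbT.
have : wip u u + 1 <= wip u u.
  apply: le_trans L4; rewrite -ler_pdivrMl// mulrC; exact: L5.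
lra.
Qed.

End WeightedL2.

(** * Completeness along geometrically fast Cauchy sequences *)

Section Completeness.
Context {R : realType}.
Notation mu := (@lebesgue_measure R).
Notation I01 := (@I01 R).
Hint Resolve measurable_I01 measurable_itvR : core.

(** Cauchy-Schwarz for a telescoping sum with the weights [2^-(i+1)], whose total is at most 1. *)
Lemma sqr_telescope_le (f : nat -> R) (p n : nat) :
  (f (n + p)%N - f n) ^+ 2 <=
  \sum_(0 <= i < p) 2 ^+ i.+1 * (f (n + i).+1 - f (n + i)%N) ^+ 2.
Proof.
elim: p n => [|p IH] n; first by rewrite addn0 subrr expr0n big_geq.
rewrite big_nat_recl// addn0 expr1.
have -> : \sum_(0 <= i < p) 2 ^+ i.+2 * (f (n + i.+1).+1 - f (n + i.+1)%N) ^+ 2 =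
  2 * \sum_(0 <= i < p) 2 ^+ i.+1 * (f (n.+1 + i).+1 - f (n.+1 + i)%N) ^+ 2.
  by rewrite mulr_sumr; apply: eq_bigr => i _; rewrite addSnnS mulrA -exprS.
have := IH n.+1; rewrite addSnnS => h.
have := sqr_ge0 ((f (n + p.+1)%N - f n.+1) - (f n.+1 - f n)).
by move: h; nra.
Qed.

(** Riesz-Fischer without passing to a subsequence: at this speed the weighted squares of the
    increments have an integrable sum [S], and where [S] is finite the sequence converges with a
    rate controlled by [S]. *)
Lemma weightedL2_complete (f : nat -> R -> R) (C : R) :
  (forall n, weightedL2 (f n)) ->
  (forall n, wip (fun x => f n.+1 x - f n x) (fun x => f n.+1 x - f n x) <= C * (4 ^+ n)^-1) ->
  exists2 g, weightedL2 g & forall n,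
    wip (fun x => g x - f n x) (fun x => g x - f n x) <= 4 * C * (2 ^+ n)^-1.
Proof.
move=> hf hd.
pose d n x := f n.+1 x - f n x.
have hdL n : weightedL2 (d n) by exact: weightedL2B.
(* Of the decay [4^-n] one half is spent on these weights. The rest makes the integrals summable,
   with sum at most [2 C]; the weights come back as the rate [2^-n]. *)
pose t n x := 2 ^+ n * (d n x * d n x * wt x).
have t0 n x : 0 <= t n x by rewrite mulr_ge0 ?exprn_ge0// mulr_ge0 ?wt_ge0// -expr2 sqr_ge0.
have ti n : mu.-integrable I01 (EFin \o t n).
  by apply: integrable_scale => //; exact: wip_integrable.
pose S x : \bar R := (\sum_(k <oo) (t k x)%:E)%E.
have mt n : measurable_fun I01 (EFin \o t n) by exact: measurable_int (ti n).
have S0 x : (0 <= S x)%E by apply: nneseries_ge0 => n _ _; rewrite lee_fin.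
have mS : measurable_fun I01 S.
  have := @ge0_emeasurable_sum _ _ R I01 (fun k x => (t k x)%:E) predT.
  by apply => [k x _ _|k _]; [rewrite lee_fin|exact: mt].
have IS : (\int[mu]_(x in I01) S x <= (2 * C)%:E)%E.
  rewrite /S integral_nneseries; [|exact: measurable_I01|exact: mt|by move=> n x _; rewrite lee_fin].
  apply: lime_le.
    by apply: is_cvg_nneseries => n _ _; apply: integral_ge0 => x _; rewrite lee_fin.
  apply: nearW => n.
  have C0 : 0 <= C.
    by apply: le_trans (wip_ge0 (d 0%N)) _; have := hd 0%N; rewrite expr0 invr1 mulr1.
  apply: (@le_trans _ _ (\sum_(0 <= k < n) (C * (2 ^+ k)^-1))%:E).
    rewrite -sumEFin; apply: lee_sum => k _.
    rewrite -[leLHS](fineK (integral_fin _ (ti k)))// lee_fin.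
    rewrite -/(Rintegral mu I01 (t k)) (Rintegral_scale _ _ (wip_integrable (hdL k) (hdL k)))//.
    rewrite -/(wip (d k) (d k)).
    have -> : C * (2 ^+ k)^-1 = 2 ^+ k * (C * (4 ^+ k)^-1).
      have -> : 4 = 2 * 2 :> R by rewrite -natrM.
      by rewrite exprMn; field; rewrite expf_neq0.
    by rewrite ler_pM2l ?exprn_gt0//; exact: hd.
  rewrite lee_fin.
  suff -> : \sum_(0 <= k < n) (C * (2 ^+ k)^-1) = 2 * C * (1 - (2 ^+ n)^-1).
    by rewrite ler_piMr ?mulr_ge0// lerBlDr lerDl invr_ge0 exprn_ge0.
  elim: n => [|n IH]; first by rewrite big_geq// expr0 invr1 subrr mulr0.
  rewrite big_nat_recr//= IH exprS; field.
  by rewrite expf_neq0.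
have Sae : {ae mu, forall x, I01 x -> S x \is a fin_num}.
  have iS : mu.-integrable I01 S.
    apply/integrableP; split => //.
    have -> : (\int[mu]_(x in I01) `|S x| = \int[mu]_(x in I01) S x)%E.
      by apply: eq_integral => x _; rewrite gee0_abs.
    by rewrite (le_lt_trans IS)// ltry.
  by apply: (integrable_ae _ iS); exact: measurable_I01.
have key x n p : S x \is a fin_num ->
    (f (n + p)%N x - f n x) ^+ 2 * wt x <= 2 * fine (S x) * (2 ^+ n)^-1.
  move=> Sx; rewrite ler_pdivlMr ?exprn_gt0//.
  have h : \sum_(0 <= i < n + p) t i x <= fine (S x).
    by rewrite -lee_fin fineK// -sumEFin; apply: nneseries_lim_ge => k _ _; rewrite lee_fin.
  have h2 : \sum_(0 <= i < p) t (n + i)%N x <= \sum_(0 <= i < n + p) t i x.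
    have -> : \sum_(0 <= i < n + p) t i x =
        \sum_(0 <= i < n) t i x + \sum_(0 <= i < p) t (n + i)%N x.
      rewrite (big_cat_nat (n := n))//=; last exact: leq_addr.
      congr (_ + _); rewrite -{1}[n]add0n big_addn addKn.
      by apply: eq_bigr => i _; rewrite addnC.
    by rewrite lerDr; apply: sumr_ge0 => i _.
  have h3 : (f (n + p)%N x - f n x) ^+ 2 * wt x * 2 ^+ n <=
      2 * \sum_(0 <= i < p) t (n + i)%N x.
    have -> : 2 * \sum_(0 <= i < p) t (n + i)%N x = 2 ^+ n * wt x *
       \sum_(0 <= i < p) 2 ^+ i.+1 * (f (n + i).+1 x - f (n + i)%N x) ^+ 2.
      rewrite !mulr_sumr; apply: eq_bigr => i _; rewrite /t /d exprD exprS; ring.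
    have -> : (f (n + p)%N x - f n x) ^+ 2 * wt x * 2 ^+ n =
      2 ^+ n * wt x * (f (n + p)%N x - f n x) ^+ 2 by ring.
    have w0 : 0 <= 2 ^+ n * wt x by apply: mulr_ge0; rewrite ?wt_ge0 ?exprn_ge0.
    apply: ler_wpM2l => //; exact: (sqr_telescope_le (fun n => f n x)).
  by apply: (le_trans h3); rewrite ler_pM2l// (le_trans h2).
have cv x : 0 < x < 1 -> S x \is a fin_num -> cvgn (fun n => f n x).
  move=> x01 Sx; apply: cauchy_cvg; apply: cauchy_exP => e e0.
  pose B := 2 * fine (S x) / (wt x * e ^+ 2).
  have B0 : 0 <= B.
    by apply: divr_ge0; apply: mulr_ge0; rewrite ?fine_ge0 ?wt_ge0 ?sqr_ge0.
  pose n := Num.bound B.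
  exists (f n x); exists n => // m /= nm.
  have := key x n (m - n)%N Sx; rewrite subnKC// => h.
  rewrite /ball/= distrC -ltr_sqr ?nnegrE ?(ltW e0)//= real_normK ?num_real//.
  rewrite -(ltr_pM2r (wt_gt0 x01)) (le_lt_trans h)//.
  rewrite ltr_pdivrMr ?exprn_gt0//.
  have : B < 2 ^+ n.
    apply: lt_le_trans (archi_boundP B0) _.
    by rewrite -natrX ler_nat ltnW// ltn_expl.
  rewrite /B ltr_pdivrMr; last by apply: mulr_gt0; rewrite ?wt_gt0 ?exprn_gt0.
  by have -> : e ^+ 2 * wt x * 2 ^+ n = 2 ^+ n * (wt x * e ^+ 2) by ring.
(* Set to 0 where [S] diverges, so that the limit exists at every point of [I01] and is
   measurable. *)
pose h n x := if (S x < +oo)%E then f n x else 0.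
have Slt x : (S x < +oo)%E = (S x \is a fin_num) by rewrite ge0_fin_numE.
pose g x := limn (fun n => h n x).
have hg x : I01 x -> h ^~ x @ \oo --> g x.
  move=> /I01P x01; rewrite /g /h; case Sx : (S x < +oo)%E.
    by apply: cv => //; rewrite -Slt.
  exact: is_cvg_cst.
have mh n : measurable_fun I01 (h n).
  apply: measurable_fun_if; first exact: measurable_I01.
  - by apply: measurable_fun_lte => //; exact: measurable_cst.
  - apply: (measurable_funS _ _ (hf n).1); first exact: measurable_I01.
    by move=> x [].
  - exact: measurable_cst.
have mg : measurable_fun I01 g by exact: measurable_fun_cvg mh hg.
have gb x n : I01 x -> S x \is a fin_num ->
    (g x - f n x) ^+ 2 * wt x <= 2 * fine (S x) * (2 ^+ n)^-1.
  move=> Ix Sx; have := hg x Ix; rewrite /h Slt Sx => cg.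
  have cg2 : (fun m => (f m x - f n x) ^+ 2 * wt x) @ \oo --> (g x - f n x) ^+ 2 * wt x.
    apply: cvgMl; rewrite expr2; under eq_fun do rewrite expr2.
    by apply: cvgM; apply: cvgB => //; exact: cvg_cst.
  rewrite -(cvg_lim _ cg2)//; apply: limr_le; first by apply/cvg_ex; eexists; exact: cg2.
  exists n => // m /= nm; have := key x n (m - n)%N Sx.
  by rewrite subnKC.
have mgf n : measurable_fun I01 (fun x => g x - f n x).
  by apply: measurable_funB => //; exact: (hf n).1.
have igf n : (\int[mu]_(x in I01) ((g x - f n x) ^+ 2 * wt x)%:E <=
     (4 * C * (2 ^+ n)^-1)%:E)%E.
  have mm : measurable_fun I01 (EFin \o (fun x => (g x - f n x) ^+ 2 * wt x)).
    apply/measurable_EFinP; apply: measurable_funM; last exact: measurable_wt.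
    exact: (measurable_funX 2 (mgf n)).
  have c0 : 0 <= 2 * (2 ^+ n)^-1 :> R by rewrite mulr_ge0 ?invr_ge0 ?exprn_ge0.
  apply: (@le_trans _ _ (\int[mu]_(x in I01) ((2 * (2 ^+ n)^-1)%:E * S x))%E).
    apply: ae_ge0_le_integral => //; first exact: measurable_I01.
    - by move=> x _; rewrite lee_fin mulr_ge0 ?sqr_ge0 ?wt_ge0.
    - by move=> x _; rewrite mule_ge0// lee_fin.
    - exact: measurable_funeM.
    - move: Sae; apply: aeS => x h1 Ix; have Sx := h1 Ix.
      rewrite -(fineK Sx) -EFinM lee_fin (le_trans (gb x n Ix Sx))//.
      by rewrite le_eqVlt; apply/orP; left; apply/eqP; ring.
  rewrite ge0_integralZl//; last exact: measurable_I01.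
  apply: (@le_trans _ _ ((2 * (2 ^+ n)^-1)%:E * (2 * C)%:E)%E).
    by rewrite lee_wpmul2l// lee_fin.
  by rewrite -EFinM lee_fin le_eqVlt; apply/orP; left; apply/eqP; ring.
have gfL n : weightedL2 (fun x => g x - f n x).
  split => //; apply/integrableP; split.
    apply/measurable_EFinP; apply: measurable_funM; last exact: measurable_wt.
    exact: (measurable_funX 2 (mgf n)).
  rewrite (le_lt_trans _ (ltry (4 * C * (2 ^+ n)^-1)))// (le_trans _ (igf n))//.
  rewrite le_eqVlt; apply/orP; left; apply/eqP; apply: eq_integral => x _.
  by rewrite gee0_abs// lee_fin mulr_ge0 ?sqr_ge0 ?wt_ge0.
exists g.
  have := weightedL2D (gfL 0%N) (hf 0%N); congr weightedL2.
  by apply/funext => x; rewrite subrK.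
move=> n; rewrite -lee_fin /wip /Rintegral fineK.
  by under eq_integral do rewrite -expr2; exact: igf.
by apply: integral_fin => //; exact: wip_integrable.
Qed.

End Completeness.

(** * The operator [A] and its inverse *)

Section SturmLiouville.
Context {R : realType}.
Notation mu := (@lebesgue_measure R).
Notation I01 := (@I01 R).
Implicit Types (u v f g Y : R -> R) (x a b : R).
Hint Resolve measurable_I01 measurable_itvR : core.

(** Here [v] is [x^2 u']: the equation [A u = f] as a first order system. *)
Definition solvesA u f := exists v, antider 0 1 u (fun x => v x / x ^+ 2) /\
  antider 0 1 v (fun x => 2 * u x - wt x * f x).

(** With [z = x u / sqrt (1 - x^2)] and [t = artanh x] this is [z^2]. For [Y = x u - x^2 u'],
    [decay_inner Y] is the square of [((2 - x^2) / x) z - dz/dt], a first order factor of [A]. *)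
Definition decay_outer u x := x ^+ 2 * u x ^+ 2 / (1 - x ^+ 2).
Definition decay_inner Y x := Y x ^+ 2 * (1 - x ^+ 2) / x ^+ 2.

(** Each quantity is bounded and tends to 0 at one end only, [decay_inner] at 0 and [decay_outer] at
    1. This is enough for boundary terms, because the product of the two is [(u Y)^2]. *)
Definition regular_pair u Y := exists M, [/\ 0 <= M,
  forall x, 0 < x < 1 -> decay_outer u x <= M,
  forall x, 0 < x < 1 -> decay_inner Y x <= M,
  forall eps, 0 < eps -> exists2 d, 0 < d & forall x, 0 < x < 1 -> x < d ->
     decay_inner Y x <= eps &
  forall eps, 0 < eps -> exists2 d, 0 < d & forall x, 0 < x < 1 -> 1 - x < d ->
     decay_outer u x <= eps].

Lemma continuous_integrable g a b : (forall x, 0 < x < 1 -> {for x, continuous g}) ->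
  0 < a -> a <= b -> b < 1 -> mu.-integrable `]a, b] (EFin \o g).
Proof.
move=> cg a0 ab b1.
have : mu.-integrable `[a, b] (EFin \o g).
  apply: continuous_compact_integrable; first exact: segment_compact.
  apply: continuous_in_subspaceT => x; rewrite inE/= in_itv/= => /andP[ax xb].
  by apply: cg; rewrite (lt_le_trans a0 ax) (le_lt_trans xb b1).
by apply: integrable_subset => // x /=; rewrite !in_itv/= => /andP[/ltW -> ->].
Qed.

Lemma antider_const F : antider 0 1 F (fun=> 0) -> forall x y, 0 < x < 1 -> 0 < y < 1 ->
  F x = F y.
Proof.
move=> HF x y /andP[x0 x1] /andP[y0 y1].
wlog xy : x y x0 x1 y0 y1 / x <= y.
  move=> H; have [xy|/ltW yx] := leP x y; first exact: H.
  by rewrite (H y x).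
have [_] := HF x y x0 xy y1; rewrite Rintegral_cst// mul0r => /eqP.
by rewrite subr_eq0 => /eqP ->.
Qed.

Lemma antider_inv n : antider 0 1 (fun x : R => (x ^+ n)^-1) (fun x => - n%:R / x ^+ n.+1).
Proof.
have cX m x : 0 < x < 1 -> {for x, continuous (fun y : R => (y ^+ m)^-1)}.
  move=> /andP[x0 _]; apply: continuousV; first by rewrite gt_eqF// exprn_gt0.
  exact: exprn_continuous.
apply: derive_antider => x x01; last first.
  apply: continuousM; last exact: cX.
  exact: cst_continuous.
have /andP[x0 _] := x01.
have dX := derive_pow n x.
have xn : x ^+ n != 0 by rewrite gt_eqF// exprn_gt0.
apply: (derive_eq (derive_inv dX xn)).
case: n {dX} xn => [|n] xn /=; first by rewrite !mul0r oppr0 !mul0r.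
rewrite [x ^+ n.+2]exprS [x ^+ n.+1]exprS; field.
by rewrite expf_neq0 !gt_eqF.
Qed.

Lemma antider_pow n : antider 0 1 (fun x : R => x ^+ n) (fun x => n%:R * x ^+ n.-1).
Proof.
apply: derive_antider => x x01.
  exact: derive_pow.
apply: continuousM; first exact: cst_continuous.
exact: exprn_continuous.
Qed.

(** The solutions are spanned by [x] and [x^-2]. The two conserved quantities single out one
    coefficient each: [v x - u x^2] is -3 times that of [x^-2], and [v / x^2 + 2 u / x] is 3 times
    that of [x]. *)
Lemma homogeneous_explicit u v : antider 0 1 u (fun x => v x / x ^+ 2) ->
  antider 0 1 v (fun x => 2 * u x) ->
  exists c1 c2, forall x, 0 < x < 1 -> u x = (c2 * x - c1 / x ^+ 2) / 3.
Proof.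
move=> Hu Hv.
have h12 : 0 < (2^-1 : R) < 1 by apply/andP; split; lra.
have K1 : antider 0 1 (fun x => v x * x ^+ 1 - u x * x ^+ 2) (fun=> 0).
  apply: antider_ext (antiderB (antiderM Hv (antider_pow 1)) (antiderM Hu (antider_pow 2))) _ _ => //.
  move=> x /andP[x0 _] /=; rewrite expr0 expr1; field; rewrite gt_eqF//.
have K2 : antider 0 1 (fun x => v x * (x ^+ 2)^-1 + 2 * (u x * (x ^+ 1)^-1)) (fun=> 0).
  apply: antider_ext (antiderD (antiderM Hv (antider_inv 2)) (antiderZ 2 (antiderM Hu (antider_inv 1)))) _ _ => //.
  move=> x /andP[x0 _] /=; rewrite expr1; field; rewrite gt_eqF//.
exists (v 2^-1 * 2^-1 ^+ 1 - u 2^-1 * 2^-1 ^+ 2).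
exists (v 2^-1 * (2^-1 ^+ 2)^-1 + 2 * (u 2^-1 * (2^-1 ^+ 1)^-1)) => x x01.
rewrite -(antider_const K1 x01 h12) -(antider_const K2 x01 h12).
by rewrite expr1; field; rewrite gt_eqF//; case/andP: x01.
Qed.

(** At 1 the weight grows like [(1 - x)^-2] and forces [u] to vanish there, that is [c1 = c2]. What
    remains is a multiple of [x - x^-2], which is not square integrable at 0, although [wt] behaves
    like [x^2]. *)
Lemma homogeneous_zero u : weightedL2 u -> solvesA u (fun=> 0) ->
  forall x, 0 < x < 1 -> u x = 0.
Proof.
move=> Lu [v [Hu Hv]].
have {}Hv : antider 0 1 v (fun x => 2 * u x).
  by apply: antider_ext Hv _ _ => // x _; rewrite mulr0 subr0.
have [c1 [c2 E]] := homogeneous_explicit Hu Hv.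
have c12 : c1 = c2.
  apply/eqP/negPn/negP => c12.
  pose g x := c2 * x - c1 / x ^+ 2.
  have cg : {for 1, continuous g}.
    apply: continuousB.
      by apply: continuousM; [exact: cst_continuous|exact: cvg_id].
    apply: continuousM; first exact: cst_continuous.
    apply: continuousV; first by rewrite expr1n oner_neq0.
    exact: exprn_continuous.
  have g1 : g 1 = c2 - c1 by rewrite /g expr1n mulr1 divr1.
  have e0 : 0 < `|c2 - c1| / 2 by rewrite divr_gt0// normr_gt0 subr_eq0 eq_sym.
  have /cvgrPdist_lt/(_ _ e0)/nbhs_ballP[d /= d0 Hd] := cg.
  pose b0 := Num.max (1 / 2) (1 - d).
  (* The factor 4 comes from [g] being at least half its value at 1, 9 from the denominator 3 of
     [u], and 16 from the lower bound of the weight on [(1/2, 1)]. *)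
  apply: (@not_weightedL2_near1 R u b0 (`|c2 - c1| ^+ 2 / 4 / 9 / 16) Lu).
  - by rewrite le_max gt_max; apply/andP; split; [apply/orP; left|apply/andP; split]; lra.
  - by rewrite !divr_gt0 ?ltr0n// exprn_gt0// normr_gt0 subr_eq0 eq_sym.
  move=> x /andP[]; rewrite gt_max => /andP[x2 xd] x1.
  have x0 : 0 < x by lra.
  rewrite E ?x0// -/(g x).
  have : `|g 1 - g x| < `|c2 - c1| / 2.
    by apply: Hd; rewrite /ball/= gtr0_norm ?subr_gt0//; lra.
  rewrite g1 => h.
  have gx : `|c2 - c1| / 2 <= `|g x|.
    have := ler_normD (c2 - c1 - g x) (g x); rewrite subrK => h2; lra.
  have gx2 : `|c2 - c1| ^+ 2 / 4 <= g x ^+ 2.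
    have -> : `|c2 - c1| ^+ 2 / 4 = (`|c2 - c1| / 2) ^+ 2 by field.
    rewrite -[leRHS]real_normK ?num_real// lerXn2r ?nnegrE//; exact: ltW.
  have wx : 16^-1 / (1 - x) <= wt x.
    rewrite /wt.
    have p1 : 0 < 1 - x by lra.
    have p2 : 0 < (1 - x ^+ 2) ^+ 2.
      by rewrite exprn_gt0// onem_sqr_gt0// x0.
    rewrite ler_pdivrMr// mulrAC ler_pdivlMr//.
    have h1 : (1 + x) ^+ 2 <= 4 by nra.
    have h3 : (1 - x) * (1 + x) ^+ 2 <= 2 by nra.
    have h4 : 2 <= 16 * x ^+ 2 by nra.
    have h5 : 0 <= (16 * x ^+ 2 - (1 - x) * (1 + x) ^+ 2) * (1 - x).
      by apply: mulr_ge0; lra.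
    have -> : 16^-1 * (1 - x ^+ 2) ^+ 2 = x ^+ 2 * (1 - x) -
      (16 * x ^+ 2 - (1 - x) * (1 + x) ^+ 2) * (1 - x) / 16 by field.
    by rewrite lerBlDr lerDl divr_ge0.
  have -> : `|c2 - c1| ^+ 2 / 4 / 9 / 16 / (1 - x) =
    (`|c2 - c1| ^+ 2 / 4 / 9) * (16^-1 / (1 - x)) by field; lra.
  apply: ler_pM => //.
  - by rewrite divr_ge0//; lra.
  - have -> : (g x / 3) ^+ 2 = g x ^+ 2 / 9 by field.
    by rewrite ler_pM2r.
suff c0 : c1 = 0 by move=> x x01; rewrite E// -c12 c0 !mul0r subrr mul0r.
apply/eqP/negPn/negP => c10.
apply: (@not_weightedL2_near0 R u (1 / 2) (c1 ^+ 2 / 36) Lu).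
- by apply/andP; split; lra.
- by rewrite divr_gt0// exprn_even_gt0.
move=> x /andP[x0 x2]; rewrite E; last by apply/andP; split; lra.
rewrite -c12.
have -> : ((c1 * x - c1 / x ^+ 2) / 3) ^+ 2 * wt x =
  c1 ^+ 2 / 36 / x * (4 * (1 - x ^+ 3) ^+ 2 / (x * (1 - x ^+ 2) ^+ 2)).
  rewrite /wt; field; rewrite !gt_eqF//; nra.
rewrite -[leLHS]mulr1; apply: ler_wpM2l.
  by rewrite !divr_ge0 ?sqr_ge0//; lra.
have p2 : 0 < (1 - x ^+ 2) ^+ 2.
  by rewrite exprn_gt0// onem_sqr_gt0// x0/=; lra.
rewrite ler_pdivlMr ?mul1r; last exact: mulr_gt0.
have s0 := sqr_ge0 x.
have s1 : x ^+ 2 <= 1 / 4 by nra.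
have h1 : (1 - x ^+ 2) ^+ 2 <= 1 by rewrite exprn_ile1//; lra.
have h2 : x * (1 - x ^+ 2) ^+ 2 <= 1 by nra.
have h3 : x ^+ 3 <= 1 / 8 by rewrite !exprS expr0 mulr1; nra.
nra.
Qed.

End SturmLiouville.

(** * Inversion of the operator by two Hardy-type steps *)

Section InverseOfA.
Context {R : realType}.
Notation mu := (@lebesgue_measure R).
Notation I01 := (@I01 R).
Implicit Types (u v f g Y : R -> R) (x a b : R).
Hint Resolve measurable_I01 measurable_itvR : core.

Lemma sub_I01 a b : 0 <= a -> b < 1 -> `]a, b] `<=` I01.
Proof.
move=> a0 b1 x /=; rewrite in_itv/= => /andP[ax xb]; apply/I01P.
by rewrite (le_lt_trans a0 ax) (le_lt_trans xb b1).
Qed.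

Lemma sub_I01_right a : 0 <= a -> `]a, 1[ `<=` I01.
Proof.
move=> a0 x /=; rewrite in_itv/= => /andP[ax xb]; apply/I01P.
by rewrite (le_lt_trans a0 ax) xb.
Qed.

Lemma ler_transfer (p q i j n : R) : p - q <= i - j -> i <= n -> p + j <= q + n.
Proof. lra. Qed.

Lemma bounded_integral (D : set R) g (M m : R) : measurable D -> mu D = m%:E ->
  measurable_fun D g -> (forall x, D x -> 0 <= g x <= M) ->
  mu.-integrable D (EFin \o g) /\ \int[mu]_(x in D) g x <= M * m.
Proof.
move=> mD muD mg gM.
have ic : mu.-integrable D (EFin \o (fun=> M)).
  apply/integrableP; split; first by apply/measurable_EFinP; exact: measurable_cst.
  rewrite (_ : (\int[mu]_(x in D) `|(EFin \o (fun=> M)) x| = `|M|%:E * m%:E)%E) ?ltry//.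
  by rewrite (_ : (fun x => `|(EFin \o (fun=> M)) x|%E) = cst `|M|%:E)// integral_cst// -muD.
have ig : mu.-integrable D (EFin \o g).
  apply: (integrable_dominated _ _ _ ic) => // x /gM/andP[g0 gM'].
  by rewrite ger0_norm.
split => //; apply: (@le_trans _ _ (\int[mu]_(x in D) M)).
  by apply: le_Rintegral => // x /gM/andP[].
by rewrite Rintegral_cst// -[leRHS]/(M * fine m%:E) -muD; exact: lexx.
Qed.

Lemma integrable_patch (D : set R) g : measurable D ->
  mu.-integrable D (EFin \o g) -> mu.-integrable setT (EFin \o (g \_ D)).
Proof. by move=> mD; rewrite integrable_mkcond// restrict_EFin. Qed.

Lemma continuous_invX n (t : R) : 0 < t -> {for t, continuous (fun t : R => (t ^+ n)^-1)}.
Proof.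
move=> t0; apply: continuousV; last exact: exprn_continuous.
by rewrite gt_eqF// exprn_gt0.
Qed.

Lemma measurable_invX n : measurable_fun I01 (fun t : R => (t ^+ n)^-1).
Proof.
apply: open_continuous_measurable_fun; first exact: interval_open.
by move=> t; rewrite inE => /I01P/andP[t0 _]; exact: continuous_invX.
Qed.

Section Construction.
Variable f : R -> R.
Hypothesis Lf : weightedL2 f.
Let N := wip f f.
Let N0 : 0 <= N. Proof. exact: wip_ge0. Qed.

(** The integrand [x w f] of [I] below is split as [p q] for Cauchy-Schwarz: [q^2 = f^2 w] is
    integrable up to 1, and [p^2] is small at 0. *)
Let p x := x ^+ 2 / (1 - x ^+ 2).
Let q x := x * f x / (1 - x ^+ 2).

Let pq x : 0 < x < 1 -> p x * q x = x * wt x * f x.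
Proof. by move=> /onem_sqr_gt0 h; rewrite /p /q /wt; field; rewrite gt_eqF. Qed.

Let q2 x : 0 < x < 1 -> q x ^+ 2 = f x ^+ 2 * wt x.
Proof. by move=> /onem_sqr_gt0 h; rewrite /q /wt; field; rewrite gt_eqF. Qed.

Let c_inv x : 0 < x < 1 -> {for x, continuous (fun y : R => (1 - y ^+ 2)^-1)}.
Proof.
move=> /onem_sqr_gt0 h; apply: continuousV; first by rewrite gt_eqF.
by apply: continuousB; [exact: cst_continuous|exact: exprn_continuous].
Qed.

Let m_inv : measurable_fun I01 (fun y : R => (1 - y ^+ 2)^-1).
Proof.
apply: open_continuous_measurable_fun; first exact: interval_open.
by move=> x; rewrite inE => /I01P/c_inv.
Qed.

Let mp : measurable_fun I01 p.
Proof. by apply: measurable_funM => //; exact: measurable_funX. Qed.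

Let mq : measurable_fun I01 q.
Proof.
by apply: measurable_funM => //; apply: measurable_funM => //; case: Lf.
Qed.

Let wf_int a b : 0 <= a -> b < 1 ->
  mu.-integrable `]a, b] (EFin \o (fun x => f x ^+ 2 * wt x)) /\
  \int[mu]_(x in `]a, b]) (f x ^+ 2 * wt x) <= N.
Proof.
move=> a0 b1; case: (Lf) => mf i1.
have i2 := integrable_subset measurable_I01 (measurable_itvR `]a, b]) (sub_I01 a0 b1) i1.
split => //; rewrite /N /wip; under [leRHS]eq_Rintegral do rewrite -expr2.
apply: (ge0_integral_subset measurable_I01 _ (sub_I01 a0 b1) _ i1) => // x _.
by rewrite mulr_ge0 ?sqr_ge0 ?wt_ge0.
Qed.

Let q_int b : b < 1 -> mu.-integrable `]0, b] (EFin \o (fun x => q x ^+ 2)) /\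
  \int[mu]_(x in `]0, b]) (q x ^+ 2) <= N.
Proof.
move=> b1; have [i1 i2] := wf_int (lexx 0) b1.
split.
  by apply: eq_integrable i1 => // x; rewrite inE => /(sub_I01 (lexx 0) b1)/I01P h /=; rewrite q2.
apply: le_trans i2; rewrite le_eqVlt; apply/orP; left; apply/eqP.
by apply: eq_Rintegral => x; rewrite inE => /(sub_I01 (lexx 0) b1)/I01P h /=; rewrite q2.
Qed.

Let p_int b : 0 < b < 1 -> mu.-integrable `]0, b] (EFin \o (fun x => p x ^+ 2)) /\
  \int[mu]_(x in `]0, b]) (p x ^+ 2) <= b ^+ 5 / (1 - b ^+ 2) ^+ 2.
Proof.
move=> b01; have /andP[b0 b1] := b01.
have sub := sub_I01 (lexx 0) b1.
have bnd x : `]0, b]%classic x -> p x ^+ 2 <= b ^+ 4 / (1 - b ^+ 2) ^+ 2.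
  rewrite /= in_itv/= => /andP[x0 xb].
  have x1 : 0 < x < 1 by rewrite x0 (le_lt_trans xb).
  have -> : b ^+ 4 / (1 - b ^+ 2) ^+ 2 = (b ^+ 2 / (1 - b ^+ 2)) ^+ 2.
    by field; rewrite gt_eqF// onem_sqr_gt0.
  have hx := onem_sqr_gt0 x1; have hb := onem_sqr_gt0 b01.
  have xb2 : x ^+ 2 <= b ^+ 2 by rewrite lerXn2r ?nnegrE// ltW.
  have p0 : 0 <= p x by apply: divr_ge0; [exact: sqr_ge0|exact: ltW].
  have pb : p x <= b ^+ 2 / (1 - b ^+ 2).
    apply: ler_pM => //; first exact: sqr_ge0.
      by rewrite invr_ge0 ltW.
    by rewrite lef_pV2 ?posrE// lerB.
  by rewrite ler_sqr ?nnegrE// (le_trans p0).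
have mub : mu `]0, b]%classic = b%:E.
  by rewrite lebesgue_measure_itv/= lte_fin b0 -EFinB subr0.
have mp2 : measurable_fun `]0, b] (fun x => p x ^+ 2).
  by apply: measurable_funX; exact: (measurable_funS measurable_I01 sub mp).
have bnd' x : `]0, b]%classic x -> 0 <= p x ^+ 2 <= b ^+ 4 / (1 - b ^+ 2) ^+ 2.
  by move=> /bnd ->; rewrite sqr_ge0.
have [i1 i2] := bounded_integral (measurable_itvR _) mub mp2 bnd'.
split => //; apply: (le_trans i2).
by rewrite le_eqVlt; apply/orP; left; apply/eqP; rewrite mulrAC -exprSr.
Qed.

(** With [Y = x u - x^2 u'] the equation splits into [(x Y)' = x w f] and [(u / x)' = - Y / x^3].
    The first is integrated from 0, which excludes the solution [x^-2], the second from 1, which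
    excludes the solution [x]; [I] is [x Y] and [J] will be [u / x]. *)
Let I x := \int[mu]_(t in `]0, x]) (t * wt t * f t).

Let i_int b : 0 < b < 1 ->
  mu.-integrable `]0, b] (EFin \o (fun t => t * wt t * f t)) /\
  I b ^+ 2 <= b ^+ 5 / (1 - b ^+ 2) ^+ 2 * N.
Proof.
move=> b01; have /andP[b0 b1] := b01; have sub := sub_I01 (lexx 0) b1.
have [ip Hp] := p_int b01; have [iq Hq] := q_int b1.
have mp' : measurable_fun `]0, b] p by exact: (measurable_funS measurable_I01 sub mp).
have mq' : measurable_fun `]0, b] q by exact: (measurable_funS measurable_I01 sub mq).
have E x : x \in `]0, b]%classic -> p x * q x = x * wt x * f x.
  by rewrite inE => /sub/I01P/pq.
split.
  apply: eq_integrable (integrable_mul _ mp' mq' ip iq) => // x /E h.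
  by rewrite /= h.
have -> : I b = \int[mu]_(x in `]0, b]) (p x * q x).
  by apply: eq_Rintegral => x /E.
apply: le_trans (Rintegral_cauchy_schwarz _ mp' mq' ip iq) _ => //.
apply: ler_pM => //; apply: Rintegral_ge0 => x _; exact: sqr_ge0.
Qed.

Let antI : antider 0 1 I (fun t => t * wt t * f t).
Proof.
move=> a b a0 ab b1.
have [ib _] : mu.-integrable `]0, b] (EFin \o (fun t => t * wt t * f t)) /\
  I b ^+ 2 <= b ^+ 5 / (1 - b ^+ 2) ^+ 2 * N.
  by apply: i_int; rewrite b1 andbT (lt_le_trans a0).
split.
  by apply: integrable_subset ib => // x /=; rewrite !in_itv/= => /andP[/(lt_trans a0) -> ->].
by rewrite /I Rintegral_itvB// bnd_simp ltW.
Qed.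

Let Y x := I x * (x ^+ 1)^-1.

Let YE x : Y x = I x / x. Proof. by rewrite /Y expr1. Qed.

Let antY : antider 0 1 Y (fun x => wt x * f x - Y x / x).
Proof.
apply: antider_ext (antiderM antI (antider_inv 1)) _ _ => //.
move=> x /andP[x0 _]; rewrite YE expr1; field; rewrite gt_eqF//.
Qed.

Let contY x : 0 < x < 1 -> {for x, continuous Y}.
Proof. exact: antider_continuous antY. Qed.

Let Pge0 x : 0 < x < 1 -> 0 <= decay_inner Y x.
Proof.
move=> /onem_sqr_gt0 h; rewrite /decay_inner divr_ge0 ?sqr_ge0//.
by rewrite mulr_ge0 ?sqr_ge0// ltW.
Qed.

Let Psmall x : 0 < x < 1 -> decay_inner Y x <= 2 * x / (1 - x) * N.
Proof.
move=> x01; have /andP[x0 x1] := x01; have h := onem_sqr_gt0 x01.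
have [_ H] := i_int x01.
have -> : decay_inner Y x = I x ^+ 2 * ((1 - x ^+ 2) / x ^+ 4).
  by rewrite /decay_inner YE; field; rewrite gt_eqF.
have c0 : 0 <= (1 - x ^+ 2) / x ^+ 4 by rewrite divr_ge0 ?exprn_ge0 ?ltW.
apply: le_trans (ler_wpM2r c0 H) _.
have -> : x ^+ 5 / (1 - x ^+ 2) ^+ 2 * N * ((1 - x ^+ 2) / x ^+ 4) =
   x / (1 - x ^+ 2) * N by field; rewrite !gt_eqF.
rewrite ler_wpM2r//.
rewrite ler_pdivrMr// mulrAC ler_pdivlMr ?subr_gt0//.
have : 0 <= x * (1 - x) * (1 + 2 * x) by rewrite !mulr_ge0//; lra.
nra.
Qed.

Let antP : antider 0 1 (decay_inner Y) (fun x =>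
  2 * Y x * (wt x * f x - Y x / x) * ((1 - x ^+ 2) / x ^+ 2) - 2 * Y x ^+ 2 / x ^+ 3).
Proof.
have := antiderM (antiderM antY antY) (antiderB (antider_inv 2) (antider_pow 0)).
move/antider_ext; apply => x /andP[x0 _] /=.
  by rewrite /decay_inner expr0; field; rewrite gt_eqF.
by rewrite expr0; field; rewrite gt_eqF.
Qed.

Let contYY x : 0 < x < 1 -> {for x, continuous (fun x => Y x ^+ 2 / x ^+ 2)}.
Proof.
move=> x01; have cY := contY x01.
have cY2 : {for x, continuous (fun x => Y x ^+ 2)}.
  by apply: (@continuous_comp _ _ _ Y (fun z => z ^+ 2)) => //; exact: exprn_continuous.
apply: (continuousM cY2); apply: continuousV; last exact: exprn_continuous.
by rewrite gt_eqF// exprn_gt0//; case/andP: x01.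
Qed.

Let iYY a b : 0 < a -> a <= b -> b < 1 ->
  mu.-integrable `]a, b] (EFin \o (fun x => Y x ^+ 2 / x ^+ 2)).
Proof. by apply: continuous_integrable => x; exact: contYY. Qed.

(** A Hardy inequality with its boundary terms: [f^2 w - Y^2 / x^2] exceeds the derivative of
    [decay_inner Y] by a square plus a nonnegative multiple of [Y^2]. *)
Let energyY a b : 0 < a -> a <= b -> b < 1 ->
  decay_inner Y b + \int[mu]_(x in `]a, b]) (Y x ^+ 2 / x ^+ 2) <= decay_inner Y a + N.
Proof.
move=> a0 ab b1; have [i1 E1] := antP a0 ab b1.
have [i2 H2] := wf_int (ltW a0) b1.
have i3 := iYY a0 ab b1.
apply: ler_transfer H2.
rewrite E1 -RintegralB//; apply: le_Rintegral => //; first exact: integrable_sub.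
move=> x /(sub_I01 (ltW a0) b1)/I01P x01.
have /andP[x0 x1] := x01; have h := onem_sqr_gt0 x01.
have -> : f x ^+ 2 * wt x - Y x ^+ 2 / x ^+ 2 =
  (2 * Y x * (wt x * f x - Y x / x) * ((1 - x ^+ 2) / x ^+ 2) - 2 * Y x ^+ 2 / x ^+ 3)
  + (Y x / x - f x * x / (1 - x ^+ 2)) ^+ 2
  + Y x ^+ 2 * (2 * (1 - x) * (x + 2) / x ^+ 3).
  by rewrite /wt; field; rewrite !gt_eqF.
rewrite -addrA lerDl addr_ge0 ?sqr_ge0//.
apply: mulr_ge0; first exact: sqr_ge0.
by rewrite divr_ge0 ?exprn_ge0 ?(ltW x0)// !mulr_ge0//; lra.
Qed.

(** [Psmall] degenerates at 1, so it is used only up to [1 / 2], where it gives [2 N]; from there on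
    the energy inequality adds at most [N]. *)
Let PleN x : 0 < x < 1 -> decay_inner Y x <= 3 * N.
Proof.
move=> x01; have /andP[x0 x1] := x01.
have half y : 0 < y -> y <= 1 / 2 -> decay_inner Y y <= 2 * N.
  move=> y0 y2; have y01 : 0 < y < 1 by rewrite y0/=; lra.
  apply: le_trans (Psmall y01) _; rewrite ler_wpM2r//.
  by rewrite ler_pdivrMr; lra.
have [x2|/ltW x2] := leP x (1 / 2).
  by apply: le_trans (half x x0 x2) _; rewrite ler_wpM2r//; lra.
have c0 : 0 < 1 / 2 :> R by lra.
have h1 := half _ c0 (lexx _).
have h2 : 0 <= \int[mu]_(t in `](1 / 2), x]) (Y t ^+ 2 / t ^+ 2).
  by apply: Rintegral_ge0 => t _; rewrite divr_ge0 ?sqr_ge0.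
have -> : 3 * N = 2 * N + N by ring.
apply: le_trans (_ : _ <= decay_inner Y (1 / 2) + N) _; last by rewrite lerD2r.
by apply: le_trans (energyY c0 x2 x1); rewrite lerDl.
Qed.

Let mYY : measurable_fun I01 (fun x => Y x ^+ 2 / x ^+ 2).
Proof.
apply: open_continuous_measurable_fun; first exact: interval_open.
by move=> x; rewrite inE => /I01P; exact: contYY.
Qed.

Let YYint : mu.-integrable I01 (EFin \o (fun x => Y x ^+ 2 / x ^+ 2)) /\
  \int[mu]_(x in I01) (Y x ^+ 2 / x ^+ 2) <= 4 * N.
Proof.
apply: integrable_exhaustion => //.
  by move=> x _; rewrite divr_ge0 ?sqr_ge0.
move=> a b a0 ab b1; split; first exact: iYY.
have a01 : 0 < a < 1 by rewrite a0 (le_lt_trans ab b1).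
have b01 : 0 < b < 1 by rewrite b1 (lt_le_trans a0 ab).
have -> : 4 * N = 3 * N + N by ring.
apply: le_trans (_ : _ <= decay_inner Y a + N) _; last by rewrite lerD2r PleN.
by apply: le_trans (energyY a0 ab b1); rewrite lerDr Pge0.
Qed.

Let tail x := \int[mu]_(t in `]x, 1[) (Y t ^+ 2 / t ^+ 2).

Let tail_int x : 0 < x -> mu.-integrable `]x, 1[ (EFin \o (fun t => Y t ^+ 2 / t ^+ 2)).
Proof.
move=> x0; apply: integrable_subset YYint.1 => //; exact: sub_I01_right (ltW x0).
Qed.

Let tail_le x : 0 < x -> tail x <= 4 * N.
Proof.
move=> x0; apply: le_trans YYint.2; apply: ge0_integral_subset => //.
- exact: sub_I01_right (ltW x0).
- by move=> t _; rewrite divr_ge0 ?sqr_ge0.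
- exact: YYint.1.
Qed.

Let tail_ge0 x : 0 <= tail x.
Proof. by apply: Rintegral_ge0 => t _; rewrite divr_ge0 ?sqr_ge0. Qed.

Let tail_small eps : 0 < eps -> exists2 d, 0 < d & forall x, 0 < x < 1 -> 1 - x < d ->
  tail x <= eps.
Proof.
move=> e0; pose h := (fun t => Y t ^+ 2 / t ^+ 2) \_ I01.
have ih := integrable_patch measurable_I01 YYint.1.
have [d [d0 Hd]] := integral_normr_continuous ih e0.
exists d => // x /andP[x0 x1] xd.
have mx : measurable (`]x, 1[%classic : set R) by [].
have : \int[mu]_(t in `]x, 1[) `|h t| < eps.
  apply: Hd; first exact: (measurable_itvR `]x, 1[).
  have mux : (mu `]x, 1%R[%classic < d%:E)%E.
    by rewrite lebesgue_measure_itv/= lte_fin x1 -EFinB lte_fin.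
  exact: mux.
move/ltW; apply: le_trans; rewrite le_eqVlt; apply/orP; left; apply/eqP.
apply: eq_Rintegral => t; rewrite inE => /(sub_I01_right (ltW x0)) It.
by rewrite /h patchE mem_set// ger0_norm// divr_ge0 ?sqr_ge0.
Qed.

Let J x := \int[mu]_(t in `]x, 1[) (Y t / t ^+ 3).

Let one_mu x : 0 < x < 1 -> mu.-integrable `]x, 1[ (EFin \o (fun t : R => (t ^+ 2)^-1 ^+ 2)) /\
  \int[mu]_(t in `]x, 1[) ((t ^+ 2)^-1 ^+ 2) <= (1 - x) / x ^+ 4.
Proof.
move=> x01; have /andP[x0 x1] := x01.
have bnd t : `]x, 1[%classic t -> (t ^+ 2)^-1 ^+ 2 <= (x ^+ 4)^-1.
  rewrite /= in_itv/= => /andP[xt t1]; have t0 := lt_trans x0 xt.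
  rewrite -exprVn -exprM exprVn lef_pV2 ?posrE ?exprn_gt0//.
  by rewrite lerXn2r ?nnegrE// ltW.
have mux : mu `]x, 1[%classic = (1 - x)%:E.
  by rewrite lebesgue_measure_itv/= lte_fin x1 -EFinB.
have m2 : measurable_fun `]x, 1[ (fun t : R => (t ^+ 2)^-1 ^+ 2).
  apply: measurable_funX; apply: (measurable_funS measurable_I01).
    exact: sub_I01_right (ltW x0).
  exact: measurable_invX.
have bnd' t : `]x, 1[%classic t -> 0 <= (t ^+ 2)^-1 ^+ 2 <= (x ^+ 4)^-1.
  by move=> /bnd ->; rewrite sqr_ge0.
have [i1 i2] := bounded_integral (measurable_itvR _) mux m2 bnd'.
by split => //; rewrite mulrC.
Qed.

Let m_tail x : 0 < x -> measurable_fun `]x, 1[ (fun t : R => (t ^+ 2)^-1) /\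
  measurable_fun `]x, 1[ (fun t => Y t / t).
Proof.
move=> x0; have sub := sub_I01_right (ltW x0); split; apply: (measurable_funS measurable_I01 sub).
  exact: measurable_invX.
have := measurable_funM (antider_measurable_primitive antY) (measurable_invX 1).
by congr measurable_fun; apply/funext => t; rewrite expr1.
Qed.

Let J_int x : 0 < x < 1 ->
  mu.-integrable `]x, 1[ (EFin \o (fun t => Y t / t ^+ 3)) /\
  J x ^+ 2 <= (1 - x) / x ^+ 4 * tail x.
Proof.
move=> x01; have /andP[x0 x1] := x01; have sub := sub_I01_right (ltW x0).
have [i1 H1] := one_mu x01; have [m1 m2] := m_tail x0.
have i2 : mu.-integrable `]x, 1[ (EFin \o (fun t => (Y t / t) ^+ 2)).
  by apply: integrable_ext (tail_int x0) => // t _; rewrite [RHS]expr_div_n.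
have E t : t \in `]x, 1[%classic -> (t ^+ 2)^-1 * (Y t / t) = Y t / t ^+ 3.
  rewrite inE => /sub/I01P/andP[t0 _]; field; rewrite gt_eqF//.
split.
  apply: eq_integrable (integrable_mul _ m1 m2 i1 i2) => // t /E h.
  by rewrite /= h.
have -> : J x = \int[mu]_(t in `]x, 1[) ((t ^+ 2)^-1 * (Y t / t)).
  by apply: eq_Rintegral => t /E.
apply: le_trans (Rintegral_cauchy_schwarz _ m1 m2 i1 i2) _ => //.
have -> : tail x = \int[mu]_(t in `]x, 1[) (Y t / t) ^+ 2.
  by apply: eq_Rintegral => t _; rewrite [RHS]expr_div_n.
by rewrite ler_wpM2r//; apply: Rintegral_ge0 => t _; exact: sqr_ge0.
Qed.

Let antJ : antider 0 1 J (fun t => - (Y t / t ^+ 3)).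
Proof.
move=> a b a0 ab b1.
have a01 : 0 < a < 1 by rewrite a0 (le_lt_trans ab).
have [ia _] := J_int a01.
have sub : `]a, b]%classic `<=` `]a, 1[%classic.
  by move=> x /=; rewrite !in_itv/= => /andP[-> /le_lt_trans ->].
have ib := integrable_subset (measurable_itvR _) (measurable_itvR _) sub ia.
split.
  by apply: eq_integrable (integrable_scale _ (-1) ib) => // t _ /=; rewrite mulN1r.
have -> : \int[mu]_(t in `]a, b]) (- (Y t / t ^+ 3)) =
    - \int[mu]_(t in `]a, b]) (Y t / t ^+ 3).
  rewrite -mulN1r -Rintegral_scale//; apply: eq_Rintegral => t _.
  by rewrite mulN1r.
have -> : J b = J a - \int[mu]_(t in `]a, b]) (Y t / t ^+ 3).
  by rewrite /J (Rintegral_itvB ia) ?bnd_simp.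
ring.
Qed.

Let u x := x ^+ 1 * J x.

Let uE x : u x = x * J x. Proof. by rewrite /u expr1. Qed.

Let antu : antider 0 1 u (fun x => u x / x - Y x / x ^+ 2).
Proof.
apply: antider_ext (antiderM (antider_pow 1) antJ) _ _ => //.
by move=> x /andP[x0 _]; rewrite uE /= expr0 expr1; field; rewrite gt_eqF.
Qed.

Let contu x : 0 < x < 1 -> {for x, continuous u}.
Proof. exact: antider_continuous antu. Qed.

Let U_ge0 x : 0 < x < 1 -> 0 <= decay_outer u x.
Proof.
move=> /onem_sqr_gt0 h; rewrite /decay_outer; apply: divr_ge0; last exact: ltW.
by apply: mulr_ge0; exact: sqr_ge0.
Qed.

(** In Cauchy-Schwarz for [J] the factor [t^-2] costs [(1 - x) / x^4], which the weight of
    [decay_outer] absorbs. The limit 0 at 1 is thus that of the tail of a convergent integral. *)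
Let U_tail x : 0 < x < 1 -> decay_outer u x <= tail x.
Proof.
move=> x01; have /andP[x0 x1] := x01; have h := onem_sqr_gt0 x01.
have [_ H] := J_int x01.
have -> : decay_outer u x = J x ^+ 2 * (x ^+ 4 / (1 - x ^+ 2)).
  by rewrite /decay_outer uE; field; rewrite gt_eqF.
have c0 : 0 <= x ^+ 4 / (1 - x ^+ 2) by apply: divr_ge0; [rewrite exprn_ge0 ?ltW|exact: ltW].
apply: le_trans (ler_wpM2r c0 H) _.
have -> : (1 - x) / x ^+ 4 * tail x * (x ^+ 4 / (1 - x ^+ 2)) = tail x * (1 + x)^-1.
  have -> : 1 - x ^+ 2 = (1 - x) * (1 + x) by ring.
  by field; rewrite !gt_eqF//; lra.
by rewrite ler_piMr// invf_le1; lra.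
Qed.

Let antU : antider 0 1 (fun x => decay_outer u x) (fun x =>
  2 * x * u x ^+ 2 / (1 - x ^+ 2) ^+ 2 +
  2 * x ^+ 2 * u x * (u x / x - Y x / x ^+ 2) / (1 - x ^+ 2)).
Proof.
have antw : antider 0 1 (fun x : R => x ^+ 2 / (1 - x ^+ 2)) (fun x => 2 * x / (1 - x ^+ 2) ^+ 2).
  apply: derive_antider => x x01; have h := onem_sqr_gt0 x01.
    have n0 : 1 - x ^+ 2 != 0 by rewrite gt_eqF.
    apply: (derive_eq (derive_mul (derive_pow 2 x)
      (derive_inv (derive_sub (derive_const 1 x) (derive_pow 2 x)) n0))).
    by rewrite /= expr1; field.
  have c1 : {for x, continuous (fun x : R => 2 * x)}.
    by apply: continuousM; [exact: cst_continuous|exact: cvg_id].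
  apply: (continuousM c1); apply: continuousV; first by rewrite gt_eqF// exprn_gt0.
  apply: (@continuous_comp _ _ _ (fun y : R => 1 - y ^+ 2) (fun z => z ^+ 2)); last exact: exprn_continuous.
  by apply: continuousB; [exact: cst_continuous|exact: exprn_continuous].
have := antiderM antw (antiderM antu antu).
move/antider_ext; apply => x x01; have /andP[x0 x1] := x01; have h := onem_sqr_gt0 x01.
  by rewrite /decay_outer; field; rewrite gt_eqF.
by field; rewrite !gt_eqF.
Qed.

(** The same mechanism for the second factor, now with [Y] as data: the boundary value at [b] and
    the integral of [Y^2 / x^2] contribute [4 N] each. *)
Let energyU a b : 0 < a -> a <= b -> b < 1 ->
  mu.-integrable `]a, b] (EFin \o (fun x => u x ^+ 2 * wt x)) /\
  \int[mu]_(x in `]a, b]) (u x ^+ 2 * wt x) <= 8 * N.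
Proof.
move=> a0 ab b1.
have a01 : 0 < a < 1 by rewrite a0 (le_lt_trans ab).
have b01 : 0 < b < 1 by rewrite b1 (lt_le_trans a0).
have iu : mu.-integrable `]a, b] (EFin \o (fun x => u x ^+ 2 * wt x)).
  apply: continuous_integrable => // x x01; have h := onem_sqr_gt0 x01.
  have cu := contu x01.
  have cu2 : {for x, continuous (fun x => u x ^+ 2)}.
    by apply: (@continuous_comp _ _ _ u (fun z => z ^+ 2)) => //; exact: exprn_continuous.
  have cx2 : {for x, continuous (fun x : R => x ^+ 2)} by exact: exprn_continuous.
  apply: (continuousM cu2); apply: (continuousM cx2).
  apply: continuousV; first by rewrite gt_eqF// exprn_gt0.
  apply: (@continuous_comp _ _ _ (fun y : R => 1 - y ^+ 2) (fun z => z ^+ 2)); last exact: exprn_continuous.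
  by apply: continuousB; [exact: cst_continuous|exact: exprn_continuous].
split => //.
have [i1 E1] := antU a0 ab b1; have i3 := iYY a0 ab b1.
have H : \int[mu]_(x in `]a, b]) (u x ^+ 2 * wt x) <=
    (decay_outer u b - decay_outer u a) + \int[mu]_(x in `]a, b]) (Y x ^+ 2 / x ^+ 2).
  rewrite E1 -Rintegral_add//; apply: le_Rintegral => //; first exact: integrable_add.
  move=> x /(sub_I01 (ltW a0) b1)/I01P x01.
  have /andP[x0 x1] := x01; have h := onem_sqr_gt0 x01.
  rewrite -subr_ge0.
  have -> : 2 * x * u x ^+ 2 / (1 - x ^+ 2) ^+ 2 +
    2 * x ^+ 2 * u x * (u x / x - Y x / x ^+ 2) / (1 - x ^+ 2) + Y x ^+ 2 / x ^+ 2
    - u x ^+ 2 * wt x = (x * u x / (1 - x ^+ 2) - Y x / x) ^+ 2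
      + u x ^+ 2 * (2 * x * ((1 - x) + (1 - x ^+ 2)) / (1 - x ^+ 2) ^+ 2).
    by rewrite /wt; field; rewrite !gt_eqF.
  apply: addr_ge0; first exact: sqr_ge0.
  apply: mulr_ge0; first exact: sqr_ge0.
  by apply: divr_ge0; [rewrite !mulr_ge0//|exact: sqr_ge0]; lra.
apply: (le_trans H).
have -> : 8 * N = 4 * N + 4 * N by ring.
apply: lerD.
  have hb : decay_outer u b <= 4 * N.
    by apply: le_trans (U_tail b01) (tail_le _); case/andP: b01.
  by apply: le_trans hb; rewrite gerBl U_ge0.
apply: le_trans YYint.2; apply: (ge0_integral_subset measurable_I01 _ (sub_I01 (ltW a0) b1) _ YYint.1) => // x _.
by rewrite divr_ge0 ?sqr_ge0.
Qed.

Let Lu : weightedL2 u.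
Proof.
have mu_ : measurable_fun I01 u.
  apply: open_continuous_measurable_fun; first exact: interval_open.
  by move=> x; rewrite inE => /I01P; exact: contu.
split => //.
have [] // := @integrable_exhaustion R (fun x => u x ^+ 2 * wt x) (8 * N).
- by apply: measurable_funM; [exact: measurable_funX|exact: measurable_wt].
- by move=> x _; apply: mulr_ge0; [exact: sqr_ge0|exact: wt_ge0].
Qed.

Let pair_regular : regular_pair u Y.
Proof.
exists (4 * N); split.
- by rewrite mulr_ge0.
- move=> x x01; apply: le_trans (U_tail x01) (tail_le _); by case/andP: x01.
- move=> x x01; apply: le_trans (PleN x01) _; rewrite ler_wpM2r//; lra.
- move=> e e0; have d0 : 0 < e / (4 * N + 1) by rewrite divr_gt0// ltr_wpDl// mulr_ge0.
  exists (Num.min (1 / 2) (e / (4 * N + 1))).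
    by rewrite lt_min d0 andbT; lra.
  move=> x x01; have /andP[x0 x1] := x01; rewrite lt_min => /andP[x2 xe].
  apply: le_trans (Psmall x01) _.
  apply: (@le_trans _ _ (4 * x * N)).
    rewrite ler_wpM2r// ler_pdivrMr ?subr_gt0//.
    have : 0 <= x * (1 - 2 * x) by rewrite mulr_ge0//; lra.
    nra.
  move: xe; rewrite ltr_pdivlMr; last by rewrite ltr_wpDl// mulr_ge0.
  move/ltW; apply: le_trans.
  have -> : x * (4 * N + 1) = 4 * x * N + x by ring.
  by rewrite lerDl ltW.
- move=> e /tail_small[d d0 Hd]; exists d => // x x01 xd.
  exact: le_trans (U_tail x01) (Hd x x01 xd).
Qed.

(** The derivative is recorded at every point, so that [Y] can be recovered from [u] when another
    solution is compared with this one. *)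
Lemma solvesA_exists : exists u, [/\ weightedL2 u, solvesA u f &
  exists2 Y, regular_pair u Y & forall x, 0 < x < 1 -> is_derive x 1 u (u x / x - Y x / x ^+ 2)].
Proof.
exists u; split => //.
  exists (fun x => x ^+ 1 * u x - Y x); split.
    apply: antider_ext antu _ _ => // x /andP[x0 _].
    by rewrite expr1; field; rewrite gt_eqF.
  apply: antider_ext (antiderB (antiderM (antider_pow 1) antu) antY) _ _ => //.
  by move=> x /andP[x0 _]; rewrite expr1 expr0; field; rewrite gt_eqF.
exists Y => // x x01; apply: (antider_derive antu x01).
have cu := contu x01; have cY := contY x01.
have nx : x != 0 by rewrite gt_eqF//; case/andP: x01.
apply: continuousB.
  by apply: (continuousM cu); apply: continuousV => //; exact: cvg_id.
apply: (continuousM cY); apply: continuousV; first by rewrite expf_neq0.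
exact: exprn_continuous.
Qed.

End Construction.
End InverseOfA.

(** * Symmetry and coercivity *)

Section Coercivity.
Context {R : realType}.
Notation mu := (@lebesgue_measure R).
Notation I01 := (@I01 R).
Implicit Types (u v f g Y : R -> R) (x a b : R).
Hint Resolve measurable_I01 measurable_itvR : core.

(** The angle disappears by the double-angle formula, applied twice to [cos (4 atan x)]. *)
Lemma g0E x : 0 < x < 1 ->
  g0 x = 1 - 2 * x ^+ 2 - 16 * (1 - x ^+ 2) / (1 + x ^+ 2) ^+ 2.
Proof.
move=> /andP[x0 _]; rewrite /g0 /f0.
have h : 0 < 1 + x ^+ 2 by rewrite ltr_pwDl// sqr_ge0.
have cos2 (y : R) : cos (2 * y) = 2 * cos y ^+ 2 - 1.
  have -> : 2 * y = y + y by ring.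
  by rewrite cosD; have := cos2Dsin2 y; nra.
have -> : cos (2 * (2 * atan x)) = 2 * (2 * (1 + x ^+ 2)^-1 - 1) ^+ 2 - 1.
  by rewrite !cos2 cos_atan exprVn sqr_sqrtr ?ltW.
by field; rewrite !gt_eqF.
Qed.

(** The bounds are the values at 0 and at 1. The upper one gives [A = A_0 - g0 >= 1] once [A_0 >= 0]
    is known; the lower one bounds the perturbation. *)
Lemma g0_le x : 0 < x < 1 -> -15 <= g0 x <= -1.
Proof.
move=> x01; rewrite g0E//; have /andP[x0 x1] := x01.
have s0 : 0 < x ^+ 2 by rewrite exprn_gt0.
have s1 : x ^+ 2 < 1 by rewrite expr_lt1// ltW.
move: s0 s1; move: (x ^+ 2) => s s0 s1.
have d0 : 0 < (1 + s) ^+ 2 by rewrite exprn_gt0//; lra.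
have d1 : (1 + s) ^+ 2 <= 4 by nra.
have d2 : 1 <= (1 + s) ^+ 2 by nra.
apply/andP; split.
  have : 16 * (1 - s) / (1 + s) ^+ 2 <= 16 * (1 - s).
    by rewrite ler_pdivrMr// ler_peMr//; lra.
  lra.
have : 4 * (1 - s) <= 16 * (1 - s) / (1 + s) ^+ 2.
  by rewrite ler_pdivlMr//; nra.
lra.
Qed.

Lemma g0_continuous x : 0 < x < 1 ->
  {for x, continuous (fun x : R => 1 - 2 * x ^+ 2 - 16 * (1 - x ^+ 2) / (1 + x ^+ 2) ^+ 2)}.
Proof.
move=> x01.
have dp : is_derive x 1 (fun x : R => (1 + x ^+ 2) ^+ 2) _
    := derive_sqr (derive_add (derive_const 1 x) (derive_pow 2 x)).
have n0 : (1 + x ^+ 2) ^+ 2 != 0.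
  by rewrite gt_eqF// exprn_gt0// ltr_pwDl// sqr_ge0.
have d1 := derive_sub (derive_const 1 x) (derive_mul (derive_const 2 x) (derive_pow 2 x)).
have d2 := derive_mul (derive_const 16 x) (derive_sub (derive_const 1 x) (derive_pow 2 x)).
exact: derive_continuous (derive_sub d1 (derive_mul d2 (derive_inv dp n0))).
Qed.

Lemma measurable_g0 : measurable_fun I01 (@g0 R).
Proof.
have m : measurable_fun I01 (fun x : R => 1 - 2 * x ^+ 2 - 16 * (1 - x ^+ 2) / (1 + x ^+ 2) ^+ 2).
  apply: open_continuous_measurable_fun; first exact: interval_open.
  by move=> x; rewrite inE => /I01P; exact: g0_continuous.
by apply: eq_measurable_fun m => x; rewrite inE => /I01P h; rewrite g0E.
Qed.

Lemma weightedL2_g0 u : weightedL2 u -> weightedL2 (fun x => g0 x * u x).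
Proof.
apply: (weightedL2_bounded (M := 15)); first exact: measurable_g0.
by move=> x /g0_le/andP[h1 h2]; rewrite ler_norml h1; lra.
Qed.

Lemma antider_comb u1 f1 u2 f2 (c : R) : solvesA u1 f1 -> solvesA u2 f2 ->
  solvesA (fun x => u1 x + c * u2 x) (fun x => f1 x + c * f2 x).
Proof.
move=> [v1 [h1 k1]] [v2 [h2 k2]]; exists (fun x => v1 x + c * v2 x); split.
  apply: antider_ext (antiderD h1 (antiderZ c h2)) _ _ => // x /andP[x0 _].
  by field; rewrite gt_eqF.
apply: antider_ext (antiderD k1 (antiderZ c k2)) _ _ => // x _; ring.
Qed.

Lemma solvesA_ext u u' f f' : solvesA u f -> (forall x, 0 < x < 1 -> u x = u' x) ->
  (forall x, 0 < x < 1 -> f x = f' x) -> solvesA u' f'.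
Proof.
move=> [v [h1 h2]] uu ff; exists v; split.
  by apply: antider_ext h1 _ _.
by apply: antider_ext h2 _ _ => // x x01; rewrite uu// ff.
Qed.

Lemma solvesA_regular u f : weightedL2 u -> weightedL2 f -> solvesA u f ->
  exists Y, [/\ regular_pair u Y, antider 0 1 u (fun x => u x / x - Y x / x ^+ 2) &
    antider 0 1 Y (fun x => wt x * f x - Y x / x)].
Proof.
move=> Lu Lf Auf.
have [us [Lus Aus [Ys regs ders]]] := solvesA_exists Lf.
have E x : 0 < x < 1 -> u x = us x.
  move=> x01; apply/eqP; rewrite -subr_eq0; apply/eqP.
  have -> : u x - us x = u x + (-1) * us x by ring.
  apply: (@homogeneous_zero R (fun x => u x + (-1) * us x)) => //.
    by apply: weightedL2D => //; exact: weightedL2Z.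
  by apply: solvesA_ext (antider_comb (-1) Auf Aus) _ _ => // y _; ring.
have [v [Hu Hv]] := Auf.
(* Built from the [v] of the given solution, so that its equation is immediate; it agrees with [Ys]
   because the derivative of [u] is unique at each point. *)
pose Y x := x ^+ 1 * u x - v x.
have vc x : 0 < x < 1 -> {for x, continuous (fun x => v x / x ^+ 2)}.
  move=> x01; have cv := antider_continuous Hv x01.
  by apply: (continuousM cv); apply: continuous_invX; case/andP: x01.
have YE x : 0 < x < 1 -> Y x = Ys x.
  move=> x01; have /andP[x0 x1] := x01.
  have d1 := antider_derive Hu x01 (vc x x01).
  have d2 : is_derive x 1 u (us x / x - Ys x / x ^+ 2).
    have d3 := ders x x01.
    have nE : {near x, us =1 u}.
      have : \near x, 0 < x < 1.
        by near=> z; apply/andP; split; near: z; [exact: lt_nbhsr | exact: lt_nbhsl].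
      by apply: filterS => y /E.
    split; first by apply: near_eq_derivable nE _; case: d3.
    by rewrite -(near_eq_derive _ nE); case: d3.
  have := @derive_val _ _ _ _ _ _ _ d1; rewrite (@derive_val _ _ _ _ _ _ _ d2) => h.
  rewrite /Y expr1 E//.
  have nx : x != 0 by rewrite gt_eqF.
  have -> : v x = x ^+ 2 * (us x / x - Ys x / x ^+ 2) by rewrite h; field.
  by field.
exists Y; split.
- have [M [M0 h1 h2 h3 h4]] := regs; exists M; split => //.
  + by move=> x x01; rewrite /decay_outer E//; exact: h1.
  + by move=> x x01; rewrite /decay_inner YE//; exact: h2.
  + move=> e /h3[d d0 Hd]; exists d => // x x01 xd.
    by rewrite /decay_inner YE//; exact: Hd.
  + move=> e /h4[d d0 Hd]; exists d => // x x01 xd.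
    by rewrite /decay_outer E//; exact: Hd.
- apply: antider_ext Hu _ _ => // x /andP[x0 _].
  by rewrite /Y expr1; field; rewrite gt_eqF.
- apply: antider_ext (antiderB (antiderM (antider_pow 1) Hu) Hv) _ _ => //.
  by move=> x /andP[x0 _]; rewrite /Y expr0 expr1; field; rewrite gt_eqF.
Unshelve. all: by end_near. Qed.

Lemma vanishes_add K L : vanishes_at_ends K -> vanishes_at_ends L ->
  vanishes_at_ends (fun x : R => K x + L x).
Proof.
move=> HK HL e e0; have e2 : 0 < e / 2 by rewrite divr_gt0.
have [d1 d10 H1] := HK _ e2; have [d2 d20 H2] := HL _ e2.
exists (Num.min d1 d2); first by rewrite lt_min d10.
move=> x x01; rewrite !lt_min => xd.
have h1 : `|K x| <= e / 2.
  by apply: H1 => //; move: xd => /orP[] /andP[h _]; rewrite h ?orbT.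
have h2 : `|L x| <= e / 2.
  by apply: H2 => //; move: xd => /orP[] /andP[_ h]; rewrite h ?orbT.
have := ler_normD (K x) (L x); lra.
Qed.

Lemma vanishes_bounded (M : R) (m K : R -> R) : 0 <= M ->
  (forall x, 0 < x < 1 -> `|m x| <= M) ->
  vanishes_at_ends K -> vanishes_at_ends (fun x => m x * K x).
Proof.
move=> M0 mM HK e e0.
have M1 : 0 < M + 1 by lra.
have [d d0 H] := HK _ (divr_gt0 e0 M1); exists d => // x x01 xd.
rewrite normrM; apply: (@le_trans _ _ ((M + 1) * (e / (M + 1)))).
  by apply: ler_pM => //; [apply: le_trans (mM _ x01) _; lra|exact: H].
by rewrite mulrC divfK// gt_eqF.
Qed.

Lemma regular_vanishes u Y u' Y' : regular_pair u Y -> regular_pair u' Y' ->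
  vanishes_at_ends (fun x => u x * Y' x).
Proof.
move=> [M [M0 hu _ _ hu1]] [M' [M0' _ hY hY0 _]] e e0.
have b x : 0 < x < 1 -> (u x * Y' x) ^+ 2 = decay_outer u x * decay_inner Y' x.
  move=> x01; have /andP[x0 _] := x01; have := onem_sqr_gt0 x01 => h.
  by rewrite /decay_outer /decay_inner; field; rewrite !gt_eqF.
have P0 x : 0 < x < 1 -> 0 <= decay_inner Y' x.
  move=> /onem_sqr_gt0 h; rewrite /decay_inner; apply: divr_ge0; last exact: sqr_ge0.
  by apply: mulr_ge0; [exact: sqr_ge0|exact: ltW].
have U0 x : 0 < x < 1 -> 0 <= decay_outer u x.
  move=> /onem_sqr_gt0 h; rewrite /decay_outer; apply: divr_ge0; last exact: ltW.
  by apply: mulr_ge0; exact: sqr_ge0.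
have M1 : 0 < M + 1 by lra.
have M1' : 0 < M' + 1 by lra.
have e2 : 0 < e ^+ 2 by rewrite exprn_gt0.
have [d1 d10 H1] := hY0 _ (divr_gt0 e2 M1).
have [d2 d20 H2] := hu1 _ (divr_gt0 e2 M1').
exists (Num.min d1 d2); first by rewrite lt_min d10.
move=> x x01; rewrite !lt_min => xd.
rewrite -ler_sqr ?nnegrE ?(ltW e0)// real_normK ?num_real// b//.
move: xd => /orP[/andP[xd _]|/andP[_ xd]].
  apply: (@le_trans _ _ ((M + 1) * (e ^+ 2 / (M + 1)))).
    by apply: ler_pM; rewrite ?U0 ?P0//; [apply: le_trans (hu _ x01) _; lra|exact: H1].
  by rewrite mulrC divfK// gt_eqF.
apply: (@le_trans _ _ (e ^+ 2 / (M' + 1) * (M' + 1))).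
  by apply: ler_pM; rewrite ?U0 ?P0//; [exact: H2|apply: le_trans (hY _ x01) _; lra].
by rewrite divfK// gt_eqF.
Qed.

(** The factor [x] supplies the decay at 0, where [decay_outer] is merely bounded. *)
Lemma regular_vanishes_outer u Y : regular_pair u Y ->
  vanishes_at_ends (fun x => x * decay_outer u x).
Proof.
move=> [M [M0 hu _ _ hu1]] e e0.
have U0 x : 0 < x < 1 -> 0 <= decay_outer u x.
  move=> /onem_sqr_gt0 h; rewrite /decay_outer; apply: divr_ge0; last exact: ltW.
  by apply: mulr_ge0; exact: sqr_ge0.
have M1 : 0 < M + 1 by lra.
have [d2 d20 H2] := hu1 _ e0.
exists (Num.min (e / (M + 1)) d2); first by rewrite lt_min divr_gt0.
move=> x x01; have /andP[x0 x1] := x01; rewrite !lt_min => xd.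
rewrite ger0_norm; last by apply: mulr_ge0; [exact: ltW|exact: U0].
move: xd => /orP[/andP[xd _]|/andP[_ xd]].
  apply: (@le_trans _ _ (e / (M + 1) * (M + 1))).
    apply: ler_pM; [exact: ltW|exact: U0|exact: ltW|].
    by apply: le_trans (hu _ x01) _; lra.
  by rewrite divfK// gt_eqF.
rewrite -[leRHS]mul1r; apply: ler_pM; [exact: ltW|exact: U0|exact: ltW|exact: H2].
Qed.

Lemma solvesA_symmetric u1 f1 u2 f2 : weightedL2 u1 -> weightedL2 f1 ->
  weightedL2 u2 -> weightedL2 f2 -> solvesA u1 f1 -> solvesA u2 f2 ->
  wip f1 u2 = wip u1 f2.
Proof.
move=> Lu1 Lf1 Lu2 Lf2 A1 A2.
suff half v1 g1 v2 g2 : weightedL2 v1 -> weightedL2 g1 ->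
  weightedL2 v2 -> weightedL2 g2 -> solvesA v1 g1 -> solvesA v2 g2 -> wip v1 g2 <= wip g1 v2.
  apply/eqP; rewrite eq_le (half u1 f1 u2 f2)// andbT wipC [wip u1 f2]wipC.
  exact: half.
move=> {}Lu1 {}Lf1 {}Lu2 {}Lf2 {}A1 {}A2; clear u1 f1 u2 f2.
have [Y1 [r1 d1 e1]] := solvesA_regular Lu1 Lf1 A1.
have [Y2 [r2 d2 e2]] := solvesA_regular Lu2 Lf2 A2.
have i1 := wip_integrable Lf1 Lu2; have i2 := wip_integrable Lu1 Lf2.
have D1 : antider 0 1 (fun x => v1 x * Y2 x - v2 x * Y1 x)
    (fun x => v1 x * g2 x * wt x - g1 x * v2 x * wt x).
  apply: antider_ext (antiderB (antiderM d1 e2) (antiderM d2 e1)) _ _ => // x /andP[x0 _].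
  by field; rewrite gt_eqF.
rewrite -subr_ge0 /wip -(Rintegral_sub measurable_I01 i1 i2).
apply: (@integral_ge0_of_boundary R _ (fun x => v1 x * Y2 x + (- 1) * (v2 x * Y1 x))).
- exact: integrable_sub.
- apply: vanishes_add; first exact: regular_vanishes r1 r2.
  apply: (@vanishes_bounded 1 (fun=> -1)) => //; last exact: regular_vanishes r2 r1.
  by move=> x _; rewrite normrN1.
- move=> a b a0 ab b1; have [i3 E] := D1 a b a0 ab b1.
  have -> : (v1 a * Y2 a + -1 * (v2 a * Y1 a)) - (v1 b * Y2 b + -1 * (v2 b * Y1 b)) =
    - ((v1 b * Y2 b - v2 b * Y1 b) - (v1 a * Y2 a - v2 a * Y1 a)) by ring.
  rewrite E -mulN1r -Rintegral_scale// le_eqVlt; apply/orP; left; apply/eqP.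
  by apply: eq_Rintegral => x _; ring.
Qed.

(** For [e = x sqrt (1 - x^2) / (1 + x^2)] one has [x^2 e' / e = x - A x], hence
    [A u - Y = x^2 (u' - (e' / e) u)]. The quadratic form of [A_0] is then the integral of
    [((A u - Y) / x)^2], with boundary term [A u^2 - u Y]. *)
Lemma solvesA_coercive u f : weightedL2 u -> weightedL2 f -> solvesA u f ->
  0 <= wip (fun x => f x + g0 x * u x) u.
Proof.
move=> Lu Lf Au; have [Y [r d e]] := solvesA_regular Lu Lf Au.
have Lg : weightedL2 (fun x => f x + g0 x * u x).
  by apply: weightedL2D => //; exact: weightedL2_g0.
pose A x : R := x ^+ 3 / (1 - x ^+ 2) + 2 * x ^+ 3 / (1 + x ^+ 2).
have p2 x : 0 < 1 + x ^+ 2 :> R by rewrite ltr_pwDl// sqr_ge0.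
pose A' x : R := (3 * x ^+ 2 - x ^+ 4) / (1 - x ^+ 2) ^+ 2 +
   2 * (3 * x ^+ 2 + x ^+ 4) / (1 + x ^+ 2) ^+ 2.
have dA : antider 0 1 A A'.
  apply: derive_antider => x x01; have h := onem_sqr_gt0 x01; have h2 := p2 x.
    have n1 : 1 - x ^+ 2 != 0 by rewrite gt_eqF.
    have n2 : 1 + x ^+ 2 != 0 by rewrite gt_eqF.
    have d1 := derive_mul (derive_pow 3 x)
      (derive_inv (derive_sub (derive_const 1 x) (derive_pow 2 x)) n1).
    have d2 := derive_mul (derive_mul (derive_const 2 x) (derive_pow 3 x))
      (derive_inv (derive_add (derive_const 1 x) (derive_pow 2 x)) n2).
    apply: (derive_eq (derive_add d1 d2)).
    by rewrite /A' /= expr1; field; rewrite n1 n2.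
  have n1 : (1 - x ^+ 2) ^+ 2 != 0 by rewrite gt_eqF// exprn_gt0.
  have n2 : (1 + x ^+ 2) ^+ 2 != 0 by rewrite gt_eqF// exprn_gt0.
  have d1 := derive_mul (derive_sub (derive_mul (derive_const 3 x) (derive_pow 2 x)) (derive_pow 4 x))
    (derive_inv (derive_sqr (derive_sub (derive_const 1 x) (derive_pow 2 x))) n1).
  have d2 := derive_mul (derive_mul (derive_const 2 x)
     (derive_add (derive_mul (derive_const 3 x) (derive_pow 2 x)) (derive_pow 4 x)))
    (derive_inv (derive_sqr (derive_add (derive_const 1 x) (derive_pow 2 x))) n2).
  exact: derive_continuous (derive_add d1 d2).
have D1 := antiderB (antiderM dA (antiderM d d)) (antiderM d e).
(* This is [A u^2 - u Y], rewritten through [x * decay_outer u], whose limits are known, and a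
   bounded factor. *)
apply: (@integral_ge0_of_boundary R _ (fun x => (1 + 2 * (1 - x ^+ 2) / (1 + x ^+ 2)) *
   (x * decay_outer u x) + (- 1) * (u x * Y x))).
- exact: wip_integrable.
- apply: vanishes_add.
    apply: (@vanishes_bounded 3 (fun x => 1 + 2 * (1 - x ^+ 2) / (1 + x ^+ 2))) => //.
      move=> x x01; have h := onem_sqr_gt0 x01; have h2 := p2 x.
      have h3 : 0 <= 2 * (1 - x ^+ 2) / (1 + x ^+ 2).
        by apply: divr_ge0; [rewrite mulr_ge0// ltW|exact: ltW].
      rewrite ger0_norm; last by rewrite addr_ge0.
      have : 2 * (1 - x ^+ 2) / (1 + x ^+ 2) <= 2.
        by rewrite ler_pdivrMr//; have := sqr_ge0 x; lra.
      lra.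
    exact: regular_vanishes_outer r.
  apply: (@vanishes_bounded 1 (fun=> -1)) => //; last exact: (regular_vanishes r r).
  by move=> x _; rewrite normrN1.
- move=> a b a0 ab b1.
  have KE x : 0 < x < 1 -> (1 + 2 * (1 - x ^+ 2) / (1 + x ^+ 2)) *
      (x * decay_outer u x) + (- 1) * (u x * Y x) = A x * (u x * u x) - u x * Y x.
    move=> x01; have h := onem_sqr_gt0 x01; have h2 := p2 x.
    by rewrite /A /decay_outer; field; rewrite !gt_eqF.
  have a01 : 0 < a < 1 by rewrite a0 (le_lt_trans ab).
  have b01 : 0 < b < 1 by rewrite b1 (lt_le_trans a0).
  rewrite !KE//; have [i3 E] := D1 a b a0 ab b1.
  rewrite -[leLHS]opprB E -mulN1r -Rintegral_scale//.
  apply: le_Rintegral => //.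
  + exact: integrable_scale.
  + by apply: integrable_subset (wip_integrable Lg Lu) => //; exact: sub_I01 (ltW a0) b1.
  move=> x /(sub_I01 (ltW a0) b1)/I01P x01; have /andP[x0 x1] := x01.
  have h := onem_sqr_gt0 x01; have h2 := p2 x.
  rewrite g0E// -subr_ge0 [leRHS](_ : _ = ((A x * u x - Y x) / x) ^+ 2); first exact: sqr_ge0.
  by rewrite /A /A' /wt; field; rewrite !gt_eqF.
Qed.

End Coercivity.

(** * Absence of eigenfunctions for nonnegative parameters *)

Section DecayAtOne.
Context {R : realType}.
Notation mu := (@lebesgue_measure R).
Notation I01 := (@I01 R).
Implicit Types (u v f g Y : R -> R) (x a b : R).
Hint Resolve measurable_I01 measurable_itvR : core.

Lemma antider_ae l r F g g' : antider l r F g -> measurable_fun `]l, r[ g' ->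
  {ae mu, forall x, l < x < r -> g x = g' x} -> antider l r F g'.
Proof.
move=> HF mg gg; apply: abs_continuous_antider mg _.
  by move=> a b la ab br; exact: antider_abs_continuous HF la ab br.
apply: (aeS2 _ (antider_ae_derive HF) gg) => x h1 h2 lxr.
by have [_ ->] := h1 lxr; exact: h2.
Qed.

Lemma antider_mono l r F f a b : antider l r F f -> l < a -> a <= b -> b < r ->
  (forall x, a < x <= b -> 0 <= f x) -> F a <= F b.
Proof.
move=> HF la ab br f0; have H0 : antider l r (fun=> 0 : R) (fun=> 0).
  by apply: derive_antider => x _; exact: cst_continuous.
have := antider_le H0 HF la ab br f0; lra.
Qed.

Lemma antider_inv_onem_sqr : antider 0 1 (fun x : R => (1 - x ^+ 2)^-1)
  (fun x => 2 * x / (1 - x ^+ 2) ^+ 2).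
Proof.
apply: derive_antider => x x01; have h := onem_sqr_gt0 x01.
  have n0 : 1 - x ^+ 2 != 0 by rewrite gt_eqF.
  apply: (derive_eq (derive_inv (derive_sub (derive_const 1 x) (derive_pow 2 x)) n0)).
  by rewrite /= expr1; field.
have n2 : (1 - x ^+ 2) ^+ 2 != 0 by rewrite gt_eqF// exprn_gt0.
exact: derive_continuous (derive_mul (derive_mul (derive_const 2 x) (derive_var x))
  (derive_inv (derive_sqr (derive_sub (derive_const 1 x) (derive_pow 2 x))) n2)).
Qed.

Lemma antider_log l : antider l 1 (fun x : R => 0 - ln (1 - x)) (fun x => (1 - x)^-1).
Proof.
apply: derive_antider => x /andP[_ x1]; have x10 : 0 < 1 - x by rewrite subr_gt0.
  have h2 := derive_sub (derive_const 1 x) (derive_var x).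
  by apply: (derive_eq (derive_sub (derive_const 0 x) (derive_ln h2 x10))); ring.
apply: continuousV; first by rewrite gt_eqF.
by apply: continuousB; [exact: cst_continuous|exact: cvg_id].
Qed.

Lemma log_unbounded (M x0 : R) : x0 < 1 -> exists2 b0, x0 < b0 < 1 &
  forall b, b0 <= b -> b < 1 -> M <= (0 - ln (1 - b)) - (0 - ln (1 - x0)).
Proof.
move=> x01; pose N := Num.max M 1.
have N0 : 0 < N by rewrite lt_max ltr01 orbT.
have d0 : 0 < 1 - x0 by rewrite subr_gt0.
have e0 := expR_gt0 (- N).
have e1 : expR (- N) < 1 by rewrite expR_lt1 oppr_lt0.
exists (1 - (1 - x0) * expR (- N)).
  have h1 : 0 < (1 - x0) * expR (- N) by exact: mulr_gt0.
  have h2 : 0 < (1 - x0) * (1 - expR (- N)) by rewrite mulr_gt0// subr_gt0.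
  by apply/andP; split; nra.
move=> b hb b1; have d1 : 0 < 1 - b by rewrite subr_gt0.
apply: (@le_trans _ _ N); first by rewrite le_max lexx.
have -> : (0 - ln (1 - b)) - (0 - ln (1 - x0)) = ln ((1 - x0) / (1 - b)).
  by rewrite ln_div ?posrE//; ring.
rewrite -[leLHS]expRK ler_ln ?posrE ?expR_gt0 ?divr_gt0//.
rewrite ler_pdivlMr// mulrC -ler_pdivlMr ?expR_gt0// -expRN; lra.
Qed.

Lemma onep_sqr_gt0 (x : R) : 0 < 1 + x ^+ 2.
Proof. by rewrite ltr_pwDl// sqr_ge0. Qed.

Lemma antider_inv_onep_sqr : antider 0 1 (fun x : R => (1 + x ^+ 2)^-1)
  (fun x => - (2 * x) / (1 + x ^+ 2) ^+ 2).
Proof.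
apply: derive_antider => x x01; have h := onep_sqr_gt0 x.
  have n0 : 1 + x ^+ 2 != 0 by rewrite gt_eqF.
  apply: (derive_eq (derive_inv (derive_add (derive_const 1 x) (derive_pow 2 x)) n0)).
  by rewrite /= expr1; field.
have n2 : (1 + x ^+ 2) ^+ 2 != 0 by rewrite gt_eqF// exprn_gt0.
apply: continuousM; last first.
  exact: derive_continuous (derive_inv (derive_sqr (derive_add (derive_const 1 x) (derive_pow 2 x))) n2).
apply: continuousN.
exact: derive_continuous (derive_mul (derive_const 2 x) (derive_var x)).
Qed.

Lemma half_div_onem_le (d e x : R) : 0 < x < 1 -> 0 <= d -> d <= e ->
  d / 2 / (1 - x) <= e / (1 - x ^+ 2).
Proof.
move=> x01 d0 de; have h := onem_sqr_gt0 x01; have /andP[_ x1] := x01.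
have h1 : 0 < 1 - x by rewrite subr_gt0.
rewrite -mulrA -invfM; apply: ler_pM => //; first by rewrite invr_ge0 mulr_ge0// ltW.
rewrite lef_pV2 ?posrE ?mulr_gt0//; have := sqr_ge0 (1 - x); lra.
Qed.

Variables (lam c : R) (u f : R -> R).
Hypotheses (lam0 : 0 <= lam) (c01 : 0 <= c < 1).
Hypotheses (Lu : weightedL2 u) (Au : solvesA u f).
Hypothesis uf : {ae mu, forall x, c < x < 1 -> f x + g0 x * u x = lam * u x}.

Definition g0_rat x : R := 1 - 2 * x ^+ 2 - 16 * (1 - x ^+ 2) / (1 + x ^+ 2) ^+ 2.

Let c1 : c < 1. Proof. by case/andP: c01. Qed.
Let c0 : 0 <= c. Proof. by case/andP: c01. Qed.
Let sub01 F g : antider 0 1 F g -> antider c 1 F g.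
Proof. exact: antider_sub. Qed.
Let in01 x : c < x < 1 -> 0 < x < 1.
Proof. by move=> /andP[cx ->]; rewrite (le_lt_trans c0 cx). Qed.

Let homogeneous_ode : exists v, antider c 1 u (fun x => v x / x ^+ 2) /\
  antider c 1 v (fun x => (2 - wt x * (lam - g0_rat x)) * u x).
Proof.
have [v [Hu Hv]] := Au; exists v; split; first exact: sub01.
apply: antider_ae (sub01 Hv) _ _.
  have sub : `]c, 1[%classic `<=` I01.
    by move=> x /=; rewrite in_itv/= => /in01/I01P.
  apply: (measurable_funS measurable_I01 sub).
  apply: measurable_funM; last by case: Lu.
  apply: measurable_funB; first exact: measurable_cst.
  apply: measurable_funM; first exact: measurable_wt.
  apply: measurable_funB; first exact: measurable_cst.
  apply: eq_measurable_fun (@measurable_g0 R) => x; rewrite inE => /I01P h.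
  by rewrite g0E.
move: uf; apply: aeS => x H cx.
have := H cx; rewrite g0E ?in01// -/(g0_rat x) => h.
have -> : f x = (lam - g0_rat x) * u x by lra.
ring.
Qed.

(** * Positive spectral parameter: an almost conserved energy *)

Section Positive.
Hypothesis lam_gt0 : 0 < lam.

(** For [z = x u / sqrt (1 - x^2)] and [t = artanh x] the equation reads [z'' = (V - lam) z]. Since
    [V] is integrable at infinity, Gronwall keeps the energy [E = z'^2 + lam z^2] away from 0. The
    virial function [S = z z'] satisfies [S' = E + (V - 2 lam) z^2]; for square integrable [z] it
    tends to infinity, so [z^2] is eventually increasing, which is absurd. *)
Lemma no_decay_positive x0 : c < x0 < 1 -> u x0 = 0.
Proof.
move=> cx0; have /andP[x00 x01] := in01 cx0.
have [v [Hu Hv]] := homogeneous_ode.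
apply/eqP/negPn/negP => u0.
have in1 x : x0 < x -> x < 1 -> c < x < 1.
  by move=> h ->; rewrite andbT (lt_trans _ h)//; case/andP: cx0.
(* In the half-line variables [q / sqrt (1 - x^2)] is the derivative of [z]. *)
pose q x := u x + (x ^+ 0 - x ^+ 2) * (v x * (x ^+ 1)^-1).
have qE x : q x = u x + (1 - x ^+ 2) * (v x / x) by rewrite /q expr0 expr1.
have Hq : antider c 1 q (fun x => - v x + (1 - x ^+ 2) / x *
    ((2 - wt x * (lam - g0_rat x)) * u x)).
  have := antiderD Hu (antiderM (sub01 (antiderB (antider_pow 0) (antider_pow 2)))
    (antiderM Hv (sub01 (antider_inv 1)))).
  move/antider_ext; apply => // x /in01 /andP[xp x1].
  rewrite /= expr0 expr1; move: (wt x) (g0_rat x) => w' g'.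
  by field; rewrite gt_eqF.
pose V x := 2 * (1 - x ^+ 2) ^+ 2 / x ^+ 2 + g0_rat x + 1.
pose E x := (q x * q x + lam * (x ^+ 2 * (u x * u x))) * (1 - x ^+ 2)^-1.
have HE : antider c 1 E (fun x => 2 * V x * q x * (x * u x) / (1 - x ^+ 2) ^+ 2).
  have := antiderM (antiderD (antiderM Hq Hq) (antiderZ lam (antiderM (sub01 (antider_pow 2)) (antiderM Hu Hu))))
    (sub01 antider_inv_onem_sqr).
  move/antider_ext; apply => // x cx; have x01' := in01 cx.
  have /andP[xp x1] := x01'; have h := onem_sqr_gt0 x01'.
  rewrite /V qE /wt /= expr1; move: (g0_rat x) => g'.
  by field; rewrite !gt_eqF.
pose C := 2 / x0 ^+ 2 + 18.
have C0 : 0 <= C.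
  by rewrite addr_ge0// divr_ge0// sqr_ge0.
have VC x : x0 < x < 1 -> `|V x| <= C * (1 - x ^+ 2).
  move=> /andP[x0x x1]; have xp := lt_trans x00 x0x.
  have h : 0 < 1 - x ^+ 2 by apply: onem_sqr_gt0; rewrite xp.
  have -> : V x = (2 * (1 - x ^+ 2) / x ^+ 2 + (2 - 16 / (1 + x ^+ 2) ^+ 2)) * (1 - x ^+ 2).
    rewrite /V /g0_rat; field; rewrite !gt_eqF//.
    by rewrite ltr_pwDl// sqr_ge0.
  rewrite normrM (gtr0_norm h) ler_wpM2r ?(ltW h)//.
  have x2 : x0 ^+ 2 <= x ^+ 2 by rewrite ler_sqr ?nnegrE ?ltW.
  have xq : 0 < x0 ^+ 2 by rewrite exprn_gt0.
  have xq' : 0 < x ^+ 2 by rewrite exprn_gt0.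
  have h1 : 0 <= 2 * (1 - x ^+ 2) / x ^+ 2.
    by apply: divr_ge0; [rewrite mulr_ge0// ltW|exact: ltW].
  have h2 : 2 * (1 - x ^+ 2) / x ^+ 2 <= 2 / x0 ^+ 2.
    apply: ler_pM => //; [by rewrite mulr_ge0// ltW|by rewrite invr_ge0 ltW|lra|].
    by rewrite lef_pV2 ?posrE.
  have d2 : 1 <= (1 + x ^+ 2) ^+ 2 by nra.
  have h3 : 0 <= 16 / (1 + x ^+ 2) ^+ 2 by apply: divr_ge0 => //; exact: sqr_ge0.
  have h4 : 16 / (1 + x ^+ 2) ^+ 2 <= 16 by rewrite ler_pdivrMr; nra.
  by rewrite /C ler_norml; apply/andP; split; lra.
(* [2 |q x u| <= q^2 + (x u)^2], and this sum is at most [L] times [q^2 + lam (x u)^2]. Here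
   [lam > 0] is essential. *)
pose L := 1 + lam^-1.
have L0 : 0 <= lam^-1 by rewrite invr_ge0.
have Eq x : 0 < x < 1 -> 0 <= q x * q x + lam * (x ^+ 2 * (u x * u x)).
  move=> _; apply: addr_ge0; first by rewrite -expr2 sqr_ge0.
  by apply: mulr_ge0 => //; apply: mulr_ge0; rewrite -?expr2 sqr_ge0.
have E0 x : 0 < x < 1 -> 0 <= E x.
  move=> h; apply: mulr_ge0; first exact: Eq.
  by rewrite invr_ge0 ltW// onem_sqr_gt0.
have qz x : 0 < x < 1 -> `|2 * (q x * (x * u x))| <= L * (E x * (1 - x ^+ 2)).
  move=> h; have h' := onem_sqr_gt0 h.
  have -> : E x * (1 - x ^+ 2) = q x ^+ 2 + lam * (x * u x) ^+ 2.
    by rewrite /E; field; rewrite gt_eqF.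
  apply: (@le_trans _ _ (q x ^+ 2 + (x * u x) ^+ 2)).
    have := sqr_ge0 (q x - x * u x); have := sqr_ge0 (q x + x * u x).
    rewrite ler_norml; move: (q x) (x * u x) => s t h1 h2.
    by apply/andP; split; lra.
  have -> : L * (q x ^+ 2 + lam * (x * u x) ^+ 2) = (q x ^+ 2 + (x * u x) ^+ 2)
    + (lam^-1 * q x ^+ 2 + lam * (x * u x) ^+ 2) by rewrite /L; field; rewrite gt_eqF.
  by rewrite lerDl addr_ge0// mulr_ge0 ?sqr_ge0.
(* Gronwall constant in the variable [x]: the factor [1 - x^2] in the bound on [V] cancels the
   singular factor that comes from [t]. *)
pose K := C * L.
have HG : antider c 1 (fun x => E x * expR (K * x)) (fun x =>
   2 * V x * q x * (x * u x) / (1 - x ^+ 2) ^+ 2 * expR (K * x) + E x * (expR (K * x) * K)).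
  apply: antiderM => //; apply: derive_antider => x _.
    have h1 := derive_mul (derive_const K x) (derive_var x).
    have h2 : is_derive (K * x) 1 (@expR R) (expR (K * x)) by exact: is_derive_expR.
    apply: (derive_eq (@is_derive1_comp R (@expR R) (fun y => K * y) x _ _ h2 h1)).
    by rewrite mul0r add0r mulr1.
  apply: continuousM; last exact: cst_continuous.
  apply: (@continuous_comp _ _ _ (fun y : R => K * y) (@expR R)); last exact: continuous_expR.
  by apply: continuousM; [exact: cst_continuous|exact: cvg_id].
have Ex0 : 0 < E x0.
  apply: mulr_gt0; last by rewrite invr_gt0 onem_sqr_gt0// x00.
  have : 0 < u x0 * u x0 by rewrite -expr2 exprn_even_gt0.
  move=> h; apply: ltr_wpDl; first by rewrite -expr2 sqr_ge0.
  by apply: mulr_gt0 => //; apply: mulr_gt0 => //; rewrite exprn_gt0.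
(* [expR |K|] bounds [expR (K * x)] on the unit interval, so [e0] bounds [E] itself from below. *)
pose e0 := E x0 * expR (K * x0) / expR `|K|.
have e00 : 0 < e0 by rewrite divr_gt0 ?expR_gt0// mulr_gt0 ?expR_gt0.
have Elow x : x0 <= x -> x < 1 -> e0 <= E x.
  move=> x0x x1.
  have xx : 0 < x < 1 by rewrite x1 (lt_le_trans x00).
  have h : E x0 * expR (K * x0) <= E x * expR (K * x).
    apply: (antider_mono HG (proj1 (andP cx0)) x0x x1) => z /andP[x0z zx].
    have z1 : z < 1 by exact: le_lt_trans x1.
    have zz : 0 < z < 1 by rewrite z1 (lt_trans x00).
    have h := onem_sqr_gt0 zz.
    have -> : 2 * V z * q z * (z * u z) / (1 - z ^+ 2) ^+ 2 * expR (K * z) +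
       E z * (expR (K * z) * K) = expR (K * z) *
         (V z / (1 - z ^+ 2) * (2 * (q z * (z * u z)) / (1 - z ^+ 2)) + K * E z).
      by field; rewrite gt_eqF.
    apply: mulr_ge0; first exact: ltW (expR_gt0 _).
    have b1 : `|V z / (1 - z ^+ 2)| <= C.
      by rewrite normrM normfV (gtr0_norm h) ler_pdivrMr// VC// x0z.
    have b2 : `|2 * (q z * (z * u z)) / (1 - z ^+ 2)| <= L * E z.
      by rewrite normrM normfV (gtr0_norm h) ler_pdivrMr// -mulrA; exact: qz.
    have : `|V z / (1 - z ^+ 2) * (2 * (q z * (z * u z)) / (1 - z ^+ 2))| <= K * E z.
      have -> : K * E z = C * (L * E z) by rewrite /K; ring.
      by rewrite normrM; apply: ler_pM.
    by rewrite ler_norml => /andP[]; lra.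
  rewrite /e0 ler_pdivrMr ?expR_gt0// (le_trans h)// ler_wpM2l ?E0// ler_expR.
  apply: le_trans (ler_norm _) _; rewrite normrM ler_piMr// ger0_norm; lra.
pose S x := x ^+ 1 * u x * q x * (1 - x ^+ 2)^-1.
have HS : antider c 1 S (fun x => E x / (1 - x ^+ 2) + (V x - 2 * lam) * (u x ^+ 2 * wt x)).
  have := antiderM (antiderM (antiderM (sub01 (antider_pow 1)) Hu) Hq) (sub01 antider_inv_onem_sqr).
  move/antider_ext; apply => // x cx; have x01' := in01 cx.
  have /andP[xp x1] := x01'; have h := onem_sqr_gt0 x01'.
  rewrite /E /V qE /wt /= expr0 expr1; move: (g0_rat x) => g'.
  by field; rewrite !gt_eqF.
(* The most that the term [(V - 2 lam) u^2 w] can take away from [S]; the gain from [E] is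
   logarithmic and therefore wins. *)
pose W := (C + 2 * lam) * wip u u.
have Slow b : x0 <= b -> b < 1 ->
   e0 / 2 * ((0 - ln (1 - b)) - (0 - ln (1 - x0))) - W <= S b - S x0.
  move=> x0b b1; have cx := proj1 (andP cx0).
  have [i1 ->] := HS _ _ cx x0b b1.
  have [i2 ->] := antider_log cx x0b b1.
  have sub : `]x0, b]%classic `<=` I01 by exact: sub_I01 (ltW x00) b1.
  have i3 := integrable_subset measurable_I01 (measurable_itvR `]x0, b]) sub Lu.2.
  have i4 := integrable_scale (measurable_itvR `]x0, b]) (C + 2 * lam) i3.
  have i5 := integrable_scale (measurable_itvR `]x0, b]) (e0 / 2) i2.
  have W1 : \int[mu]_(x in `]x0, b]) ((C + 2 * lam) * (u x ^+ 2 * wt x)) <= W.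
    rewrite Rintegral_scale// /W ler_wpM2l//; first by rewrite addr_ge0// mulr_ge0.
    rewrite /wip; under [leRHS]eq_Rintegral do rewrite -expr2.
    apply: (ge0_integral_subset measurable_I01 _ sub _ Lu.2) => // x _.
    by apply: mulr_ge0; [exact: sqr_ge0|exact: wt_ge0].
  rewrite -Rintegral_scale//; apply: (@le_trans _ _ (\int[mu]_(x in `]x0, b]) (e0 / 2 * (1 - x)^-1)
     - \int[mu]_(x in `]x0, b]) ((C + 2 * lam) * (u x ^+ 2 * wt x)))).
    by rewrite lerB.
  rewrite -Rintegral_sub//; apply: le_Rintegral => //; first exact: integrable_sub.
  move=> x; rewrite /= in_itv/= => /andP[x0x xb]; have x1 := le_lt_trans xb b1.
  have xx : 0 < x < 1 by rewrite x1 (lt_trans x00).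
  have h := onem_sqr_gt0 xx; have /andP[xp _] := xx.
  have h1 : e0 / 2 / (1 - x) <= E x / (1 - x ^+ 2).
    exact: half_div_onem_le xx (ltW e00) (Elow _ (ltW x0x) x1).
  have h2 : - (C + 2 * lam) * (u x ^+ 2 * wt x) <= (V x - 2 * lam) * (u x ^+ 2 * wt x).
    apply: ler_wpM2r; first by apply: mulr_ge0; [exact: sqr_ge0|exact: wt_ge0].
    have := VC x (introT andP (conj x0x x1)); rewrite ler_norml => /andP[h2 _].
    have : C * (1 - x ^+ 2) <= C by rewrite ler_piMr// lerBlDr lerDl sqr_ge0.
    lra.
  move: h1 h2; rewrite mulNr; lra.
have [b0 /andP[x0b b1] Hb0] := log_unbounded ((W + `|S x0| + 1) / (e0 / 2)) x01.
have Spos b : b0 <= b -> b < 1 -> 0 < S b.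
  move=> bb b1'; have h1 := Hb0 b bb b1'.
  have h2 := Slow b (le_trans (ltW x0b) bb) b1'.
  have e2 : 0 < e0 / 2 by rewrite divr_gt0.
  move: h1; rewrite ler_pdivrMr// [_ * (e0 / 2)]mulrC => h1.
  have := ler_norm (- S x0); rewrite normrN; lra.
pose m := (b0 + 1) / 2.
have bm : b0 < m by rewrite /m; lra.
have m1 : m < 1 by rewrite /m; lra.
have b00 : 0 < b0 by exact: lt_trans x0b.
have um : 0 < decay_outer u m.
  have mm : 0 < m < 1 by rewrite m1 (lt_trans b00).
  have := Spos m (ltW bm) m1; rewrite /S => h.
  have um0 : u m != 0 by apply/eqP => h0; move: h; rewrite h0 mulr0 !mul0r ltxx.
  rewrite /decay_outer; apply: divr_gt0; last exact: onem_sqr_gt0.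
  by apply: mulr_gt0; [rewrite exprn_gt0// (lt_trans b00)|rewrite exprn_even_gt0].
have HU : antider c 1 (decay_outer u) (fun x => 2 * S x / (1 - x ^+ 2)).
  have := antiderM (antiderM (sub01 (antider_pow 2)) (antiderM Hu Hu)) (sub01 antider_inv_onem_sqr).
  move/antider_ext; apply => x cx; have x01' := in01 cx.
    by rewrite /decay_outer expr2.
  have /andP[xp x1] := x01'; have h := onem_sqr_gt0 x01'.
  by rewrite /S qE /= expr1; field; rewrite !gt_eqF.
apply: (@not_weightedL2_near1 R u m (decay_outer u m / 2) Lu).
- by rewrite m1 andbT ltW// (lt_trans b00).
- by rewrite divr_gt0.
move=> x /andP[mx x1].
have xx : 0 < x < 1 by rewrite x1 (lt_trans b00)// (lt_trans bm).
have h := onem_sqr_gt0 xx; have /andP[xp _] := xx.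
have cm : c < m by rewrite (lt_trans (proj1 (andP cx0)))// (lt_trans x0b).
have hU : decay_outer u m <= decay_outer u x.
  apply: (antider_mono HU cm (ltW mx) x1) => z /andP[mz zx].
  have z1 := le_lt_trans zx x1.
  apply: divr_ge0; last by apply/ltW/onem_sqr_gt0; rewrite z1 (lt_trans b00)// (lt_trans bm).
  by rewrite mulr_ge0// ltW// Spos// ltW// (lt_trans bm).
have -> : u x ^+ 2 * wt x = decay_outer u x * (1 - x ^+ 2)^-1.
  by rewrite /decay_outer /wt; field; rewrite gt_eqF.
exact: half_div_onem_le xx (ltW um) hU.
Qed.

End Positive.

(** * Spectral parameter zero: reduction of order *)

Section Zero.
Hypothesis lam_eq0 : lam = 0.

(* [x sqrt (1 - x^2) / (1 + x^2)] solves the homogeneous equation for [lam = 0]; [e2] is its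
   square and [h0] its logarithmic derivative. *)
Let h0 x : R := x^-1 - x / (1 - x ^+ 2) - 2 * x / (1 + x ^+ 2).
Let e2 x : R := x ^+ 2 * (1 - x ^+ 2) / (1 + x ^+ 2) ^+ 2.

Let e2_gt0 x : 0 < x < 1 -> 0 < e2 x.
Proof.
move=> x01; have /andP[x0 _] := x01; rewrite /e2 divr_gt0//.
  by rewrite mulr_gt0 ?exprn_gt0 ?onem_sqr_gt0.
by rewrite exprn_gt0 ?onep_sqr_gt0.
Qed.

(** The energy no longer controls [z], so [u] is compared with the known solution [e] instead:
    [(u / e)^2] turns out to be nondecreasing near 1, and [e] itself fails to be square integrable
    there. *)
Lemma no_decay_zero x0 : c < x0 < 1 -> u x0 = 0.
Proof.
move=> cx0; have /andP[x00 x01] := in01 cx0; have cltx0 := proj1 (andP cx0).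
have [v [Hu Hv']] := homogeneous_ode.
have Hv : antider c 1 v (fun x => (2 - wt x * (0 - g0_rat x)) * u x) by rewrite -lam_eq0.
apply/eqP/negPn/negP => u0.
have nz x : c < x < 1 -> [/\ x != 0, 1 - x ^+ 2 != 0 & 1 + x ^+ 2 != 0].
  move=> /in01 h; have /andP[xp _] := h.
  by rewrite !gt_eqF ?onep_sqr_gt0// onem_sqr_gt0.
have HA : antider c 1 (fun x => x ^+ 2 * h0 x) (fun x => 2 + wt x * g0_rat x - x ^+ 2 * h0 x ^+ 2).
  have := antiderB (antiderB (antider_pow 1) (antiderM (antider_pow 3) antider_inv_onem_sqr))
     (antiderM (antiderZ 2 (antider_pow 3)) antider_inv_onep_sqr).
  move/sub01/antider_ext; apply => x /nz[n1 n2 n3]; rewrite /h0 /wt /g0_rat /= ?expr0 ?expr1; field; exact/and3P.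
have HE : antider c 1 e2 (fun x => 2 * h0 x * e2 x).
  have := antiderM (antiderB (antider_pow 2) (antider_pow 4)) (antiderM antider_inv_onep_sqr antider_inv_onep_sqr).
  move/sub01/antider_ext; apply => x /nz[n1 n2 n3]; rewrite /e2 /h0 /= ?expr1; field => //; exact/and3P.
have HI : antider c 1 (fun x => (e2 x)^-1) (fun x => - 2 * h0 x / e2 x).
  have := antiderM (antiderM (@antider_inv R 2) antider_inv_onem_sqr)
    (antiderD (antiderD (antider_pow 0) (antiderZ 2 (antider_pow 2))) (antider_pow 4)).
  move/sub01/antider_ext; apply => x /nz[n1 n2 n3]; rewrite /e2 /h0 /= ?expr0 ?expr1; field => //; exact/and3P.
(* [r e = x^2 (u' e - u e')] is the Wronskian. Only its square [r^2 e2] is used, which avoids the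
   square root in [e]. *)
pose r x := v x - x ^+ 2 * h0 x * u x.
have Hr : antider c 1 r (fun x => - h0 x * r x).
  move/antider_ext: (antiderB Hv (antiderM HA Hu)); apply => // x /nz[n1 _ _].
  by rewrite /r; move: (h0 x) (g0_rat x) (wt x) => h g w; field.
have HC : antider c 1 (fun x => r x * r x * e2 x) (fun=> 0).
  move/antider_ext: (antiderM (antiderM Hr Hr) HE); apply => // x _.
  by move: (h0 x) (e2 x) => h e; ring.
have HK : antider c 1 (fun x => u x * r x) (fun x => r x ^+ 2 / x ^+ 2).
  move/antider_ext: (antiderM Hu Hr); apply => // x /nz[n1 _ _].
  by rewrite /r; move: (h0 x) => h; field.
pose y x := u x * u x * (e2 x)^-1.
have Hy : antider c 1 y (fun x => 2 * (u x * r x) / (x ^+ 2 * e2 x)).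
  move/antider_ext: (antiderM (antiderM Hu Hu) HI); apply => // x cx.
  have n2 : e2 x != 0 by rewrite gt_eqF// e2_gt0// in01.
  have [n1 _ _] := nz _ cx; move: n2; rewrite /r; move: (h0 x) (e2 x) => h e n2.
  by field; rewrite ?n1 ?n2.
have rconst x : x0 <= x -> x < 1 -> r x * r x * e2 x = r x0 * r x0 * e2 x0.
  move=> x0x x1; have [_] := HC _ _ cltx0 x0x x1.
  by rewrite /Rintegral integral0 => /eqP; rewrite subr_eq0 => /eqP.
set C := r x0 * r x0 * e2 x0 in rconst.
have C0 : 0 <= C by rewrite mulr_ge0 -?expr2 ?sqr_ge0// ltW// e2_gt0// x00.
(* If the Wronskian vanishes, [u r] is 0 on [[x0, 1)]. Otherwise [(u r)' = r^2 / x^2] is at least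
   [C / 2 / (1 - x)], and [u r] becomes positive by logarithmic growth. *)
have [m [x0m m1 um um0]] : exists m, [/\ x0 <= m, m < 1, u m != 0 &
    forall x, m <= x -> x < 1 -> 0 <= u x * r x].
  have [r0|r0] := eqVneq (r x0) 0.
    exists x0; split => // x x0x x1.
    have : r x * r x * e2 x = 0 by rewrite rconst// /C r0 !mul0r.
    have e0 : 0 < e2 x by rewrite e2_gt0// x1 (lt_le_trans x00).
    move=> h; have : r x * r x = 0 by apply: (mulIf (lt0r_neq0 e0)); rewrite h mul0r.
    by move/eqP; rewrite mulf_eq0 orbb => /eqP ->; rewrite mulr0.
  have Cp : 0 < C / 2.
    by rewrite divr_gt0// mulr_gt0 ?e2_gt0 ?x00// -expr2 exprn_even_gt0.
  have [b0 /andP[x0b b1] Hb0] := log_unbounded ((`|u x0 * r x0| + 1) / (C / 2)) x01.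
  have pos x : b0 <= x -> x < 1 -> 0 < u x * r x.
    move=> bx x1; have x0x : x0 <= x by exact: le_trans (ltW x0b) bx.
    have := antider_le (antiderZ (C / 2) (@antider_log c)) HK cltx0 x0x x1.
    have := Hb0 _ bx x1; rewrite ler_pdivrMr// => h1 h2.
    have {}h2 : C / 2 * (0 - ln (1 - x)) - C / 2 * (0 - ln (1 - x0)) <= u x * r x - u x0 * r x0.
      apply: h2 => z /andP[x0z zx]; have z1 := le_lt_trans zx x1.
      have zp := lt_trans x00 x0z; have z01 : 0 < z < 1 by rewrite zp.
      have E : r z ^+ 2 = C / e2 z.
        by rewrite -(rconst z (ltW x0z) z1) -expr2; field; rewrite gt_eqF// e2_gt0.
      have h := onem_sqr_gt0 z01.
      have -> : r z ^+ 2 / z ^+ 2 = C * ((1 + z ^+ 2) ^+ 2 / z ^+ 4 * (1 - z ^+ 2)^-1).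
        rewrite E /e2; field; rewrite !gt_eqF//; exact: onep_sqr_gt0.
      rewrite -mulrA; apply: ler_wpM2l => //.
      rewrite -[2^-1]mul1r; apply: half_div_onem_le => //.
      rewrite ler_pdivlMr ?exprn_gt0// mul1r; apply: (@le_trans _ _ 1).
        by rewrite exprn_ile1 ?ltW.
      by rewrite exprn_ege1// lerDl sqr_ge0.
    have := ler_norm (- (u x0 * r x0)); rewrite normrN; move: h1 h2; lra.
  exists b0; split => //; first exact: ltW.
    by apply/eqP => h; have := pos b0 (lexx _) b1; rewrite h mul0r ltxx.
  by move=> x bx x1; exact: ltW (pos _ bx x1).
have m0 : 0 < m by exact: lt_le_trans x0m.
have ym : 0 < y m.
  by rewrite mulr_gt0 ?invr_gt0 ?e2_gt0 ?m0// -expr2 exprn_even_gt0.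
(* From [u^2 w = x^4 / (1 + x^2)^2 * y / (1 - x^2)]: the 4 bounds [(1 + x^2)^2], and the 2 comes
   from [1 - x^2 <= 2 (1 - x)]. *)
apply: (@not_weightedL2_near1 R u m (m ^+ 4 / 4 * y m / 2) Lu).
- by rewrite m1 andbT ltW.
- by rewrite divr_gt0// mulr_gt0// divr_gt0// exprn_gt0.
move=> x /andP[mx x1]; have xp := lt_trans m0 mx; have xx : 0 < x < 1 by rewrite xp.
have h := onem_sqr_gt0 xx.
have yx : y m <= y x.
  apply: (antider_mono Hy (lt_le_trans cltx0 x0m) (ltW mx) x1) => z /andP[mz zx].
  have z1 := le_lt_trans zx x1; have zp := lt_trans m0 mz.
  apply: divr_ge0; first by rewrite mulr_ge0// um0// ltW.
  by rewrite mulr_ge0 ?sqr_ge0// ltW// e2_gt0// zp.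
have -> : u x ^+ 2 * wt x = x ^+ 4 / (1 + x ^+ 2) ^+ 2 * y x * (1 - x ^+ 2)^-1.
  rewrite /y /e2 /wt; field; rewrite !gt_eqF//; exact: onep_sqr_gt0.
have m4 : 0 <= m ^+ 4 / 4 by rewrite divr_ge0// exprn_ge0// ltW.
apply: half_div_onem_le => //; first by rewrite mulr_ge0// ltW.
apply: ler_pM => //; first exact: ltW.
apply: ler_pM => //; first by rewrite exprn_ge0// ltW.
  by rewrite lerXn2r ?nnegrE ?ltW.
rewrite lef_pV2 ?posrE ?exprn_gt0 ?onep_sqr_gt0//.
have x2 : x ^+ 2 <= 1 by rewrite exprn_ile1// ltW.
have := sqr_ge0 x; nra.
Qed.

End Zero.

Lemma no_decay x : c < x < 1 -> u x = 0.
Proof.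
by have [l0|l0] := eqVneq lam 0; [exact: no_decay_zero|apply: no_decay_positive; rewrite lt_def l0].
Qed.

End DecayAtOne.

(** * Surjectivity off the half-line *)

Section ComplexShift.
Context {R : realType}.
Notation mu := (@lebesgue_measure R).
Notation I01 := (@I01 R).
Implicit Types (u v f g h : R -> R) (U V F G : bool -> R -> R) (c : R).
Hint Resolve measurable_I01 measurable_itvR : core.

Lemma wip_comb c f g h : weightedL2 f -> weightedL2 g -> weightedL2 h ->
  wip (fun x => f x + c * g x) h = wip f h + c * wip g h.
Proof. by move=> Lf Lg Lh; rewrite wipDl// ?wipZl//; exact: weightedL2Z. Qed.

Lemma weightedL2_comb c f g : weightedL2 f -> weightedL2 g ->
  weightedL2 (fun x => f x + c * g x).
Proof. by move=> Lf Lg; apply: weightedL2D => //; exact: weightedL2Z. Qed.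

Lemma wip_comb_sqr c f g : weightedL2 f -> weightedL2 g ->
  wip (fun x => f x + c * g x) (fun x => f x + c * g x) =
  wip f f + 2 * c * wip f g + c ^+ 2 * wip g g.
Proof.
move=> Lf Lg; have L := weightedL2_comb c Lf Lg.
by rewrite wip_comb// [wip f _]wipC [wip g _]wipC !wip_comb// (wipC g f); ring.
Qed.

Lemma wip_scale_sqr c f : weightedL2 f ->
  wip (fun x => c * f x) (fun x => c * f x) = c ^+ 2 * wip f f.
Proof.
move=> Lf; have L := weightedL2Z c Lf.
by rewrite wipZl// wipC wipZl// mulrA expr2.
Qed.

Lemma wip_le f g h k : weightedL2 f -> weightedL2 g -> weightedL2 h -> weightedL2 k ->
  (forall x, 0 < x < 1 -> f x * g x <= h x * k x) -> wip f g <= wip h k.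
Proof.
move=> Lf Lg Lh Lk fgh; apply: le_Rintegral => //;
  [exact: measurable_I01|exact: wip_integrable|exact: wip_integrable|].
by move=> x /I01P x01; rewrite ler_wpM2r ?wt_ge0// fgh.
Qed.

Lemma wip_triangle f g h : weightedL2 f -> weightedL2 g -> weightedL2 h ->
  wip (fun x => f x - h x) (fun x => f x - h x) <=
  2 * wip (fun x => f x - g x) (fun x => f x - g x) +
  2 * wip (fun x => g x - h x) (fun x => g x - h x).
Proof.
move=> Lf Lg Lh.
have L1 := weightedL2B Lf Lg; have L2 := weightedL2B Lg Lh.
pose p x := f x - g x; pose q x := g x - h x.
have -> : (fun x => f x - h x) = (fun x => p x + 1 * q x).
  by apply/funext => x; rewrite /p /q; ring.
have := wip_ge0 (fun x => p x + (-1) * q x).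
rewrite !wip_comb_sqr// -/p -/q; lra.
Qed.

Lemma le0_geometric (x C : R) : (forall n, x <= C * (2 ^+ n)^-1) -> x <= 0.
Proof.
move=> H; rewrite leNgt; apply/negP => x0.
have C0 : 0 < C by have := H 0%N; rewrite expr0 invr1 mulr1; exact: lt_le_trans.
have := archi_boundP (divr_ge0 (ltW C0) (ltW x0)); set n := Num.bound _ => hn.
have h2 : n%:R < 2 ^+ n :> R by rewrite -natrX ltr_nat ltn_expl.
have := H n; rewrite ler_pdivlMr ?exprn_gt0// => h3.
have : C < 2 ^+ n * x by rewrite -ltr_pdivrMr//; exact: lt_trans h2.
by rewrite ltNge mulrC h3.
Qed.

Lemma solvesA_ae u f f' : solvesA u f -> measurable_fun I01 f' -> ae_eq mu I01 f f' ->
  solvesA u f'.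
Proof.
move=> [v [Hu Hv]] mf' ff'; exists v; split => //; apply: (antider_ae Hv).
  have mu' := antider_measurable_primitive Hu.
  apply: measurable_funB; first by apply: measurable_funM => //; exact: measurable_cst.
  by apply: measurable_funM => //; exact: measurable_wt.
by move: ff'; apply: aeS => x H x01; rewrite H//; exact/I01P.
Qed.

(* A pair [U] stands for the complex function [U true + i U false], and [a + i b] for the
   spectral parameter; [omega = al + i be] rotates the half-line path from [A] to
   [A + g0 - (a + i b)] into the right half plane. *)
Variables a b al be d : R.
Hypotheses (d0 : 0 < d) (dal : d <= al) (omega_le : al ^+ 2 + be ^+ 2 <= 4)
  (dab : d <= - (al * a) + be * b).

Definition pairL2 U := forall i, weightedL2 (U i).
Definition pair_norm2 U := wip (U true) (U true) + wip (U false) (U false).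
Definition pair_shift U i x :=
  (g0 x - a) * U i x + (if i then b else - b) * U (~~ i) x.
Definition solves_path s U F :=
  forall i, solvesA (U i) (fun x => F i x - s * pair_shift U i x).
Definition path_surj s := forall F, pairL2 F -> exists U, pairL2 U /\ solves_path s U F.

Lemma weightedL2_g0B u : weightedL2 u -> weightedL2 (fun x => (g0 x - a) * u x).
Proof.
move=> Lu; have := weightedL2_comb (- a) (weightedL2_g0 Lu) Lu.
by congr weightedL2; apply/funext => x; ring.
Qed.

Lemma pairL2_shift U : pairL2 U -> pairL2 (pair_shift U).
Proof. by move=> LU i; apply: weightedL2_comb (LU _); exact: weightedL2_g0B. Qed.

Lemma pairL2B U V : pairL2 U -> pairL2 V -> pairL2 (fun i x => U i x - V i x).
Proof. by move=> LU LV i; exact: weightedL2B. Qed.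

Lemma pair_norm2_ge0 U : 0 <= pair_norm2 U.
Proof. by apply: addr_ge0; exact: wip_ge0. Qed.

Lemma wip_le_pair_norm2 U i : wip (U i) (U i) <= pair_norm2 U.
Proof. by rewrite /pair_norm2; case: i; rewrite ?lerDl ?lerDr wip_ge0. Qed.

Lemma wip_g0_le u : weightedL2 u -> wip (fun x => g0 x * u x) u <= - wip u u.
Proof.
move=> Lu; have -> : - wip u u = wip (fun x => -1 * u x) u by rewrite wipZl// mulN1r.
apply: wip_le => //; [exact: weightedL2_g0|exact: weightedL2Z|].
move=> x /g0_le /andP[_ h]; have := sqr_ge0 (u x); rewrite expr2; nra.
Qed.

(** [X] is the real part of [omega (F, U)]. Writing [A + s g0 = (A + g0) + (1 - s) (- g0)],
    coercivity and [- g0 >= 1] contribute [al (1 - s) |U|^2], and the shift contributes the share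
    [s]; both rates are at least [d], uniformly in [s]. *)
Lemma path_lower_bound s U F : 0 <= s <= 1 -> pairL2 U -> pairL2 F ->
  solves_path s U F -> d ^+ 2 * pair_norm2 U <= 4 * pair_norm2 F.
Proof.
move=> /andP[s0 s1] LU LF HU.
pose h i x := F i x - s * pair_shift U i x.
have Lh i : weightedL2 (h i).
  by apply: weightedL2B => //; apply: weightedL2Z; exact: pairL2_shift.
pose G i x := g0 x * U i x.
have LG i : weightedL2 (G i) by exact: weightedL2_g0.
have FE i k : weightedL2 k -> wip (F i) k = wip (h i) k + s * wip (G i) k
   - s * a * wip (U i) k + s * (if i then b else - b) * wip (U (~~ i)) k.
  move=> Lk; have -> : F i = (fun x => ((h i x + s * G i x) + (- (s * a)) * U i x)
      + (s * (if i then b else - b)) * U (~~ i) x).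
    by apply/funext => x; rewrite /h /G /pair_shift; ring.
  have L1 := weightedL2_comb s (Lh i) (LG i).
  have L2 := weightedL2_comb (- (s * a)) L1 (LU i).
  by rewrite !wip_comb// mulNr.
have sym : wip (h false) (U true) = wip (h true) (U false).
  by rewrite (solvesA_symmetric (LU false) (Lh false) (LU true) (Lh true) (HU false) (HU true)) wipC.
have symG : wip (G false) (U true) = wip (G true) (U false).
  by congr (Rintegral _ _ _); apply/funext => x; rewrite /G; ring.
have coer i : 0 <= wip (h i) (U i) + wip (G i) (U i).
  by rewrite -wipDl//; exact: solvesA_coercive (LU i) (Lh i) (HU i).
have Gle i : wip (G i) (U i) <= - wip (U i) (U i) by exact: wip_g0_le.
pose X := al * (wip (F true) (U true) + wip (F false) (U false))
  - be * (wip (F false) (U true) - wip (F true) (U false)).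
have XE : X = al * (wip (h true) (U true) + wip (G true) (U true)
     + (wip (h false) (U false) + wip (G false) (U false)))
   + al * (1 - s) * (- wip (G true) (U true) - wip (G false) (U false))
   + s * (- (al * a) + be * b) * pair_norm2 U.
  rewrite /X !FE// sym symG /pair_norm2 /= (wipC (U false) (U true)); ring.
have al0 : 0 <= al by exact: ltW (lt_le_trans d0 dal).
have N0 := pair_norm2_ge0 U.
have dX : d * pair_norm2 U <= X.
  have h1 : 0 <= al * (wip (h true) (U true) + wip (G true) (U true)
     + (wip (h false) (U false) + wip (G false) (U false))).
    by apply: mulr_ge0 => //; exact: addr_ge0.
  have h2 : (1 - s) * (d * pair_norm2 U) <=
      al * (1 - s) * (- wip (G true) (U true) - wip (G false) (U false)).
    rewrite mulrA [al * _]mulrC; apply: ler_pM => //.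
    - by rewrite mulr_ge0 ?subr_ge0// ltW.
    - by rewrite ler_wpM2l ?subr_ge0.
    - by have := Gle true; have := Gle false; rewrite /pair_norm2; lra.
  have h3 : s * (d * pair_norm2 U) <= s * (- (al * a) + be * b) * pair_norm2 U.
    by rewrite -mulrA ler_wpM2l// ler_wpM2r.
  rewrite XE; move: h1 h2 h3; lra.
pose e1 x := al * F true x + (- be) * F false x.
pose e2 x := al * F false x + be * F true x.
have La i : weightedL2 (fun x => al * F i x) by exact: weightedL2Z.
have Le1 : weightedL2 e1 by exact: weightedL2_comb.
have Le2 : weightedL2 e2 by exact: weightedL2_comb.
have E1 : wip e1 e1 = al ^+ 2 * wip (F true) (F true) - 2 * al * be * wip (F true) (F false)
    + be ^+ 2 * wip (F false) (F false).
  by rewrite wip_comb_sqr// wip_scale_sqr// wipZl//; ring.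
have E2 : wip e2 e2 = al ^+ 2 * wip (F false) (F false) + 2 * al * be * wip (F true) (F false)
    + be ^+ 2 * wip (F true) (F true).
  by rewrite wip_comb_sqr// wip_scale_sqr// wipZl// (wipC (F false) (F true)); ring.
have E1U : wip e1 (U true) = al * wip (F true) (U true) - be * wip (F false) (U true).
  by rewrite wip_comb// wipZl// mulNr.
have E2U : wip e2 (U false) = al * wip (F false) (U false) + be * wip (F true) (U false).
  by rewrite wip_comb// wipZl.
(* [e1] and [e2] are the parts of [omega F]. Expanding [|omega F - d U|^2 >= 0] and inserting
   [d |U|^2 <= X] gives [d^2 |U|^2 <= |omega F|^2], which is at most [4 |F|^2]. *)
have := wip_ge0 (fun x => e1 x + (- d) * U true x).
have := wip_ge0 (fun x => e2 x + (- d) * U false x).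
rewrite (wip_comb_sqr (- d) Le1 (LU true)) (wip_comb_sqr (- d) Le2 (LU false)) E1 E2 E1U E2U sqrrN.
have : (al ^+ 2 + be ^+ 2) * pair_norm2 F <= 4 * pair_norm2 F.
  by apply: ler_wpM2r => //; exact: pair_norm2_ge0.
have : d * (d * pair_norm2 U) <= d * X by rewrite ler_wpM2l// ltW.
rewrite /X /pair_norm2 expr2; clear XE dX E1 E2 E1U E2U sym symG; lra.
Qed.

Let K : R := 15 + `|a|.
Let M : R := K ^+ 2 + b ^+ 2.

(** This is multiplication by the complex function [g0 - a - i b]; the cross terms of the two parts
    cancel, leaving its squared modulus. *)
Lemma pair_shift_bound U : pairL2 U -> pair_norm2 (pair_shift U) <= M * pair_norm2 U.
Proof.
move=> LU; pose c i x := (g0 x - a) * U i x.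
have Lc i : weightedL2 (c i) by exact: weightedL2_g0B.
have K0 : 0 <= K by rewrite addr_ge0.
have H i : wip (c i) (c i) <= K ^+ 2 * wip (U i) (U i).
  rewrite -wip_scale_sqr//; apply: wip_le => //; try exact: weightedL2Z.
  move=> x /g0_le/andP[h1 h2]; rewrite /c -!expr2 !exprMn.
  apply: ler_wpM2r; first exact: sqr_ge0.
  rewrite -[X in X <= _]real_normK ?num_real// lerXn2r ?nnegrE//.
  have := ler_norm a; have := ler_norm (- a); rewrite normrN /K ler_norml => h3 h4.
  by apply/andP; split; lra.
have E i : wip (pair_shift U i) (pair_shift U i) = wip (c i) (c i)
    + 2 * (if i then b else - b) * wip (c i) (U (~~ i)) + b ^+ 2 * wip (U (~~ i)) (U (~~ i)).
  by rewrite (wip_comb_sqr (if i then b else - b) (Lc i) (LU (~~ i))); case: i; ring.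
have cross : wip (c true) (U false) = wip (c false) (U true).
  by congr (Rintegral _ _ _); apply/funext => x; rewrite /c; ring.
rewrite /pair_norm2 !E/= cross /M; have := H true; have := H false; lra.
Qed.

Lemma solves_pathB s U F V G : solves_path s U F -> solves_path s V G ->
  solves_path s (fun i x => U i x - V i x) (fun i x => F i x - G i x).
Proof.
move=> HU HV i; apply: solvesA_ext (antider_comb (-1) (HU i) (HV i)) _ _ => x _; first by ring.
by rewrite /pair_shift; ring.
Qed.

Lemma path_surj0 : path_surj 0.
Proof.
move=> F LF; have [u1 [L1 H1 _]] := solvesA_exists (LF true).
have [u2 [L2 H2 _]] := solvesA_exists (LF false).
exists (fun i => if i then u1 else u2); split; first by case.
by case; [move: H1|move: H2] => H; apply: solvesA_ext H _ _ => // x _; ring.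
Qed.

(* Neumann series around the parameter [s]. *)
Lemma path_surj_step s s' : 0 <= s <= 1 -> 16 * (s' - s) ^+ 2 * M <= d ^+ 2 ->
  path_surj s -> path_surj s'.
Proof.
move=> s01 small Ss F LF; set e := s' - s in small.
(* Choice needs a total function; off [pairL2] the value [G] is arbitrary. *)
have /choice[sol Hsol] : forall G, exists U, pairL2 G -> pairL2 U /\ solves_path s U G.
  move=> G; have [LG|nG] := pselect (pairL2 G); last by exists G.
  by have [U HU] := Ss G LG; exists U.
pose rhs U i x := F i x - e * pair_shift U i x.
have Lrhs U : pairL2 U -> pairL2 (rhs U).
  by move=> LU; apply: pairL2B => // i; apply: weightedL2Z; exact: pairL2_shift.
(* The lower bound costs [4 / d^2] and the shift [(s' - s)^2 M]; the smallness hypothesis makes the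
   product at most [1 / 4], the ratio that the completeness lemma expects. *)
have contract U V : pairL2 U -> pairL2 V ->
    pair_norm2 (fun i x => sol (rhs U) i x - sol (rhs V) i x) <=
    pair_norm2 (fun i x => U i x - V i x) / 4.
  move=> LU LV; have [LU' HU'] := Hsol _ (Lrhs _ LU); have [LV' HV'] := Hsol _ (Lrhs _ LV).
  set D := pair_norm2 (fun i x => U i x - V i x).
  have := path_lower_bound s01 (pairL2B LU' LV') (pairL2B (Lrhs _ LU) (Lrhs _ LV))
    (solves_pathB HU' HV').
  set D' := pair_norm2 _.
  have LUV := pairL2B LU LV.
  have -> : (fun i x => rhs U i x - rhs V i x) =
      (fun i x => (- e) * pair_shift (fun j y => U j y - V j y) i x).
    by apply/funext => i; apply/funext => x; rewrite /rhs /pair_shift; ring.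
  rewrite [X in 4 * X]/pair_norm2 !wip_scale_sqr; try exact: pairL2_shift.
  rewrite sqrrN -mulrDr => h1.
  have h2 := pair_shift_bound LUV; rewrite -/D in h2.
  have d2 : 0 < d ^+ 2 by rewrite exprn_gt0.
  have D0 : 0 <= D by exact: pair_norm2_ge0.
  rewrite -(ler_pM2l d2); apply: le_trans h1 _.
  apply: (@le_trans _ _ (4 * (e ^+ 2 * (M * D)))).
    by rewrite ler_wpM2l// ler_wpM2l// sqr_ge0.
  have : 16 * e ^+ 2 * M * D <= d ^+ 2 * D by rewrite ler_wpM2r.
  lra.
pose it := fix it n := if n is n'.+1 then sol (rhs (it n')) else (fun=> fun=> 0 : R).
have Lit n : pairL2 (it n).
  elim: n => [|n IH]; first by move=> i; exact: weightedL20.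
  by have [] := Hsol _ (Lrhs _ IH).
pose D n := pair_norm2 (fun i x => it n.+1 i x - it n i x).
have HD n : D n <= D 0%N * (4 ^+ n)^-1.
  elim: n => [|n IH]; first by rewrite expr0 invr1 mulr1.
  have h : D n.+1 <= D n / 4 := contract _ _ (Lit n.+1) (Lit n).
  apply: le_trans h _; rewrite exprS invfM.
  by move: IH; move: (D n) (D 0%N) (4 ^+ n)^-1 => y z w; lra.
have /choice[g Hg] : forall i, exists g, weightedL2 g /\ forall n,
    wip (fun x => g x - it n i x) (fun x => g x - it n i x) <= 4 * D 0%N * (2 ^+ n)^-1.
  move=> i; have [g Lg Hg] := @weightedL2_complete R (fun n => it n i) (D 0%N) (fun n => Lit n i)
    (fun n => le_trans (wip_le_pair_norm2 (fun i x => it n.+1 i x - it n i x) i) (HD n)).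
  by exists g.
have Lg : pairL2 g by move=> i; have [] := Hg i.
have gn n : pair_norm2 (fun i x => g i x - it n i x) <= 8 * D 0%N * (2 ^+ n)^-1.
  have [_ /(_ n)] := Hg true; have [_ /(_ n)] := Hg false.
  rewrite /pair_norm2; lra.
(* The limit [g] is determined only up to null sets and need not satisfy the system pointwise. Its
   image [U] does, with right-hand side [rhs g], and since [U = g] almost everywhere this side can
   be rewritten in terms of [U]. *)
have [LU HU] := Hsol _ (Lrhs _ Lg); set U := sol (rhs g) in LU HU.
have ae i : ae_eq mu I01 (U i) (g i).
  have LUg : weightedL2 (fun x => U i x - g i x) by exact: weightedL2B.
  suff /(wip_eq0 LUg) : wip (fun x => U i x - g i x) (fun x => U i x - g i x) = 0.
    by apply: aeS => x H x01; apply/eqP; rewrite -subr_eq0 H.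
  apply/eqP; rewrite eq_le wip_ge0 andbT.
  apply: (@le0_geometric _ (8 * D 0%N)) => n.
  apply: le_trans (wip_triangle (LU i) (Lit n.+1 i) (Lg i)) _.
  have h1 : wip (fun x => U i x - it n.+1 i x) (fun x => U i x - it n.+1 i x) <= _ :=
    le_trans (wip_le_pair_norm2 (fun i x => U i x - it n.+1 i x) i) (contract _ _ Lg (Lit n)).
  have h2 := gn n.
  have [_ /(_ n.+1)] := Hg i; rewrite exprS invfM => h3.
  have h4 : wip (fun x => it n.+1 i x - g i x) (fun x => it n.+1 i x - g i x) =
    wip (fun x => g i x - it n.+1 i x) (fun x => g i x - it n.+1 i x).
    by congr (Rintegral _ _ _); apply/funext => x; ring.
  move: h1 h2 h3; rewrite h4; lra.
exists U; split => // i; apply: solvesA_ae (HU i) _ _.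
  by apply: (weightedL2B (LF i) _).1; apply: weightedL2Z; exact: pairL2_shift.
apply: (aeS2 _ (ae i) (ae (~~ i))) => x h1 h2 x01.
by rewrite /rhs /pair_shift h1// h2// /e; ring.
Qed.

Lemma path_surj1 : path_surj 1.
Proof.
have M0 : 0 <= M by rewrite addr_ge0 ?sqr_ge0.
have d2 : 0 < d ^+ 2 by rewrite exprn_gt0.
(* Neither [d] nor [M] depends on [s], so one step length [1 / N] serves along the whole path. *)
pose N := (Num.bound (16 * M / d ^+ 2)).+1.
have N0 : 0 < N%:R :> R by rewrite ltr0n.
have HN : 16 * (N%:R^-1) ^+ 2 * M <= d ^+ 2.
  have := archi_boundP (divr_ge0 (mulr_ge0 (ler0n R 16) M0) (ltW d2)).
  rewrite ltr_pdivrMr// => h.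
  have N1 : 1 <= N%:R :> R by rewrite ler1n.
  have h2 : 16 * M <= N%:R * d ^+ 2.
    by apply: le_trans (ltW h) _; apply: ler_wpM2r; [exact: ltW|rewrite ler_nat; exact: leqnSn].
  have -> : 16 * N%:R^-1 ^+ 2 * M = 16 * M / (N%:R * N%:R) by field; rewrite gt_eqF.
  rewrite ler_pdivrMr ?mulr_gt0// [d ^+ 2 * _]mulrC -mulrA.
  apply: le_trans h2 _; rewrite -[leLHS]mul1r; apply: ler_wpM2r => //.
  by rewrite mulr_ge0 ?ltW.
have H k : (k <= N)%N -> path_surj (k%:R / N%:R).
  elim: k => [_|k IH kN]; first by rewrite mul0r; exact: path_surj0.
  apply: path_surj_step (IH (ltnW kN)).
    by rewrite divr_ge0//= ler_pdivrMr// mul1r ler_nat ltnW.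
  by rewrite -mulrBl -natrB ?leqnSn// subSnn mul1r.
by have := H N (leqnn _); rewrite divff// gt_eqF.
Qed.

End ComplexShift.

Lemma rotation_exists (R : realType) (a b : R) : ~ (b = 0 /\ 0 <= a) ->
  exists al be d : R, [/\ 0 < d, d <= al, al ^+ 2 + be ^+ 2 <= 4 & d <= - (al * a) + be * b].
Proof.
move=> ab; pose l := Num.sqrt (a ^+ 2 + b ^+ 2).
have l2 : l ^+ 2 = a ^+ 2 + b ^+ 2 by rewrite sqr_sqrtr// addr_ge0 ?sqr_ge0.
have l0 : 0 <= l by exact: sqrtr_ge0.
have al : a < l.
  rewrite ltNge; apply/negP => la; apply: ab; have a0 := le_trans l0 la.
  have h : l ^+ 2 <= a ^+ 2 by rewrite lerXn2r ?nnegrE.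
  have b2 : b ^+ 2 = 0 by have := sqr_ge0 b; lra.
  by split => //; apply/eqP; rewrite -sqrf_eq0 b2.
have lp : 0 < l.
  rewrite lt_def l0 andbT; apply/eqP => le; have : a ^+ 2 = 0.
    by have := sqr_ge0 a; have := sqr_ge0 b; move: l2; rewrite le expr0n /=; lra.
  by move/eqP; rewrite sqrf_eq0 => /eqP a0; move: al; rewrite a0 le ltxx.
(* [omega = 1 - conj lam / |lam|] bisects the direction 1 and the direction that turns [- lam] into
   a positive number. Its real part is [1 - a / l], and the real part of [- omega lam] is [l - a];
   both are positive off the half-line. *)
exists (1 - a / l), (b / l), (Num.min (1 - a / l) (l - a)); split.
- by rewrite lt_min !subr_gt0 al ltr_pdivrMr// mul1r al.
- by rewrite ge_min lexx.
- have -> : (1 - a / l) ^+ 2 + (b / l) ^+ 2 = 1 - 2 * (a / l) + (a ^+ 2 + b ^+ 2) / l ^+ 2.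
    by field; rewrite gt_eqF.
  rewrite -l2 divff ?expf_neq0 ?gt_eqF//.
  have : - l <= a.
    rewrite lerNl; apply: le_trans (ler_norm _) _.
    by rewrite normrN -sqrtr_sqr ler_sqrt ?addr_ge0 ?sqr_ge0// lerDl sqr_ge0.
  have -> : - l <= a = (-1 <= a / l) by rewrite ler_pdivlMr// mulN1r.
  lra.
- have -> : - ((1 - a / l) * a) + b / l * b = - a + (a ^+ 2 + b ^+ 2) / l by field; rewrite gt_eqF.
  rewrite -l2 expr2 mulfK ?gt_eqF// ge_min; apply/orP; right; lra.
Qed.

(** * Range for nonnegative parameters *)

Section RealResolvent.
Context {R : realType}.
Notation mu := (@lebesgue_measure R).
Notation I01 := (@I01 R).
Implicit Types (u v f g h k : R -> R) (x a b c : R).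
Hint Resolve measurable_I01 measurable_itvR : core.

Lemma continuous_ae_zero g l r x : l < r -> l <= x <= r -> {for x, continuous g} ->
  {ae mu, forall y, l < y < r -> g y = 0} -> g x = 0.
Proof.
move=> lr /andP[lx xr] cg gae; apply/eqP/negPn/negP => gx.
have g0 : 0 < `|g x| by rewrite normr_gt0.
have /cvgr_dist_lt/(_ _ g0)/nbhs_ballP[e e0 He] := cg.
pose s := Num.max l (x - e / 2); pose t := Num.min r (x + e / 2).
have e2 : 0 < e / 2 by rewrite divr_gt0.
have st : s < t.
  rewrite /s /t gt_max !lt_min; apply/andP; split; apply/andP; split => //; lra.
have sub y : s < y < t -> (l < y < r) /\ g y != 0.
  rewrite /s /t gt_max lt_min => /andP[/andP[ly xy] /andP[yr yx]]; split.
    by rewrite ly.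
  apply/eqP => gy; have := He y; rewrite /ball/= gy subr0 ltxx => H.
  suff : false by []; apply: H; rewrite ltr_norml; apply/andP; split; lra.
move: gae => [B [mB B0 HB]].
have : (mu `]s, t[ <= mu B)%E.
  apply: le_measure; [apply/mem_set; exact: measurable_itvR|exact/mem_set|].
  move=> y /=; rewrite in_itv/= => /sub[ly gy]; apply: HB => /= H.
  by move: gy; rewrite H// eqxx.
by rewrite B0 lebesgue_measure_itv/= lte_fin st -EFinD lee_fin leNgt subr_gt0 st.
Qed.

Definition solves_res lam u f := solvesA u (fun x => (lam - g0 x) * u x - f x).

Lemma solves_res_comb lam u1 f1 u2 f2 c : solves_res lam u1 f1 -> solves_res lam u2 f2 ->
  solves_res lam (fun x => u1 x + c * u2 x) (fun x => f1 x + c * f2 x).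
Proof.
by move=> H1 H2; apply: solvesA_ext (antider_comb c H1 H2) _ _ => // x _; ring.
Qed.

Lemma solves_res_zero lam : solves_res lam (fun=> 0) (fun=> 0).
Proof.
have H : antider 0 1 (fun=> 0 : R) (fun=> 0).
  by apply: derive_antider => x _; exact: cst_continuous.
exists (fun=> 0); split; apply: (antider_ext H) => // x _; first by rewrite mul0r.
by rewrite !mulr0 subr0 mulr0 subr0.
Qed.

Lemma weightedL2_res lam u f : weightedL2 u -> weightedL2 f ->
  weightedL2 (fun x => (lam - g0 x) * u x - f x).
Proof.
move=> Lu Lf; have := weightedL2B (weightedL2B (weightedL2Z lam Lu) (weightedL2_g0 Lu)) Lf.
by congr weightedL2; apply/funext => x; ring.
Qed.

Lemma solves_res_symmetric lam u1 f1 u2 f2 : weightedL2 u1 -> weightedL2 f1 ->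
  weightedL2 u2 -> weightedL2 f2 -> solves_res lam u1 f1 -> solves_res lam u2 f2 ->
  wip f1 u2 = wip u1 f2.
Proof.
move=> L1 M1 L2 M2 H1 H2.
have W1 := weightedL2_res lam L1 M1; have W2 := weightedL2_res lam L2 M2.
have := solvesA_symmetric L1 W1 L2 W2 H1 H2.
have Lg u : weightedL2 u -> weightedL2 (fun x => (lam - g0 x) * u x).
  by move=> Lu; have := weightedL2_res lam Lu weightedL20; congr weightedL2; apply/funext => x; ring.
have E u f k : weightedL2 u -> weightedL2 f -> weightedL2 k ->
   wip (fun x => (lam - g0 x) * u x - f x) k = wip (fun x => (lam - g0 x) * u x) k - wip f k.
  move=> Lu Lf Lk; rewrite -[X in _ - X]mul1r -mulNr -wip_comb//; last exact: Lg.
  by congr wip; apply/funext => x; ring.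
rewrite [RHS]wipC !E// [wip f2 _]wipC.
have -> : wip (fun x => (lam - g0 x) * u1 x) u2 = wip (fun x => (lam - g0 x) * u2 x) u1.
  by congr (Rintegral _ _ _); apply/funext => x; ring.
lra.
Qed.

Variables (lam : R).
Hypothesis lam0 : 0 <= lam.

Lemma solves_res_vanish c u f : 0 <= c < 1 -> weightedL2 u -> solves_res lam u f ->
  (forall x, c < x < 1 -> f x = 0) -> forall x, c < x < 1 -> u x = 0.
Proof.
move=> c01 Lu H f0; apply: (no_decay lam0 c01 Lu H).
by apply: aeW => x cx; rewrite f0//; ring.
Qed.

Let p x : R := x ^+ 1 - x ^+ 3.

Let p_explicit : weightedL2 p /\ exists2 f, weightedL2 f & solves_res lam p f.
Proof.
have L1 : weightedL2 (fun x : R => 1 - x ^+ 2).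
  have mq : measurable_fun I01 (fun x : R => 1 - x ^+ 2).
    by apply: measurable_funB => //; exact: measurable_funX.
  split => //; apply: (proj1 (@bounded_integral R I01 _ 1 1 _ _ _ _)) => //.
  - by rewrite lebesgue_measure_itv/= lte_fin ltr01 -EFinD subr0.
  - by apply: measurable_funM; [exact: measurable_funX|exact: measurable_wt].
  move=> x /I01P x01; have /andP[x0 x1] := x01; have h := onem_sqr_gt0 x01.
  have -> : (1 - x ^+ 2) ^+ 2 * wt x = x ^+ 2 by rewrite /wt; field; rewrite gt_eqF.
  by rewrite sqr_ge0 expr_le1// ltW.
have Lp : weightedL2 p.
  have : weightedL2 (fun x : R => x * (1 - x ^+ 2)).
    apply: (weightedL2_bounded (M := 1)) L1 => //.
    by move=> x /andP[x0 x1]; rewrite gtr0_norm// ltW.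
  by congr weightedL2; apply/funext => x; rewrite /p; ring.
split => //.
(* [q] is [A p]: from [v = x^2 - 3 x^4] one finds [2 p - v' = 10 x^3], divided by the weight. *)
pose q x : R := 10 * x ^+ 1 * (1 - x ^+ 2) ^+ 2.
have Lq : weightedL2 q.
  have : weightedL2 (fun x : R => (10 * (1 - x ^+ 2)) * p x).
    apply: (weightedL2_bounded (M := 10)) Lp => //.
      apply: measurable_funM; first exact: measurable_cst.
      by case: L1.
    move=> x x01; have h := onem_sqr_gt0 x01; rewrite gtr0_norm ?mulr_gt0//.
    have := sqr_ge0 x; lra.
  by congr weightedL2; apply/funext => x; rewrite /p /q; ring.
exists (fun x => (lam - g0 x) * p x - q x); first exact: weightedL2_res.
exists (fun x => x ^+ 2 - 3 * x ^+ 4); split.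
  apply: antider_ext (antiderB (antider_pow 1) (antider_pow 3)) _ _ => // x /andP[x0 _].
  by rewrite /= expr0; field; rewrite gt_eqF.
apply: antider_ext (antiderB (antider_pow 2) (antiderZ 3 (antider_pow 4))) _ _ => // x x01.
have /andP[x0 _] := x01; have h := onem_sqr_gt0 x01.
by rewrite /p /q /wt /= ; move: (g0 x) => g'; field; rewrite !gt_eqF.
Qed.

(** [D = p - u1] has its right-hand side supported in [(c, 1)], where [u2] vanishes, so testing
    against [u2] gives [wip D (cut D) = 0] by symmetry. Thus [D] vanishes on [(0, c)] and, by
    continuity, at [c]; so does [u1], but [p c] is not 0. *)
Lemma not_surjective_real : ~ (forall f, weightedL2 f -> exists2 u, weightedL2 u & solves_res lam u f).
Proof.
move=> surj; have [Lp [F LF HF]] := p_explicit.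
pose c : R := 1 / 2.
have c01 : 0 < c < 1 by rewrite /c; apply/andP; split; lra.
have /andP[c0 c1] := c01.
have c01' : 0 <= c < 1 by rewrite c1 ltW.
pose cut f x : R := (if x <= c then 1 else 0) * f x.
have Lcut f : weightedL2 f -> weightedL2 (cut f).
  apply: (weightedL2_bounded (M := 1)).
    apply: measurable_fun_if; [exact: measurable_I01| |exact: measurable_cst|exact: measurable_cst].
    by apply: measurable_fun_ler; [exact: measurable_id|exact: measurable_cst].
  by move=> x _; case: ifP; rewrite ?normr1 ?normr0.
have cut0 f x : c < x < 1 -> cut f x = 0.
  by move=> /andP[cx _]; rewrite /cut leNgt cx mul0r.
have [u1 Lu1 Hu1] := surj _ (Lcut _ LF).
have Z1 := solves_res_vanish c01' Lu1 Hu1 (cut0 _).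
pose D x := p x - u1 x.
have LD : weightedL2 D by exact: weightedL2B.
have [u2 Lu2 Hu2] := surj _ (Lcut _ LD).
have Z2 := solves_res_vanish c01' Lu2 Hu2 (cut0 _).
have E1 := solves_res_symmetric Lp LF Lu2 (Lcut _ LD) HF Hu2.
have E2 := solves_res_symmetric Lu1 (Lcut _ LF) Lu2 (Lcut _ LD) Hu1 Hu2.
have E3 : wip F u2 = wip (cut F) u2.
  apply: eq_Rintegral => x; rewrite inE => /I01P/andP[x0 x1].
  have [xc|cx] := leP x c; first by rewrite /cut xc mul1r.
  by rewrite Z2 ?cx// !mulr0.
have D0 : wip (cut D) (cut D) = 0.
  have -> : wip (cut D) (cut D) = wip D (cut D).
    by congr (Rintegral _ _ _); apply/funext => x; rewrite /cut; case: ifP => _; ring.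
  have -> : wip D (cut D) = wip p (cut D) + (-1) * wip u1 (cut D).
    by rewrite -wip_comb//; [congr wip; apply/funext => x; rewrite /D; ring|exact: Lcut].
  rewrite -E1 -E2 E3; ring.
have cu1 : {for c, continuous u1} by have [v [h _]] := Hu1; exact: antider_continuous h c01.
have cp : {for c, continuous p}.
  exact: derive_continuous (derive_sub (derive_pow 1 c) (derive_pow 3 c)).
have u1c : u1 c = 0.
  apply: (@continuous_ae_zero _ c 1 c) => //; first by rewrite lexx ltW.
  by apply: aeW => x; exact: Z1.
have : D c = 0.
  apply: (@continuous_ae_zero _ 0 c c) => //; first by rewrite lexx ltW.
    exact: continuousB.
  have := wip_eq0 (Lcut _ LD) D0; apply: aeS => x H /andP[x0 xc].
  have := H (proj2 (I01P x) _); rewrite /cut (ltW xc) mul1r; apply.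
  by rewrite x0 (lt_trans xc).
rewrite /D u1c /p /c; lra.
Qed.


Let in_range h := weightedL2 h /\ exists2 u, weightedL2 u & solves_res lam u h.

Let in_range_comb c h k : in_range h -> in_range k -> in_range (fun x => h x + c * k x).
Proof.
move=> [Lh [u Lu Hu]] [Lk [v Lv Hv]]; split; first exact: weightedL2_comb.
by exists (fun x => u x + c * v x); [exact: weightedL2_comb|exact: solves_res_comb].
Qed.

(** The range need not be closed, so the projection is onto its closure and is delivered together
    with elements [h n] of the range that approach it. *)
Let orthogonal_projection f : weightedL2 f -> exists g (h : nat -> R -> R) (C : R),
  [/\ weightedL2 g, forall n, in_range (h n), forall k, in_range k -> wip g k = 0 &
    forall n, wip (fun x => (f x - g x) - h n x) (fun x => (f x - g x) - h n x) <= C * (2 ^+ n)^-1].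
Proof.
move=> Lf; pose dist h := wip (fun x => f x - h x) (fun x => f x - h x).
pose E : set R := [set dist h | h in in_range].
have E0 y : E y -> 0 <= y by move=> [h _ <-]; exact: wip_ge0.
have infE : has_inf E.
  split; last by exists 0 => y; exact: E0.
  exists (dist (fun=> 0)), (fun=> 0) => //; split; first exact: weightedL20.
  by exists (fun=> 0); [exact: weightedL20|exact: solves_res_zero].
have Einf h : in_range h -> inf E <= dist h.
  by move=> H; apply: (ge_inf infE.2); exists h.
have pos n : 0 < (4 ^+ n)^-1 :> R by rewrite invr_gt0 exprn_gt0.
have /choice[h Hh] : forall n : nat, exists h, in_range h /\ dist h < inf E + (4 ^+ n)^-1.
  by move=> n; have [_ [h H <-] H2] := inf_adherent (pos n) infE; exists h.
have Rh n : in_range (h n) by case: (Hh n).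
have Lh n : weightedL2 (h n) by case: (Rh n).
pose e n x := f x - h n x.
have Le n : weightedL2 (e n) by exact: weightedL2B.
(* Parallelogram law: the midpoint of [h n] and [h n.+1] is in the range and cannot be nearer to [f]
   than the infimum. *)
have cauchy n : wip (fun x => h n.+1 x - h n x) (fun x => h n.+1 x - h n x) <= 4 * (4 ^+ n)^-1.
  have mid : dist (fun x => h n x + 2^-1 * ((fun x => h n.+1 x + (-1) * h n x) x)) =
      (2 * dist (h n) + 2 * dist (h n.+1)
      - wip (fun x => h n.+1 x - h n x) (fun x => h n.+1 x - h n x)) / 4.
    have -> : (fun x => h n.+1 x - h n x) = (fun x => e n x + (-1) * e n.+1 x).
      by apply/funext => x; rewrite /e; ring.
    rewrite /dist -/(e n) -/(e n.+1) wip_comb_sqr//.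
    have -> : (fun x => f x - (h n x + 2^-1 * (h n.+1 x + (-1) * h n x))) =
        (fun x => 2^-1 * ((fun x => e n x + 1 * e n.+1 x) x)).
      by apply/funext => x; rewrite /e; field.
    rewrite wip_scale_sqr; last exact: weightedL2_comb.
    by rewrite wip_comb_sqr//; field.
  have := Einf _ (in_range_comb 2^-1 (Rh n) (in_range_comb (-1) (Rh n.+1) (Rh n))).
  rewrite mid.
  have [_] := Hh n; have [_] := Hh n.+1; rewrite exprS invfM.
  have := pos n; move: (4 ^+ n)^-1 (inf E) (dist (h n)) (dist (h n.+1)) => q i y z.
  move: (wip _ _) => w; lra.
have [l Ll Hl] := weightedL2_complete Lh cauchy.
pose g x := f x - l x.
have Lg : weightedL2 g by exact: weightedL2B.
exists g, h, (4 * 4); split => //; last first.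
  move=> n; have -> : (fun x => f x - g x - h n x) = (fun x => l x - h n x).
    by apply/funext => x; rewrite /g; ring.
  exact: Hl.
move=> k Rk; have Lk : weightedL2 k by case: Rk.
(* Moving [h n] by [t k] stays in the range, so for no [t] can the squared distance drop by more
   than [4^-n]; the discriminant turns this into near orthogonality. *)
have en n : wip (e n) k ^+ 2 <= wip k k * (4 ^+ n)^-1.
  apply: cauchy_schwarz_discriminant; first exact: wip_ge0.
  move=> t; have := Einf _ (in_range_comb t (Rh n) Rk); rewrite /dist.
  have -> : (fun x => f x - (h n x + t * k x)) = (fun x => e n x + (- t) * k x).
    by apply/funext => x; rewrite /e; ring.
  rewrite wip_comb_sqr//; have [_] := Hh n; rewrite /dist -/(e n) sqrrN; lra.
have ln n : wip (fun x => l x - h n x) k ^+ 2 <= wip k k * (16 * (2 ^+ n)^-1).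
  have Ln : weightedL2 (fun x => l x - h n x) by exact: weightedL2B.
  apply: cauchy_schwarz_discriminant; first exact: wip_ge0.
  move=> t; have := wip_ge0 (fun x => (l x - h n x) + (- t) * k x).
  rewrite (wip_comb_sqr (- t) Ln Lk) sqrrN; have := Hl n.
  move: (wip _ _) (wip _ _) (wip _ _) => A B C; lra.
have : wip g k ^+ 2 <= 0.
  apply: (@le0_geometric _ _ (2 * wip k k * 17)) => n.
  have -> : wip g k = wip (e n) k + (-1) * wip (fun x => l x - h n x) k.
    by rewrite -wip_comb//; [congr wip; apply/funext => x; rewrite /g /e; ring|exact: weightedL2B].
  have q42 : (4 ^+ n)^-1 <= (2 ^+ n)^-1 :> R.
    by rewrite lef_pV2 ?posrE ?exprn_gt0// lerXn2r ?nnegrE//; lra.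
  have h1 := ler_wpM2l (wip_ge0 k) q42.
  have := ln n; have := en n; have := sqr_ge0 (wip (e n) k + wip (fun x => l x - h n x) k).
  move: h1; move: (wip (e n) k) (wip (fun x => l x - h n x) k) (wip k k) (4 ^+ n)^-1 (2 ^+ n)^-1.
  move=> y z w q r; lra.
by move=> h0; apply/eqP; rewrite -sqrf_eq0 eq_le h0 sqr_ge0.
Qed.

(** A vector [g] orthogonal to the range must first be shown to lie in the domain. The resolvent at
    -1 replaces the adjoint: with [y = (A_0 + 1)^-1 g] one gets [g = (lam + 1) y], so [y] is an
    eigenfunction for [lam], hence 0. *)
Lemma dense_range_real f eps : weightedL2 f -> 0 < eps -> exists u h,
  [/\ weightedL2 u, weightedL2 h, solves_res lam u h &
    wip (fun x => h x - f x) (fun x => h x - f x) < eps].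
Proof.
move=> Lf e0; have [g [h [C [Lg Rh orth Hh]]]] := orthogonal_projection Lf.
have inv k : weightedL2 k -> exists2 y, weightedL2 y & solvesA y (fun x => k x - (g0 x + 1) * y x).
  move=> Lk; have nz : ~ (0 = 0 :> R /\ 0 <= -1 :> R) by case=> _; lra.
  have [al [be [d [d0 dal om dab]]]] := rotation_exists nz.
  have [U [LU HU]] := path_surj1 d0 dal om dab (F := fun i => if i then k else fun=> 0)
    (fun i => if i return weightedL2 (if i then k else fun=> 0) then Lk else weightedL20).
  exists (U true) => //; apply: solvesA_ext (HU true) _ _ => // x _.
  by rewrite /pair_shift/=; ring.
have [y Ly Hy] := inv g Lg.
(* For [u = (A_0 + 1)^-1 k] the function [(lam + 1) u - k] equals [(lam - A_0) u] and is orthogonal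
   to [g]; symmetry then moves the resolvent from [k] to [g]. *)
have wk k : weightedL2 k -> wip g k = (lam + 1) * wip y k.
  move=> Lk; have [u Lu Hu] := inv k Lk.
  have Rk : in_range (fun x => (-1) * k x + (lam + 1) * u x).
    split; first by apply: weightedL2_comb => //; exact: weightedL2Z.
    by exists u => //; apply: solvesA_ext Hu _ _ => // x _; ring.
  have := orth _ Rk; rewrite wipC wip_comb//; last exact: weightedL2Z.
  rewrite wipZl// (wipC k) (wipC u) => E.
  have res v w : solvesA v (fun x => w x - (g0 x + 1) * v x) -> solves_res (-1) v (fun x => (-1) * w x).
    by move=> Hv; apply: solvesA_ext Hv _ _ => // x _; ring.
  have := solves_res_symmetric Ly (weightedL2Z (-1) Lg) Lu (weightedL2Z (-1) Lk) (res _ _ Hy) (res _ _ Hu).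
  rewrite wipZl// [RHS]wipC wipZl// (wipC k y); move: E.
  move: (wip g k) (wip g u) (wip y k) => A B D E F.
  have BD : B = D by lra.
  by rewrite BD in E; lra.
have gy : ae_eq mu I01 g (fun x => (lam + 1) * y x).
  have Ld : weightedL2 (fun x => g x + (- (lam + 1)) * y x) by exact: weightedL2_comb.
  have /(wip_eq0 Ld) : wip (fun x => g x + (- (lam + 1)) * y x) (fun x => g x + (- (lam + 1)) * y x) = 0.
    by rewrite wip_comb// wk//; ring.
  by apply: aeS => x H x01; have := H x01; lra.
have y0 x : 0 < x < 1 -> y x = 0.
  apply: (no_decay lam0 _ Ly Hy); first by rewrite lexx ltr01.
  by apply: aeS gy => z H z01; rewrite H; [ring|exact/I01P].
have g00 : wip g g = 0.
  rewrite wk//; have -> : wip y g = 0; last by rewrite mulr0.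
  have -> : wip y g = \int[mu]_(x in I01) 0; last by rewrite /Rintegral integral0.
  by apply: eq_Rintegral => x; rewrite inE => /I01P x01; rewrite y0// !mul0r.
have [n Hn] : exists n, 2 * C * (2 ^+ n)^-1 < eps.
  apply: contrapT => H; suff : eps <= 0 by rewrite leNgt e0.
  apply: (@le0_geometric _ _ (2 * C)) => n; rewrite leNgt; apply/negP => h1.
  by apply: H; exists n.
have [Lhn [u Lu Hu]] := Rh n; exists u, (h n); split => //.
have -> : (fun x => h n x - f x) = (fun x => (-1) * ((fun x => (f x - g x) - h n x) x + 1 * g x)).
  by apply/funext => x; ring.
have L1 : weightedL2 (fun x => f x - g x - h n x) by do 2 apply: weightedL2B => //.
rewrite wip_scale_sqr; last exact: weightedL2_comb.
rewrite (wip_comb_sqr 1 L1 Lg) g00.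
have := wip_ge0 (fun x => (f x - g x - h n x) + (-1) * g x).
rewrite (wip_comb_sqr (-1) L1 Lg) g00.
have := Hh n; move: Hn; move: (wip _ _) (wip _ _) => A B; lra.
Qed.

End RealResolvent.

(** * Complex-valued functions *)

Section ComplexFunctions.
Context {R : realType}.
Notation mu := (@lebesgue_measure R).
Notation I01 := (@I01 R).
Implicit Types (u f g h : R -> R[i]) (U V F G : bool -> R -> R) (a b x : R).
Hint Resolve measurable_I01 measurable_itvR : core.

Definition part f (i : bool) x : R := if i then complex.Re (f x) else complex.Im (f x).
Definition cpx U x : R[i] := Complex (U true x) (U false x).

Lemma part_cpx U i : part (cpx U) i = U i.
Proof. by case: i. Qed.

Lemma cpx_part f : cpx (part f) = f.
Proof. by apply/funext => x; rewrite /cpx /part; case: (f x). Qed.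

Lemma aeq_part f g : aeq f g -> forall i, ae_eq mu I01 (part f i) (part g i).
Proof. by move=> fg i; apply: aeS fg => x H x01; rewrite /part H. Qed.

Lemma part_aeq f g : (forall i, ae_eq mu I01 (part f i) (part g i)) -> aeq f g.
Proof.
move=> H; apply: (aeS2 _ (H true) (H false)) => x h1 h2 x01.
move: (h1 x01) (h2 x01); rewrite /part; case: (f x) (g x) => [? ?] [? ?] /= -> ->.
by [].
Qed.

Lemma aeq_trans f g h : aeq f g -> aeq g h -> aeq f h.
Proof. by apply: aeS2 => x h1 h2 x01; rewrite h1// h2. Qed.

Lemma aeq_sym f g : aeq f g -> aeq g f.
Proof. by apply: aeS => x h x01; rewrite h. Qed.

Lemma normc_sqr (z : R[i]) : Normc.normc z ^+ 2 = complex.Re z ^+ 2 + complex.Im z ^+ 2.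
Proof. by case: z => p q /=; rewrite sqr_sqrtr// addr_ge0 ?sqr_ge0. Qed.

Lemma normc_ge0 (z : R[i]) : 0 <= Normc.normc z.
Proof. by case: z => p q; exact: sqrtr_ge0. Qed.

Lemma part_le_normc f i x y : `|part f i y - part f i x| <= Normc.normc (f y - f x).
Proof.
rewrite -(@ler_sqr R) ?nnegrE ?normc_ge0// normc_sqr real_normK ?num_real//.
rewrite /part; case: (f y) (f x) => [p q] [p' q'] /=.
by case: i; rewrite ?lerDl ?lerDr sqr_ge0.
Qed.

Lemma normc_le_parts f x y : Normc.normc (f y - f x) <=
  `|part f true y - part f true x| + `|part f false y - part f false x|.
Proof.
rewrite -(@ler_sqr R) ?nnegrE ?normc_ge0 ?addr_ge0// normc_sqr.
rewrite sqrrD !real_normK ?num_real// /part; case: (f y) (f x) => [p q] [p' q'] /=.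
by rewrite lerD2r lerDl mulrn_wge0// mulr_ge0.
Qed.

Lemma ACon_part a b f i : ACon a b f -> abs_continuous a b (part f i).
Proof.
move=> H e e0; have [d d0 Hd] := H e e0; exists d => // L /andP[aL sL] lL.
pose s k := (nth (0 : R, 0 : R) L k).1; pose t k := (nth (0 : R, 0 : R) L k).2.
apply: le_lt_trans (Hd (size L) s t _ _ _).
- rewrite /total_increment (big_nth (0, 0)) big_mkord.
  by apply: ler_sum => k _; exact: part_le_normc.
- by move=> k kL; have /(all_nthP (0, 0))/(_ k kL)/and3P[] := aL.
- by move=> k kL; have /(sortedP (0, 0))/(_ k kL) := sL.
- by move: lL; rewrite /total_length (big_nth (0, 0)) big_mkord.
Qed.

Lemma part_ACon a b f : (forall i, abs_continuous a b (part f i)) -> ACon a b f.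
Proof.
move=> H e e0; have e2 : 0 < e / 2 by rewrite divr_gt0.
have [d1 d10 H1] := H true _ e2; have [d2 d20 H2] := H false _ e2.
exists (Num.min d1 d2); first by rewrite lt_min d10.
move=> n s t st ts; rewrite lt_min => /andP[l1 l2].
pose L := mkseq (fun k => (s k, t k)) n.
have nL : nonoverlapping a b L.
  apply/andP; split.
    apply/(all_nthP (0, 0)) => k; rewrite size_mkseq => kn.
    by rewrite nth_mkseq//=; apply/and3P; have [? []] := st k kn.
  apply/(sortedP (0, 0)) => k; rewrite size_mkseq => kn.
  by rewrite !nth_mkseq//=; [exact: ts|exact: ltnW].
have big (G : R * R -> R) : \sum_(p <- L) G p = \sum_(k < n) G (s k, t k).
  by rewrite big_map -(big_mkord xpredT (fun k => G (s k, t k))) /index_iota subn0.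
have len : total_length L = \sum_(k < n) (t k - s k) by rewrite /total_length big.
have := H1 L nL; have := H2 L nL; rewrite len /total_increment !big /= => /(_ l2) h2 /(_ l1) h1.
apply: (@le_lt_trans _ _ (\sum_(k < n) (`|part f true (t k) - part f true (s k)| +
    `|part f false (t k) - part f false (s k)|))).
  by apply: ler_sum => k _; exact: normc_le_parts.
by rewrite big_split/=; move: h1 h2; lra.
Qed.

Lemma Hnorm2E f : (forall i, weightedL2 (part f i)) ->
  Hnorm2 f = (pair_norm2 (part f))%:E.
Proof.
move=> L; have i1 := wip_integrable (L true) (L true).
have i2 := wip_integrable (L false) (L false).
rewrite /pair_norm2 /wip EFinD /Rintegral !fineK ?integral_fin//.
rewrite -integralD//; last exact: measurable_I01.
apply: eq_integral => x _.
by rewrite normc_sqr -EFinD /part -!expr2 mulrDl.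
Qed.

Lemma Hrep_part f : Hrep f <-> forall i, weightedL2 (part f i).
Proof.
split=> [[m1 [m2 Hf]] i|L]; last first.
  split; first by case: (L true).
  by split; [case: (L false)|rewrite Hnorm2E// ltry].
have mi : measurable_fun I01 (part f i) by case: i.
have h0 x : 0 <= Normc.normc (f x) ^+ 2 * wt x by exact: mulr_ge0 (sqr_ge0 _) (wt_ge0 _).
have ih : mu.-integrable I01 (EFin \o (fun x => Normc.normc (f x) ^+ 2 * wt x)).
  apply/integrableP; split; last first.
    by under eq_integral do rewrite /= ger0_norm//; exact: Hf.
  apply/measurable_EFinP; apply: measurable_funM; last exact: measurable_wt.
  have -> : (fun x => Normc.normc (f x) ^+ 2) = (fun x => part f true x ^+ 2 + part f false x ^+ 2).
    by apply/funext => x; rewrite normc_sqr.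
  by apply: measurable_funD; exact: measurable_funX.
split => //; apply: (integrable_dominated measurable_I01 _ _ ih).
  by apply: measurable_funM; [exact: measurable_funX|exact: measurable_wt].
move=> x _; rewrite ger0_norm; last exact: mulr_ge0 (sqr_ge0 _) (wt_ge0 _).
apply: ler_wpM2r; first exact: wt_ge0.
rewrite normc_sqr /part.
by case: (i); rewrite ?lerDl ?lerDr sqr_ge0.
Qed.

Lemma inH_part f : inH f -> (forall i, measurable_fun I01 (part f i)) ->
  forall i, weightedL2 (part f i).
Proof.
move=> [g [/Hrep_part Lg fg]] mf i; apply: weightedL2_ae (Lg i) (mf i) _.
exact: aeq_part (aeq_sym fg) i.
Qed.

Lemma rho2du_part u i x : part (rho2du u) i x = x ^+ 2 * derive1 (part u i) x.
Proof. by rewrite /rho2du /cder /part; case: i; rewrite /= mul0r ?subr0 ?addr0. Qed.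

Lemma Aop_part u i x : part (Aop u) i x =
  (wt x)^-1 * (- derive1 (part (rho2du u) i) x + 2 * part u i x).
Proof.
rewrite /Aop /cder /part; case: i; case: (u x) => p q /=.
  by rewrite addr0 mul0r subr0 [X in _ - X]mul0r subr0.
by rewrite addr0 mul0r addr0 [X in _ + X]mul0r addr0.
Qed.

(** The first equation of the system holds at every point, because [rho2du] is defined through the
    same [derive1]; only the second one is an almost everywhere statement, since [Aop u] is known
    only as a class in [H]. *)
Lemma inDA_solves u : inDA u -> (forall i, weightedL2 (part u i)) /\
  exists F, [/\ forall i, weightedL2 (F i), forall i, solvesA (part u i) (F i) & aeq (Aop u) (cpx F)].
Proof.
move=> [Hu [ACu [ACv [g [/Hrep_part Lg Ag]]]]].
have ac f i : AC_loc f -> forall a b, 0 < a -> a <= b -> b < 1 -> abs_continuous a b (part f i).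
  by move=> H a b a0 ab b1; apply: ACon_part; exact: H.
have mac f i : AC_loc f -> measurable_fun I01 (part f i).
  move=> H; apply: open_continuous_measurable_fun; first exact: interval_open.
  by move=> x; rewrite inE => /I01P; exact: abs_continuous_continuous (ac f i H).
have Lu := inH_part Hu (mac u ^~ ACu); split => //.
exists (part g); rewrite cpx_part; split => // i.
exists (part (rho2du u) i); split.
  apply: abs_continuous_antider; first exact: ac.
    apply: measurable_funM; [exact: mac|exact: measurable_invX].
  apply: aeW => x /andP[x0 x1]; rewrite rho2du_part; field; by rewrite gt_eqF.
apply: abs_continuous_antider; first exact: ac.
  apply: measurable_funB; first by apply: measurable_funM; [exact: measurable_cst|exact: mac].
  by apply: measurable_funM; [exact: measurable_wt|case: (Lg i)].
have := aeq_part Ag i; apply: aeS => x H x01; rewrite -H; last exact/I01P.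
have := wt_gt0 x01; rewrite Aop_part; move: (wt x) => w w0; field; by rewrite gt_eqF.
Qed.

(** [AC_loc] is not invariant under changes on null sets, so [v] must equal [x^2 u'] at every point.
    It does, because [v / x^2] is continuous and [u] is therefore continuously differentiable. *)
Lemma solves_inDA U F : (forall i, weightedL2 (U i)) -> (forall i, weightedL2 (F i)) ->
  (forall i, solvesA (U i) (F i)) -> inDA (cpx U) /\ aeq (Aop (cpx U)) (cpx F).
Proof.
move=> LU LF HU.
have Hv i : antider 0 1 (U i) (fun x => part (rho2du (cpx U)) i x / x ^+ 2) /\
    antider 0 1 (part (rho2du (cpx U)) i) (fun x => 2 * U i x - wt x * F i x).
  have [v [h1 h2]] := HU i.
  have E x : 0 < x < 1 -> v x = part (rho2du (cpx U)) i x.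
    move=> x01; have /andP[x0 _] := x01; rewrite rho2du_part part_cpx.
    have cv : {for x, continuous (fun x => v x / x ^+ 2)}.
      by apply: continuousM; [exact: antider_continuous h2 x01|exact: continuous_invX].
    have dU := antider_derive h1 x01 cv.
    by rewrite derive1E derive_val; field; rewrite gt_eqF.
  split; last exact: antider_ext h2 _ _.
  by apply: antider_ext h1 _ _ => // x x01; rewrite E.
have AE : aeq (Aop (cpx U)) (cpx F).
  apply: part_aeq => i; have [_ h2] := Hv i.
  apply: aeS (antider_ae_derive h2) => x H /I01P x01; have [_ E] := H x01.
  rewrite Aop_part !part_cpx E; have := wt_gt0 x01; move: (wt x) => w w0.
  by field; rewrite gt_eqF.
split => //; split.
  by exists (cpx U); split; [apply/Hrep_part => i; rewrite part_cpx|exact: aeW].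
split.
  move=> a b a0 ab b1; apply: part_ACon => i; rewrite part_cpx.
  exact: antider_abs_continuous (Hv i).1 a0 ab b1.
split.
  by move=> a b a0 ab b1; apply: part_ACon => i; exact: antider_abs_continuous (Hv i).2 a0 ab b1.
by exists (cpx F); split => //; apply/Hrep_part => i; rewrite part_cpx.
Qed.

Lemma res_op_part (a b : R) u F : aeq (Aop u) (cpx F) ->
  aeq (res_op (Complex a b) u) (cpx (fun i x => - (F i x + pair_shift a b (part u) i x))).
Proof.
apply: aeS => x H x01; rewrite /res_op /A0op H// /cpx /pair_shift /part.
case: (u x) => p q; apply/eqP; rewrite eq_complex /=; apply/andP; split; apply/eqP; ring.
Qed.

Lemma aeq_zero_part u : (forall x, 0 < x < 1 -> forall i, part u i x = 0) -> aeq u (fun=> 0).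
Proof.
move=> H; apply: part_aeq => i; apply: aeW => x /I01P x01.
by rewrite H// /part; case: i.
Qed.

(** * Parameters off the half-line *)

Section OffSpectrum.
Variables a b : R.
Hypothesis off : ~ (b = 0 /\ 0 <= a).

Lemma A0_inj_off : A0_inj (Complex a b).
Proof.
move=> u /inDA_solves[Lu [F [LF HF AF]]] /(aeq_trans (aeq_sym (res_op_part a b AF))) /aeq_part H.
have [al [be [d [d0 dal om dab]]]] := rotation_exists off.
have Z : solves_path a b 1 (part u) (fun _ _ => 0).
  move=> i; apply: solvesA_ae (HF i) _ _.
    by apply: (weightedL2B weightedL20 _).1; apply: weightedL2Z; exact: pairL2_shift.
  by apply: aeS (H i) => x h x01; have := h x01; rewrite part_cpx /part; case: (i) => /=; lra.
have o1 : 0 <= (1 : R) <= 1 by rewrite ler01 lexx.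
have := path_lower_bound d0 dal om dab o1 Lu (fun=> weightedL20) Z.
have -> : pair_norm2 (fun (_ : bool) (_ : R) => 0 : R) = 0.
  have w0 : wip (fun _ : R => 0) (fun _ : R => 0) = 0 :> R.
    by rewrite /wip; under eq_Rintegral do rewrite !mul0r; rewrite /Rintegral integral0.
  by rewrite /pair_norm2 w0 addr0.
rewrite mulr0 pmulr_rle0 ?exprn_gt0// => n0; apply: part_aeq => i.
have : wip (part u i) (part u i) = 0.
  by apply/eqP; rewrite eq_le wip_ge0 andbT; apply: le_trans (wip_le_pair_norm2 _ _) n0.
move/(wip_eq0 (Lu i)); apply: aeS => x h x01; rewrite h//.
by rewrite /part; case: (i).
Qed.

Lemma A0_surj_off : A0_surj (Complex a b).
Proof.
move=> f [g [/Hrep_part Lg fg]].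
have [al [be [d [d0 dal om dab]]]] := rotation_exists off.
(* The path ends at [A_0 - lam], whereas [res_op] is [lam - A_0]. *)
pose F i x := -1 * part g i x.
have LF : pairL2 F by move=> i; exact: weightedL2Z.
have [U [LU HU]] := path_surj1 d0 dal om dab LF.
have LS i : weightedL2 (fun x => F i x - 1 * pair_shift a b U i x).
  by apply: weightedL2B => //; apply: weightedL2Z; exact: pairL2_shift.
have [DU AU] := solves_inDA LU LS HU.
exists (cpx U); split => //; apply: aeq_trans (res_op_part a b AU) _.
apply: aeq_trans (aeq_sym fg); rewrite -[X in aeq _ X]cpx_part; apply: aeW => x _.
rewrite /cpx /F; have -> : part (fun x => Complex (U true x) (U false x)) = U.
  by apply/funext => i; exact: (part_cpx U).
by congr Complex; ring.
Qed.

End OffSpectrum.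

Lemma A0_dense_range_of_surj (lam : R[i]) : A0_surj lam -> A0_dense_range lam.
Proof.
move=> S f Hf e e0; have [|u [Du Hu]] := S f; first by exists f; split => //; exact: aeW.
exists u; split => //; exists f; split => //; split => //.
rewrite /lt_ebar /Hnorm2; under eq_integral do rewrite subrr normc_sqr /= expr0n addr0 mul0r.
by rewrite integral0 lte_fin.
Qed.

(** * Parameters on the half-line *)

Section OnSpectrum.
Variable a : R.
Hypothesis a0 : 0 <= a.

Lemma A0_inj_on : A0_inj (Complex a 0).
Proof.
move=> u /inDA_solves[Lu [F [LF HF AF]]] /(aeq_trans (aeq_sym (res_op_part a 0 AF))) /aeq_part H.
apply: aeq_zero_part => x x01 i.
have c01 : 0 <= (0 : R) < 1 by rewrite lexx ltr01.
apply: (no_decay a0 c01 (Lu i) (HF i) _ x01).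
apply: aeS (H i) => y h y01; have := h (proj2 (I01P y) y01).
by rewrite part_cpx /pair_shift /part; case: (i) => /=; lra.
Qed.

Lemma not_A0_surj_on : ~ A0_surj (Complex a 0).
Proof.
move=> S; apply: (not_surjective_real a0) => f Lf.
(* For a real parameter the two parts decouple, so the real part of a complex solution solves the
   real problem. *)
have [|u [/inDA_solves[Lu [F [LF HF AF]]] Hu]] := S (cpx (fun i => if i then f else fun=> 0)).
  exists (cpx (fun i => if i then f else fun=> 0)); split; last exact: aeW.
  by apply/Hrep_part => i; rewrite part_cpx; case: i => //; exact: weightedL20.
have /aeq_part/(_ true) := aeq_trans (aeq_sym (res_op_part a 0 AF)) Hu.
rewrite !part_cpx => H; exists (part u true) => //.
apply: solvesA_ae (HF true) _ _; first exact: (weightedL2_res a (Lu true) Lf).1.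
by apply: aeS H => x h x01; have := h x01; rewrite /pair_shift /=; lra.
Qed.

Lemma A0_dense_range_on : A0_dense_range (Complex a 0).
Proof.
move=> f /Hrep_part Lf e e0; have e2 : 0 < e / 2 by rewrite divr_gt0.
have /choice[U /choice[H HUH]] : forall i, exists u h : R -> R,
    [/\ weightedL2 u, weightedL2 h, solves_res a u h &
    wip (fun x => h x - part f i x) (fun x => h x - part f i x) < e / 2].
  by move=> i; exact: dense_range_real.
have LU i : weightedL2 (U i) by case: (HUH i).
have LH i : weightedL2 (H i) by case: (HUH i).
have S i : solves_res a (U i) (H i) by case: (HUH i).
have [DU AU] := solves_inDA LU (fun i => weightedL2_res a (LU i) (LH i)) S.
exists (cpx U); split => //; exists (cpx H); split.
  by apply/Hrep_part => i; rewrite part_cpx.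
have E i : part (fun x => cpx H x - f x) i = (fun x => H i x - part f i x).
  by apply/funext => x; rewrite /part /cpx; case: (f x) => p q; case: i.
split.
  apply: aeq_trans (res_op_part a 0 AU) _; apply: part_aeq => i; apply: aeW => x _.
  by rewrite !part_cpx /pair_shift part_cpx; case: (i); ring.
rewrite /lt_ebar Hnorm2E; last by move=> i; rewrite E; exact: weightedL2B.
rewrite lte_fin /pair_norm2 !E; have [_ _ _] := HUH true; have [_ _ _] := HUH false; lra.
Qed.

End OnSpectrum.
End ComplexFunctions.

Local Open Scope complex_scope.

Theorem mainTheorem1 (R : realType) :
  forall lam : R[i],
    (spectrum lam <-> (complex.Im lam = 0 /\ 0 <= complex.Re lam)) /\
    (sigma_c lam <-> (complex.Im lam = 0 /\ 0 <= complex.Re lam)) /\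
    ~ sigma_p lam /\ ~ sigma_r lam.
Proof.
case=> a b /=.
have [[-> a0]|off] := pselect (b = 0 /\ 0 <= a).
  have inj := A0_inj_on a0; have ns := not_A0_surj_on a0; have dn := A0_dense_range_on a0.
  by rewrite /spectrum /resolvent_set /sigma_c /sigma_p /sigma_r; tauto.
have inj := A0_inj_off off; have sj := A0_surj_off off.
have dn := A0_dense_range_of_surj sj.
by rewrite /spectrum /resolvent_set /sigma_c /sigma_p /sigma_r; tauto.
Qed.
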